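(* Let $\nu,\mu$ be normal weights on $\mathbb D$, let $\alpha>-1$ and let $\omega$ be a weight function such that $\{\nu,\omega\}$ is a normal pair with $\nu(r)\omega(r)=(1-r^2)^\alpha$ for $0\le r<1$. Let $g\in H(\mathbb D)$ and let $\phi$ be an analytic self-map of $\mathbb D$ such that $S_g^\phi:\mathcal H^\infty_\nu\to\mathcal B_\mu$ is bounded. Then the following statements are equivalent. (a) $S_g^\phi:\mathcal H^0_\nu\to\mathcal B_\mu$ is nuclear. (b) $S_g^\phi:\mathcal H^\infty_\nu\to\mathcal B_\mu$ is nuclear. (c) $$\int_{\mathbb D}\left[\sup_{z\in\mathbb D}\frac{\mu(z)|g(z)|}{|1-\bar\zeta\phi(z)|^{\alpha+3}}\right]\frac{(1-|\zeta|^2)^\alpha}{\nu(\zeta)}\,dA(\zeta)<\infty.$$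
   Context: $\mathbb D$ is the open unit disk in $\mathbb C$, $H(\mathbb D)$ the space of analytic functions on $\mathbb D$, and $dA$ normalized Lebesgue measure on $\mathbb D$. For $g\in H(\mathbb D)$ and an analytic map $\phi:\mathbb D\to\mathbb D$, $(S_g^\phi f)(z)=\int_0^z f'(\phi(\zeta))g(\zeta)\,d\zeta$ for $f\in H(\mathbb D)$, $z\in\mathbb D$. A radial weight is a continuous positive function $\nu$ on $\mathbb D$ with $\nu(z)=\nu(|z|)$, non-increasing in $|z|$. It is normal if: (I) there is $\beta>0$ such that $r\mapsto\nu(r)/(1-r^2)^\beta$ is almost increasing on $[0,1)$; and (II) there is $\gamma>0$ such that $r\mapsto\nu(r)/(1-r^2)^\gamma$ is almost decreasing on $[0,1)$. (A function $h$ is almost increasing if there is $C>0$ with $h(r)\le C h(s)$ for all $r\le s$; almost decreasing if $h(s)\le C h(r)$ for all $r\le s$.) $\{\nu,\omega\}$ is a normal pair if $\nu$ is normal, $\omega$ is radial, positive and continuous with $\int_0^1\omega(r)\,dr<\infty$, and $\nu(r)\omega(r)=(1-r^2)^\alpha$, $0\le r<1$, for some $\alpha>\beta-1$, where $\beta>0$ is an exponent as in (I) for $\nu$. $\mathcal H^\infty_\nu=\{f\in H(\mathbb D):\|f\|_{\mathcal H^\infty_\nu}=\sup_{z\in\mathbb D}\nu(z)|f(z)|<\infty\}$ and $\mathcal H^0_\nu=\{f\in H(\mathbb D):\lim_{|z|\to1^-}\nu(z)|f(z)|=0\}$, with the norm of $\mathcal H^\infty_\nu$. The weighted Bloch space is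 $\mathcal B_\mu=\{f\in H(\mathbb D):\sup_{z\in\mathbb D}\mu(z)|f'(z)|<\infty\}$ with norm $|f(0)|+\sup_{z\in\mathbb D}\mu(z)|f'(z)|$. A linear operator $T:X\to Y$ between Banach spaces is nuclear if there are sequences $(x_k')\subset X'$ (the dual of $X$) and $(y_k)\subset Y$ with $\sum_k\|x_k'\|\|y_k\|<\infty$ and $Tx=\sum_k x_k'(x)y_k$ for all $x\in X$. *)

(* Defs.v *)
From HB Require Import structures.
From mathcomp Require Import all_boot all_order all_algebra.
From mathcomp Require Import all_classical all_reals all_analysis.
From mathcomp Require Import complex.

Set Implicit Arguments.
Unset Strict Implicit.
Unset Printing Implicit Defensive.

Import Order.TTheory GRing.Theory Num.Theory.
Import numFieldNormedType.Exports.

Local Open Scope classical_set_scope.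
Local Open Scope ring_scope.

(* R : realType plays the role of the field of real numbers and R[i] that of
   the complex numbers.  The library norm `|z| of z : R[i] lives in R[i];
   cabs is the real-valued modulus. *)

Notation cabs := complex.ComplexField.Normc.normc.

(* The topology and the complex derivative come from the regular module
   R[i]^o: derivable f z 1 and derive1 f z are complex differentiability and
   the complex derivative. *)

Definition disc (R : realType) : set R[i] := [set z | cabs z < 1].
Arguments disc : clear implicits.

Definition cderiv (R : realType) (f : R[i] -> R[i]) : R[i] -> R[i] :=
  derive1 (f : R[i]^o -> R[i]^o).

Definition analytic_on_disc (R : realType) (f : R[i] -> R[i]) : Prop :=
  forall z, disc R z -> derivable (f : R[i]^o -> R[i]^o) z 1.

(* A function on the disc is represented by its extension by 0 to R[i], so that
   equality in R[i] -> R[i] is equality on the disc. *)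
Definition HD (R : realType) : set (R[i] -> R[i]) :=
  [set f | analytic_on_disc f /\ forall z, ~ disc R z -> f z = 0].
Arguments HD : clear implicits.

Definition analytic_self_map (R : realType) (phi : R[i] -> R[i]) : Prop :=
  analytic_on_disc phi /\ forall z, disc R z -> disc R (phi z).

(* Weights are functions R[i] -> R of which only the values on the disc matter;
   nu(r) is nu r%:C. *)

Definition radial (R : realType) (nu : R[i] -> R) : Prop :=
  forall z, disc R z -> nu z = nu (cabs z)%:C%C.

Definition positive_on_disc (R : realType) (nu : R[i] -> R) : Prop :=
  forall z, disc R z -> 0 < nu z.

Definition continuous_on_disc (R : realType) (nu : R[i] -> R) : Prop :=
  forall z, disc R z -> {for z, continuous (nu : R[i]^o -> R)}.

Definition radial_weight (R : realType) (nu : R[i] -> R) : Prop :=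
  [/\ continuous_on_disc nu, positive_on_disc nu, radial nu &
      forall z w, disc R z -> disc R w -> cabs z <= cabs w -> nu w <= nu z].

Definition almost_increasing (R : realType) (h : R -> R) : Prop :=
  exists2 C : R, 0 < C &
    forall r s, 0 <= r -> r <= s -> s < 1 -> h r <= C * h s.

Definition almost_decreasing (R : realType) (h : R -> R) : Prop :=
  exists2 C : R, 0 < C &
    forall r s, 0 <= r -> r <= s -> s < 1 -> h s <= C * h r.

Definition weight_quotient (R : realType) (nu : R[i] -> R) (b : R) : R -> R :=
  fun r => nu r%:C%C / (1 - r ^+ 2) `^ b.

Definition normal_I (R : realType) (nu : R[i] -> R) (beta : R) : Prop :=
  0 < beta /\ almost_increasing (weight_quotient nu beta).

Definition normal_II (R : realType) (nu : R[i] -> R) (gamma : R) : Prop :=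
  0 < gamma /\ almost_decreasing (weight_quotient nu gamma).

Definition normal_weight (R : realType) (nu : R[i] -> R) : Prop :=
  [/\ radial_weight nu, exists beta, normal_I nu beta &
      exists gamma, normal_II nu gamma].

(* {nu, omega} is a normal pair with nu omega = (1 - r^2)^alpha. *)
Definition normal_pair (R : realType) (nu omega : R[i] -> R) (alpha : R) : Prop :=
  [/\ normal_weight nu,
      [/\ radial omega, positive_on_disc omega, continuous_on_disc omega &
          (\int[lebesgue_measure]_(r in `[0%R, 1%R[) (omega r%:C%C)%:E < +oo)%E],
      (forall r, 0 <= r -> r < 1 ->
         nu r%:C%C * omega r%:C%C = (1 - r ^+ 2) `^ alpha) &
      exists2 beta, normal_I nu beta & beta - 1 < alpha].

(* A linear subspace of V with a norm that is finite on it; the value of snorm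
   outside the subspace carries no meaning.  The axioms are not recorded. *)
Record normed_subspace (R : realType) (V : lmodType R[i]) := NormedSubspace {
  carrier : set V ;
  snorm : V -> \bar R }.

Definition linear_on (R : realType) (V W : lmodType R[i]) (X : set V)
    (T : V -> W) : Prop :=
  forall (a : R[i]) f g, X f -> X g -> T (a *: f + g) = a *: T f + T g.

Definition bounded_operator (R : realType) (V W : lmodType R[i])
    (X : normed_subspace V) (Y : normed_subspace W) (T : V -> W) : Prop :=
  (forall f, carrier X f -> carrier Y (T f)) /\
  exists M : R, forall f, carrier X f -> (snorm Y (T f) <= M%:E * snorm X f)%E.

Definition dual_norm (R : realType) (V : lmodType R[i]) (X : normed_subspace V)
    (x' : V -> R[i]) : \bar R :=
  ereal_sup [set (cabs (x' f))%:E | f in [set f | carrier X f /\ (snorm X f <= 1)%E]].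

Definition dual (R : realType) (V : lmodType R[i]) (X : normed_subspace V) :
    set (V -> R[i]) :=
  [set x' | linear_on (carrier X) (x' : V -> R[i]^o) /\ (dual_norm X x' < +oo)%E].

Definition nuclear (R : realType) (V W : lmodType R[i])
    (X : normed_subspace V) (Y : normed_subspace W) (T : V -> W) : Prop :=
  [/\ forall f, carrier X f -> carrier Y (T f),
      linear_on (carrier X) T &
      exists (x' : nat -> V -> R[i]) (y : nat -> W),
        [/\ forall k, dual X (x' k),
            forall k, carrier Y (y k),
            (\sum_(0 <= k <oo) dual_norm X (x' k) * snorm Y (y k) < +oo)%E &
            forall f, carrier X f ->
              snorm Y (T f - \sum_(0 <= k < n) x' k f *: y k) @[n --> \oo]
                --> 0%E]].

Definition sup_norm (R : realType) (nu : R[i] -> R) (f : R[i] -> R[i]) : \bar R :=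
  ereal_sup [set (nu z * cabs (f z))%:E | z in disc R].

Definition Hinf (R : realType) (nu : R[i] -> R) :
    normed_subspace (R[i] -> R[i] : lmodType R[i]) :=
  NormedSubspace
    ([set f | HD R f /\ (sup_norm nu f < +oo)%E] : set (R[i] -> R[i]))
    (sup_norm nu).

Definition Hzero (R : realType) (nu : R[i] -> R) :
    normed_subspace (R[i] -> R[i] : lmodType R[i]) :=
  NormedSubspace
    ([set f | HD R f /\
       forall e : R, 0 < e ->
         \forall r \near 1^'-, forall z, cabs z = r -> nu z * cabs (f z) < e]
     : set (R[i] -> R[i]))
    (sup_norm nu).

Definition Bloch (R : realType) (mu : R[i] -> R) :
    normed_subspace (R[i] -> R[i] : lmodType R[i]) :=
  NormedSubspace
    ([set f | HD R f /\ (sup_norm mu (cderiv f) < +oo)%E] : set (R[i] -> R[i]))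
    (fun f => (cabs (f 0%R))%:E + sup_norm mu (cderiv f))%E.

Definition cintegral01 (R : realType) (F : R -> R[i]) : R[i] :=
  ((\int[lebesgue_measure]_(t in `[0%R, 1%R]) complex.Re (F t)) +i*
   (\int[lebesgue_measure]_(t in `[0%R, 1%R]) complex.Im (F t)))%C.

(* The integral from 0 to z is taken along the segment zeta = t z. *)
Definition Sop (R : realType) (g phi f : R[i] -> R[i]) : R[i] -> R[i] :=
  fun z => if z \in disc R then
    cintegral01 (fun t => cderiv f (phi (t%:C%C * z)) * g (t%:C%C * z) * z)
  else 0.

(* dA = dx dy / pi in the coordinates zeta = x + i y. *)
Definition disc_integral (R : realType) (F : R[i] -> \bar R) : \bar R :=
  ((pi^-1)%:E *
   \int[(@lebesgue_measure R) \x (@lebesgue_measure R)]_(p in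
      [set p : R * R | disc R (p.1 +i* p.2)%C]) F (p.1 +i* p.2)%C)%E.

(* Main.v *)
(** Let d_m = 2^-m and let n be a large integer.

    From (a) to (c): the kernels (1 - p^* w)^-(n+2) at the lattice points
    p = (1 - d_m) e^(2 pi i j / 2^m), with weights d_m^(n+2) / nu(p), have a sum of
    moduli that is bounded by a constant times 1 / nu (a discrete Forelli-Rudin
    estimate).  By duality, testing a nuclear representation on them bounds the
    weighted sum over the lattice of sup_z mu |g| |1 - p^* phi|^-(n+3) by
    a multiple of sum_k |x'_k| |y_k|.  For zeta in a dyadic cell, the integrand
    of (c), with its exponent alpha + 3, is dominated by a sum over the lattice
    points of all coarser cells containing zeta, with geometric weights, and
    integration gives (c).

    From (c) to (b): (c) bounds a similar sum over the cells, with the lattice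
    points replaced by cell centres c.  The derivative f' is reproduced from f by
    the kernel zeta^* (1 - zeta^* w)^-(n+3) and the weight (1 - |zeta|^2)^n.  On
    each cell, the kernel expands in powers of zeta^* - c^* with a ratio < 1 that
    does not depend on the cell.  Integrating f against these powers gives the
    functionals of a nuclear representation on the space of all f.  *)
Require Import Defs.
From HB Require Import structures.
From mathcomp Require Import all_boot all_order all_algebra.
From mathcomp Require Import all_classical all_reals all_analysis.
From mathcomp Require Import complex.
From mathcomp Require Import measurable_realfun.
From mathcomp Require Import ring lra.
Set Implicit Arguments.
Unset Strict Implicit.
Unset Printing Implicit Defensive.
Import Order.TTheory GRing.Theory Num.Theory.
Import numFieldNormedType.Exports.
Local Open Scope classical_set_scope.
Local Open Scope ring_scope.

(** * Modulus and complex derivative *)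

Section Modulus.
Variable R : realType.
Local Notation C := R[i].
Implicit Types z w : C.

(** The supremum in (c) is never shown to be measurable: the area integral enters only by comparison
    with sums of indicators of squares, above by a cover and below by disjoint squares. The
    reproducing formula involves no plane integral either, only iterated integrals of continuous
    functions over segments.

    The exponent [alpha + 3] is real and [nu] is controlled only up to constants, so no kernel
    integral is explicit. At the radii 1 - 2^-m the two halves of normality become geometric bounds
    on the growth and decay of [nu]. The integer n must meet two demands: 2^beta * 2^-(n+1) < 1
    bounds the discrete Forelli-Rudin sum, and [alpha <= n] allows the passage from the exponent
    [alpha + 3] to the integer n + 3 in the lower bound of the integrand. The condition
    [beta - 1 < alpha] gives the ratio 2^(beta - alpha - 1) < 1 in the sum over the descendants of a
    cell. Boundedness of the operator, tested on the identity, bounds mu |g| and makes every kernel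
    supremum finite. *)

Lemma cabs_ge0 z : 0 <= cabs z.
Proof. by case: z => a b /=; apply: sqrtr_ge0. Qed.

Lemma cabsM z w : cabs (z * w) = cabs z * cabs w.
Proof. exact: ComplexField.Normc.normcM. Qed.

Lemma cabsV z : cabs z^-1 = (cabs z)^-1.
Proof. exact: ComplexField.Normc.normcV. Qed.

Lemma cabs0 : cabs (0 : C) = 0.
Proof. exact: ComplexField.Normc.normc0. Qed.

Lemma cabs1 : cabs (1 : C) = 1.
Proof. exact: ComplexField.Normc.normc1. Qed.

Lemma cabsX z n : cabs (z ^+ n) = cabs z ^+ n.
Proof. by elim: n => [|n IH]; rewrite ?expr0 ?cabs1// !exprS cabsM IH. Qed.

Lemma cabs_eq0 z : (cabs z == 0) = (z == 0).
Proof.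
by apply/eqP/eqP => [/ComplexField.Normc.eq0_normc//|->]; rewrite cabs0.
Qed.

Lemma cabs_gt0 z : (0 < cabs z) = (z != 0).
Proof. by rewrite lt_neqAle cabs_ge0 andbT eq_sym cabs_eq0. Qed.

Lemma cabsN z : cabs (- z) = cabs z.
Proof. exact: normcN. Qed.

Lemma cabsD z w : cabs (z + w) <= cabs z + cabs w.
Proof. exact: le_normcD. Qed.

Lemma cabsB z w : cabs (z - w) = cabs (w - z).
Proof. by rewrite -cabsN opprB. Qed.

Lemma cabsBD z w : cabs (z - w) <= cabs z + cabs w.
Proof. by rewrite (le_trans (cabsD _ _))// cabsN. Qed.

Lemma cabs_le_sub z w : cabs z <= cabs w + cabs (z - w).
Proof. by rewrite -{1}[z](subrK w) addrC; apply: cabsD. Qed.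

Lemma cabs_real (x : R) : cabs (x%:C)%C = `|x|.
Proof. by rewrite /= expr0n addr0 sqrtr_sqr. Qed.

Lemma cabs_nat n : cabs (n%:R : C) = n%:R.
Proof. by rewrite -(rmorph_nat (real_complex R)) cabs_real normr_nat. Qed.

Lemma cabs_conj z : cabs (z^*)%C = cabs z.
Proof. by case: z => a b /=; rewrite sqrrN. Qed.

Lemma cabs_sqr z : cabs z ^+ 2 = complex.Re z ^+ 2 + complex.Im z ^+ 2.
Proof. by case: z => a b /=; rewrite sqr_sqrtr// addr_ge0// sqr_ge0. Qed.

Lemma mul_conj z : z * (z^*)%C = ((cabs z ^+ 2)%:C)%C.
Proof.
rewrite cabs_sqr; case: z => a b /=; apply/eqP; rewrite eq_complex /=.
by apply/andP; split; apply/eqP; ring.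
Qed.

Lemma cabs_Re z : `|complex.Re z| <= cabs z.
Proof.
rewrite -(@ler_pXn2r _ 2)// ?nnegrE ?normr_ge0 ?cabs_ge0//.
by rewrite cabs_sqr real_normK ?num_real// lerDl sqr_ge0.
Qed.

Lemma cabs_Im z : `|complex.Im z| <= cabs z.
Proof.
rewrite -(@ler_pXn2r _ 2)// ?nnegrE ?normr_ge0 ?cabs_ge0//.
by rewrite cabs_sqr real_normK ?num_real// lerDr sqr_ge0.
Qed.

Lemma cabs_le_ReIm z : cabs z <= `|complex.Re z| + `|complex.Im z|.
Proof.
rewrite -(@ler_pXn2r _ 2)// ?nnegrE ?addr_ge0 ?cabs_ge0//.
rewrite cabs_sqr sqrrD !real_normK ?num_real// -addrA lerD2l lerDr.
by rewrite mulrn_wge0// mulr_ge0.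
Qed.

Lemma cabs_sum (I : Type) (r : seq I) (P : pred I) (F : I -> C) :
  cabs (\sum_(i <- r | P i) F i) <= \sum_(i <- r | P i) cabs (F i).
Proof.
elim/big_ind2: _ => [|x a y b xa yb|//]; first by rewrite cabs0.
by rewrite (le_trans (cabsD _ _))// lerD.
Qed.

Lemma normC_cabs z : `|z| = ((cabs z)%:C)%C.
Proof. by []. Qed.

Lemma disc_one_sub (z w : C) : cabs z < 1 -> cabs w <= 1 -> 1 - z * w != 0.
Proof.
move=> z1 w1; rewrite subr_eq0; apply/eqP => /(congr1 (@ComplexField.Normc.normc R)).
rewrite cabs1 cabsM => e; have := cabs_ge0 z; have := cabs_ge0 w; nra.
Qed.

(** Remainder form of the complex derivative, with real epsilon and real moduli. The increment 0 is
    allowed, so nothing is divided. *)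
Definition cdiff (f : C -> C) (z l : C) : Prop :=
  forall e : R, 0 < e -> exists2 d : R, 0 < d &
    forall h, cabs h < d -> cabs (f (z + h) - f z - l * h) <= e * cabs h.

Lemma cdiff_cvg f z l : cdiff f z l <->
  (h^-1 *: ((f : C^o -> C^o) (h + z) - f z) @[h --> (0:C^o)^'] --> (l : C^o)).
Proof.
split=> [df|/cvgrPdist_le df].
- apply/cvgrPdist_le => e e0.
  (* In the order of [R[i]] the inequality [0 < e] forces [e] to be real. *)
  have [e' e'0 ee'] : exists2 e' : R, 0 < e' & e = (e'%:C)%C.
    exists (complex.Re e); first by move: e0; rewrite ltcE => /andP[].
    by case: e e0 => a b; rewrite ltcE/= => /andP[/eqP -> _].
  have [d d0 H] := df _ e'0.
  exists (d%:C)%C => /=; first by rewrite ltcR.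
  move=> h /=; rewrite sub0r normrN => hd hn0; rewrite ee' normC_cabs lecR.
  have {}hd : cabs h < d by move: hd; rewrite normC_cabs ltcR.
  have := H _ hd.
  have -> : l - h^-1 *: (f (h + z) - f z) = - (h^-1 * (f (z + h) - f z - l * h)).
    rewrite mulrBr [l * h]mulrC mulKf// opprB addrC [h + z]addrC.
    by rewrite addrC.
  rewrite cabsN cabsM cabsV => {}H.
  by rewrite mulrC ler_pdivrMr ?cabs_gt0.
- move=> e e0; have := df (e%:C)%C; rewrite ltcR => /(_ e0) /= [d /= d0 H].
  exists (complex.Re d); first by move: d0; rewrite ltcE => /andP[].
  move=> h hd; have [->|h0] := eqVneq h 0.
    by rewrite addr0 subrr mulr0 subr0 cabs0 mulr0.
  have /= := H h; rewrite sub0r normrN !normC_cabs.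
  have -> : d = ((complex.Re d)%:C)%C.
    by case: d d0 {H hd} => a b; rewrite ltcE/= => /andP[/eqP -> _].
  rewrite ltcR lecR => /(_ hd h0).
  have -> : l - h^-1 *: (f (h + z) - f z) = - (h^-1 * (f (z + h) - f z - l * h)).
    rewrite mulrBr [l * h]mulrC mulKf// opprB addrC [h + z]addrC.
    by rewrite addrC.
  by rewrite cabsN cabsM cabsV mulrC ler_pdivrMr ?cabs_gt0.
Qed.

Lemma cdiff_derivable f z l : cdiff f z l ->
  derivable (f : C^o -> C^o) z 1 /\ cderiv f z = l.
Proof.
move=> /cdiff_cvg df.
have E : (fun h : C^o => h^-1 *: (((f : C^o -> C^o) \o shift z) (h *: (1 : C^o)) - f z)) =
         (fun h : C^o => h^-1 *: ((f : C^o -> C^o) (h + z) - f z)).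
  by apply/funext => h /=; rewrite [h *: 1]mulr1.
split; first by rewrite /derivable E; apply/cvg_ex; exists l.
exact: (@cvg_lim (C^o) (@norm_hausdorff _ _) _ _ _ _ _ df).
Qed.

Lemma derivable_cdiff f z : derivable (f : C^o -> C^o) z 1 ->
  cdiff f z (cderiv f z).
Proof.
move=> df; apply/cdiff_cvg; rewrite /cderiv /derive1.
move: df; rewrite /derivable.
have -> : (fun h : C^o => h^-1 *: (((f : C^o -> C^o) \o shift z) (h *: (1 : C^o)) - f z)) =
         (fun h : C^o => h^-1 *: ((f : C^o -> C^o) (h + z) - f z)).
  by apply/funext => h /=; rewrite [h *: 1]mulr1.
by [].
Qed.

End Modulus.

#[local] Arguments ComplexField.Normc.normc : simpl never.
#[local] Arguments real_complex_def : simpl never.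

(** * Integrals of complex functions over segments *)

Section ComplexIntegral.
Variable R : realType.
Local Notation C := R[i].
Local Notation mu := (@lebesgue_measure R).
Implicit Types (h H : R -> C) (a b t : R).

Definition rcont h t : Prop := forall e : R, 0 < e ->
  exists2 d : R, 0 < d & forall s, `|s - t| < d -> cabs (h s - h t) <= e.

(** Two-sided continuity at each point, the two ends included, so the behaviour of [h] just outside
    the interval matters. *)
Definition cont_on a b h : Prop := forall t, a <= t <= b -> rcont h t.

Definition rderiv H t (l : C) : Prop := forall e : R, 0 < e ->
  exists2 d : R, 0 < d & forall s : R, `|s| < d ->
    cabs (H (t + s) - H t - (s%:C)%C * l) <= e * `|s|.

Definition cint a b h : C :=
  ((\int[mu]_(t in `[a, b]) complex.Re (h t)) +i*
   (\int[mu]_(t in `[a, b]) complex.Im (h t)))%C.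

Lemma cintegral01E (F : R -> C) : cintegral01 F = cint 0 1 F.
Proof. by []. Qed.

Lemma ReC (x : R) : complex.Re (x%:C)%C = x.
Proof. by []. Qed.

Lemma ImC (x : R) : complex.Im (x%:C)%C = 0.
Proof. by []. Qed.

Lemma ReB (z w : C) : complex.Re (z - w) = complex.Re z - complex.Re w.
Proof. by case: z w => [a b] [c d]. Qed.

Lemma ImB (z w : C) : complex.Im (z - w) = complex.Im z - complex.Im w.
Proof. by case: z w => [a b] [c d]. Qed.

Lemma ReD (z w : C) : complex.Re (z + w) = complex.Re z + complex.Re w.
Proof. by case: z w => [a b] [c d]. Qed.

Lemma ImD (z w : C) : complex.Im (z + w) = complex.Im z + complex.Im w.
Proof. by case: z w => [a b] [c d]. Qed.

Lemma ReM (z w : C) : complex.Re (z * w) =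
  complex.Re z * complex.Re w - complex.Im z * complex.Im w.
Proof. by case: z w => [a b] [c d]. Qed.

Lemma ImM (z w : C) : complex.Im (z * w) =
  complex.Re z * complex.Im w + complex.Im z * complex.Re w.
Proof. by case: z w => [a b] [c d]. Qed.

Lemma rcont_Re h t : rcont h t -> {for t, continuous (fun s => complex.Re (h s))}.
Proof.
move=> ch; apply/(@cvgrPdist_le _ R^o) => e e0; have [d d0 H] := ch _ e0.
exists d => //= s /=; rewrite distrC => /H; apply: le_trans.
by rewrite distrC -ReB cabs_Re.
Qed.

Lemma rcont_Im h t : rcont h t -> {for t, continuous (fun s => complex.Im (h s))}.
Proof.
move=> ch; apply/(@cvgrPdist_le _ R^o) => e e0; have [d d0 H] := ch _ e0.
exists d => //= s /=; rewrite distrC => /H; apply: le_trans.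
by rewrite distrC -ImB cabs_Im.
Qed.

Lemma within_cont (f : R -> R) a b : (forall t, a <= t <= b -> {for t, continuous f}) ->
  {within `[a, b], continuous f}.
Proof.
move=> cf; apply: continuous_in_subspaceT => t; rewrite inE/= in_itv/=; exact: cf.
Qed.

Lemma cont_on_integrable_Re a b h : cont_on a b h ->
  mu.-integrable `[a, b] (EFin \o (fun t => complex.Re (h t))).
Proof.
move=> ch; apply: continuous_compact_integrable; first exact: segment_compact.
by apply: within_cont => t /ch; exact: rcont_Re.
Qed.

Lemma cont_on_integrable_Im a b h : cont_on a b h ->
  mu.-integrable `[a, b] (EFin \o (fun t => complex.Im (h t))).
Proof.
move=> ch; apply: continuous_compact_integrable; first exact: segment_compact.
by apply: within_cont => t /ch; exact: rcont_Im.
Qed.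

Hint Resolve cont_on_integrable_Re cont_on_integrable_Im : core.

Lemma eq_cint a b h1 h2 : (forall t, a <= t <= b -> h1 t = h2 t) ->
  cint a b h1 = cint a b h2.
Proof.
move=> E; rewrite /cint; congr (_ +i* _)%C; apply: eq_Rintegral => t;
  by rewrite inE/= in_itv/= => /E ->.
Qed.

Lemma cintD a b h1 h2 : cont_on a b h1 -> cont_on a b h2 ->
  cint a b (fun t => h1 t + h2 t) = cint a b h1 + cint a b h2.
Proof.
move=> c1 c2; rewrite /cint; apply/eqP; rewrite eq_complex/=; apply/andP; split; apply/eqP.
- by under eq_Rintegral do rewrite ReD; rewrite RintegralD//; auto.
- by under eq_Rintegral do rewrite ImD; rewrite RintegralD//; auto.
Qed.

Lemma cintZ a b c h : cont_on a b h ->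
  cint a b (fun t => c * h t) = c * cint a b h.
Proof.
move=> ch; rewrite /cint; apply/eqP; rewrite eq_complex ReM ImM.
have I (r : R) (f : R -> R) : mu.-integrable `[a, b] (EFin \o f) ->
    mu.-integrable `[a, b] (EFin \o (fun t => r * f t)).
  move=> intf; have -> : EFin \o (fun t => r * f t) = (fun t => r%:E * (EFin \o f) t)%E.
    by apply/funext => t; rewrite /= EFinM.
  exact: integrableZl.
apply/andP; split; apply/eqP => /=.
- under eq_Rintegral do rewrite ReM.
  by rewrite RintegralB ?RintegralZl//; auto.
- under eq_Rintegral do rewrite ImM.
  by rewrite RintegralD ?RintegralZl//; auto.
Qed.

Lemma rcontM h1 h2 t : rcont h1 t -> rcont h2 t -> rcont (fun s => h1 s * h2 s) t.
Proof.
move=> c1 c2 e e0.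
set A := cabs (h1 t) + cabs (h2 t) + 1.
have A1 : 1 <= A by rewrite lerDr addr_ge0 ?cabs_ge0.
have A0 : 0 < A by apply: lt_le_trans A1.
set e' := Num.min 1 (e / (2 * A)).
have e'0 : 0 < e' by rewrite lt_min ltr01 divr_gt0// mulr_gt0.
have [d1 d10 H1] := c1 _ e'0; have [d2 d20 H2] := c2 _ e'0.
exists (Num.min d1 d2); first by rewrite lt_min d10 d20.
move=> s; rewrite lt_min => /andP[/H1 {}H1 /H2 {}H2].
have -> : h1 s * h2 s - h1 t * h2 t =
  (h1 s - h1 t) * (h2 s - h2 t) + h1 t * (h2 s - h2 t) + (h1 s - h1 t) * h2 t by ring.
apply: (le_trans (cabsD _ _)); apply: (le_trans (lerD (cabsD _ _) (lexx _))).
rewrite !cabsM.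
have e1 : e' <= 1 by rewrite ge_min lexx.
have ee : e' * (2 * A) <= e.
  by rewrite -ler_pdivlMr ?mulr_gt0// ge_min lexx orbT.
have B1 := cabs_ge0 (h1 t); have B2 := cabs_ge0 (h2 t).
have D1 := cabs_ge0 (h1 s - h1 t); have D2 := cabs_ge0 (h2 s - h2 t).
apply: le_trans ee; rewrite /A.
have X1 : cabs (h1 s - h1 t) * cabs (h2 s - h2 t) <= e' * 1.
  by apply: ler_pM => //; apply: le_trans H2 _.
have X2 : cabs (h1 t) * cabs (h2 s - h2 t) <= cabs (h1 t) * e' by rewrite ler_wpM2l.
have X3 : cabs (h1 s - h1 t) * cabs (h2 t) <= e' * cabs (h2 t) by rewrite ler_wpM2r.
nra.
Qed.

Lemma rcontD h1 h2 t : rcont h1 t -> rcont h2 t -> rcont (fun s => h1 s + h2 s) t.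
Proof.
move=> c1 c2 e e0.
have e'0 : 0 < e / 2 by rewrite divr_gt0.
have [d1 d10 H1] := c1 _ e'0; have [d2 d20 H2] := c2 _ e'0.
exists (Num.min d1 d2); first by rewrite lt_min d10 d20.
move=> s; rewrite lt_min => /andP[/H1 {}H1 /H2 {}H2].
have -> : h1 s + h2 s - (h1 t + h2 t) = (h1 s - h1 t) + (h2 s - h2 t) by ring.
by rewrite (le_trans (cabsD _ _))// (splitr e) lerD.
Qed.

Lemma rcont_cst (c : C) t : rcont (fun=> c) t.
Proof. by move=> e e0; exists 1 => // s _; rewrite subrr cabs0 ltW. Qed.

Lemma real_cpxB (x y : R) : ((x - y)%:C)%C = (x%:C)%C - (y%:C)%C.
Proof. exact: (rmorphB (real_complex R)). Qed.

Lemma real_cpxM (x y : R) : ((x * y)%:C)%C = (x%:C)%C * (y%:C)%C.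
Proof. exact: (rmorphM (real_complex R)). Qed.

Lemma real_cpxX (x : R) n : ((x ^+ n)%:C)%C = (x%:C)%C ^+ n.
Proof. exact: (rmorphXn (real_complex R)). Qed.

Lemma rcont_real (f : R -> R) t : {for t, continuous f} -> rcont (fun s => ((f s)%:C)%C) t.
Proof.
move=> /(@cvgrPdist_le _ R^o) cf e e0; have [d /= d0 H] := cf _ e0.
exists d => // s st; rewrite -real_cpxB cabs_real distrC; apply: H => /=.
by rewrite distrC.
Qed.

Lemma rcontX h n t : rcont h t -> rcont (fun s => h s ^+ n) t.
Proof.
move=> ch; elim: n => [|n IH]; first exact: rcont_cst.
by under eq_fun do rewrite exprS; apply: rcontM.
Qed.

Lemma rcont_sum n (F : nat -> R -> C) t : (forall i, (i < n)%N -> rcont (F i) t) ->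
  rcont (fun s => \sum_(i < n) F i s) t.
Proof.
elim: n => [_|n IH H].
  by under eq_fun do rewrite big_ord0; exact: rcont_cst.
under eq_fun do rewrite big_ord_recr/=; apply: rcontD; last exact: H.
by apply: IH => i ni; apply: H; rewrite ltnS ltnW.
Qed.

Lemma rcontN h t : rcont h t -> rcont (fun s => - h s) t.
Proof.
move=> ch e e0; have [d d0 H] := ch _ e0; exists d => // s /H.
by rewrite -opprD cabsN.
Qed.

Lemma rcontB h1 h2 t : rcont h1 t -> rcont h2 t -> rcont (fun s => h1 s - h2 s) t.
Proof. by move=> c1 c2; apply: rcontD => //; apply: rcontN. Qed.

Lemma cintN a b h : cont_on a b h -> cint a b (fun t => - h t) = - cint a b h.
Proof.
by move=> ch; under eq_cint do rewrite -mulN1r; rewrite cintZ// mulN1r.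
Qed.

Lemma cintB a b h1 h2 : cont_on a b h1 -> cont_on a b h2 ->
  cint a b (fun t => h1 t - h2 t) = cint a b h1 - cint a b h2.
Proof.
by move=> c1 c2; rewrite cintD// ?cintN// => t /c2; exact: rcontN.
Qed.

Lemma cint0 a b : cint a b (fun=> 0) = 0.
Proof.
by rewrite /cint; apply/eqP; rewrite eq_complex/= !Rintegral_cst ?mul0r ?eqxx//; exact: measurable_itv.
Qed.

Lemma cint_sum a b n (F : nat -> R -> C) : (forall i, (i < n)%N -> cont_on a b (F i)) ->
  cint a b (fun t => \sum_(i < n) F i t) = \sum_(i < n) cint a b (F i).
Proof.
elim: n => [_|n IH H].
  by under eq_cint do rewrite big_ord0; rewrite cint0 big_ord0.
under eq_cint do rewrite big_ord_recr/=.
have H' i : (i < n)%N -> cont_on a b (F i) by move=> ni; apply: H; rewrite ltnS ltnW.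
rewrite cintD ?IH ?big_ord_recr//; last exact: H.
by move=> t tab; apply: rcont_sum => i ni; apply: H'.
Qed.

Lemma Rintegral_segment_cst a b (r : R) : a <= b ->
  \int[mu]_(t in `[a, b]) r = (b - a) * r.
Proof.
move=> ab; rewrite Rintegral_cst; last exact: measurable_itv.
rewrite /= lebesgue_measure_itv/= lte_fin; case: ltgtP ab => //= [_ _|-> _];
  by rewrite ?subrr mulrC.
Qed.

Lemma cint_cst a b c : a <= b -> cint a b (fun=> c) = ((b - a)%:C)%C * c.
Proof.
move=> ab; rewrite /cint !Rintegral_segment_cst//.
by apply/eqP; rewrite eq_complex ReM ImM/= !mul0r subr0 addr0 !eqxx.
Qed.

Lemma cint_Re_ge0 a b h : (forall t, a <= t <= b -> 0 <= complex.Re (h t)) ->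
  0 <= complex.Re (cint a b h).
Proof. by move=> H /=; apply: Rintegral_ge0 => t /=; rewrite in_itv/=; exact: H. Qed.

(** For J the integral itself, |J|^2 is the real part of the integral of conj(J) h, hence at most
    |J| M (b - a). This gives the constant 1, which separate bounds on the real and imaginary parts
    would not. *)
Lemma cint_norm a b h M : a <= b -> cont_on a b h ->
  (forall t, a <= t <= b -> cabs (h t) <= M) -> cabs (cint a b h) <= M * (b - a).
Proof.
move=> ab ch hM.
have M0 : 0 <= M by apply: le_trans (cabs_ge0 (h a)) (hM _ _); rewrite lexx.
have key (J : C) : complex.Re ((J^*)%C * cint a b h) <= cabs J * M * (b - a).
  have cc : cont_on a b (fun t => (J^*)%C * h t).
    by move=> t tab; apply: rcontM; [exact: rcont_cst|exact: ch].
  have := @cint_Re_ge0 a b (fun t => ((cabs J * M)%:C)%C - (J^*)%C * h t).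
  rewrite cintB//; last by move=> *; exact: rcont_cst.
  rewrite cint_cst// cintZ// ReB subr_ge0 -real_cpxM ReC [_ * (_ * M)]mulrC; apply.
  move=> t tab; rewrite ReB subr_ge0 ReC.
  apply: (le_trans (ler_norm _)); apply: (le_trans (cabs_Re _)).
  by rewrite cabsM cabs_conj ler_wpM2l ?cabs_ge0// hM.
have [I0|I0] := eqVneq (cabs (cint a b h)) 0; first by rewrite I0 mulr_ge0// subr_ge0.
have Ip : 0 < cabs (cint a b h) by rewrite lt_neqAle eq_sym I0 cabs_ge0.
by have := key (cint a b h); rewrite mulrC mul_conj ReC -mulrA expr2 ler_pM2l.
Qed.

Lemma cint_split a c b h : a <= c -> c <= b -> cont_on a b h ->
  cint a b h = cint a c h + cint c b h.
Proof.
move=> ac cb ch.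
have S (f : R -> R) : mu.-integrable `[a, b] (EFin \o f) ->
   \int[mu]_(t in `[a, b]) f t = \int[mu]_(t in `[a, c]) f t + \int[mu]_(t in `[c, b]) f t.
  move=> intf; have := @Rintegral_itvB R f (BLeft a) (BRight b) c intf.
  rewrite !bnd_simp => /(_ ac cb) E.
  apply/eqP; rewrite addrC -subr_eq E; apply/eqP; rewrite Rintegral_itv_obnd_cbnd//.
  apply: integrableS intf => //; apply: subset_itvr.
  by rewrite bnd_simp.
rewrite /cint; apply/eqP; rewrite eq_complex/=.
by rewrite !S ?eqxx//; auto.
Qed.

Lemma rderiv_rcont H t l : rderiv H t l -> rcont H t.
Proof.
move=> dH e e0; have [d d0 HH] := dH _ (@ltr01 R).
have k0 : 0 < 1 + cabs l by rewrite ltr_wpDr ?cabs_ge0.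
exists (Num.min d (e / (1 + cabs l))); first by rewrite lt_min d0 divr_gt0.
move=> s; rewrite lt_min => /andP[/HH]; rewrite subrKC mul1r ltr_pdivlMr// => h1 h2.
have -> : H s - H t = H s - H t - ((s - t)%:C)%C * l + ((s - t)%:C)%C * l by rewrite subrK.
apply: (le_trans (cabsD _ _)); rewrite cabsM cabs_real; nra.
Qed.

Lemma rderiv_Re H t l : rderiv H t l ->
  is_derive t (1:R) (fun s => complex.Re (H s)) (complex.Re l).
Proof.
move=> dH; set F := (fun s => _).
suff cF : (h^-1 *: (F (h + t) - F t) @[h --> (0:R)^'] --> complex.Re l).
  have E : (fun h : R => h^-1 *: ((F \o shift t) (h *: (1 : R)) - F t)) =
         (fun h : R => h^-1 *: (F (h + t) - F t)).
    by apply/funext => h /=; rewrite [h *: 1]mulr1.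
  apply: DeriveDef; first by rewrite /derivable E; apply/cvg_ex; exists (complex.Re l).
  by rewrite /derive E; exact: (@cvg_lim R (@norm_hausdorff _ _) _ _ _ _ _ cF).
apply/(@cvgrPdist_le _ R^o) => e e0; have [d d0 HH] := dH _ e0.
exists d => //= h /=; rewrite sub0r normrN => /HH {}HH h0.
have -> : complex.Re l - h^-1 * (F (h + t) - F t) =
   - (h^-1 * complex.Re (H (t + h) - H t - (h%:C)%C * l)).
  by rewrite /F !ReB ReM/= addrC mul0r subr0 [h + t]addrC; field.
rewrite normrN normrM normfV mulrC ler_pdivrMr ?normr_gt0//.
exact: le_trans (cabs_Re _) HH.
Qed.

Lemma rderivZ (c : C) H t l : rderiv H t l -> rderiv (fun s => c * H s) t (c * l).
Proof.
move=> dH e e0; have c0 : 0 < cabs c + 1 by rewrite ltr_wpDl ?cabs_ge0.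
have [d d0 HH] := dH (e / (cabs c + 1)) (divr_gt0 e0 c0); exists d => // s /HH {}HH.
have -> : c * H (t + s) - c * H t - (s%:C)%C * (c * l) =
          c * (H (t + s) - H t - (s%:C)%C * l) by ring.
rewrite cabsM (le_trans (ler_wpM2l (cabs_ge0 _) HH))// mulrA ler_wpM2r//.
by rewrite mulrA ler_pdivrMr// mulrC ler_pM2l// lerDl.
Qed.

Lemma Im_Re (z : C) : complex.Im z = complex.Re (- 'i%C * z).
Proof. by case: z => x y; rewrite /= !oppr0 mul0r mulN1r opprK add0r. Qed.

Lemma rderiv_Im H t l : rderiv H t l ->
  is_derive t (1:R) (fun s => complex.Im (H s)) (complex.Im l).
Proof.
move=> /(rderivZ (- 'i%C)) /rderiv_Re; rewrite -Im_Re.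
by under eq_fun do rewrite -Im_Re.
Qed.

Lemma cint_FTC a b H h : a <= b -> cont_on a b h ->
  (forall t, a <= t <= b -> rderiv H t (h t)) -> cint a b h = H b - H a.
Proof.
rewrite le_eqVlt => /orP[/eqP <-|ab] ch dH.
  by rewrite /cint !set_itv1 !Rintegral_set1 subrr.
have F (f g : R -> R) : (forall t, a <= t <= b -> {for t, continuous f}) ->
    (forall t, a <= t <= b -> {for t, continuous g}) ->
    (forall t, a <= t <= b -> is_derive t (1:R) g (f t)) ->
    \int[mu]_(t in `[a, b]) f t = g b - g a.
  move=> cf cg df; rewrite /Rintegral (@continuous_FTC2 _ f g)//; first exact: within_cont.
    split.
    - by move=> t; rewrite in_itv/= => /andP[at_ tb]; apply: ex_derive; apply: df; rewrite !ltW.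
    - by apply: cvg_at_right_filter; apply: cg; rewrite lexx ltW.
    - by apply: cvg_at_left_filter; apply: cg; rewrite lexx ltW.
  move=> t; rewrite in_itv/= => /andP[at_ tb]; rewrite derive1E; apply: derive_val.
  by apply: df; rewrite !ltW.
have cH t : a <= t <= b -> rcont H t by move=> /dH; exact: rderiv_rcont.
rewrite /cint; apply/eqP; rewrite eq_complex ReB ImB /=; apply/andP; split; apply/eqP.
- apply: (F _ (fun s => complex.Re (H s))) => t tab.
  + by apply: rcont_Re; exact: ch.
  + by apply: rcont_Re; exact: cH.
  + by apply: rderiv_Re; exact: dH.
- apply: (F _ (fun s => complex.Im (H s))) => t tab.
  + by apply: rcont_Im; exact: ch.
  + by apply: rcont_Im; exact: cH.
  + by apply: rderiv_Im; exact: dH.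
Qed.

Lemma cont_on_bounded a b h : a <= b -> cont_on a b h ->
  exists M : R, forall t, a <= t <= b -> cabs (h t) <= M.
Proof.
move=> ab ch.
have B (f : R -> R) : (forall t, a <= t <= b -> {for t, continuous f}) ->
    exists M : R, forall t, a <= t <= b -> `|f t| <= M.
  move=> cf.
  have cf' : {within `[a, b], continuous (fun t => `|f t|)}.
    apply: within_cont => t /cf c.
    by apply: (@continuous_comp _ _ _ f (@Num.norm R R)) => //; exact: norm_continuous.
  have [c _ cM] := EVT_max ab cf'.
  by exists `|f c| => t tab; apply: cM; rewrite in_itv.
have [t tab|M1 H1] := B (fun t => complex.Re (h t)); first by apply: rcont_Re; apply: ch.
have [t tab|M2 H2] := B (fun t => complex.Im (h t)); first by apply: rcont_Im; apply: ch.
exists (M1 + M2) => t tab; apply: (le_trans (cabs_le_ReIm _)).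
by rewrite lerD ?H1 ?H2.
Qed.

End ComplexIntegral.

(* Keeps conversion from unfolding complex integrals into pairs of Lebesgue
   integrals. *)
#[global] Opaque cint.

(** * The unit circle *)

Section CircleExp.
Variable R : realType.
Local Notation C := R[i].
Implicit Types s t : R.

Definition ce t : C := (cos t +i* sin t)%C.

Lemma ceD s t : ce (s + t) = ce s * ce t.
Proof. by apply/eqP; rewrite eq_complex ReM ImM/= cosD sinD eqxx/= addrC eqxx. Qed.

Lemma ce0 : ce 0 = 1.
Proof. by rewrite /ce cos0 sin0. Qed.

Lemma cabs_ce t : cabs (ce t) = 1.
Proof. by rewrite /ComplexField.Normc.normc/= cos2Dsin2 sqrtr1. Qed.

Lemma ceN t : ce (- t) = ((ce t)^*)%C.
Proof. by rewrite /ce cosN sinN. Qed.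

Lemma ce_neq0 t : ce t != 0.
Proof. by rewrite -cabs_eq0 cabs_ce oner_eq0. Qed.

Lemma ceMn t n : ce (t *+ n) = ce t ^+ n.
Proof. by elim: n => [|n IH]; rewrite ?mulr0n ?ce0 ?expr0// mulrS ceD IH exprS. Qed.

Lemma ce2pi : ce (2 * pi) = 1.
Proof. by rewrite /ce mulr_natl cos2pi sin2pi. Qed.

Lemma is_derive_eps (f : R -> R) t (l : R) : is_derive t (1:R) f l ->
  forall e : R, 0 < e -> exists2 d : R, 0 < d & forall s : R, `|s| < d ->
    `|f (t + s) - f t - s * l| <= e * `|s|.
Proof.
move=> [df dl] e e0.
have cF : (h^-1 *: (f (h + t) - f t) @[h --> (0:R)^'] --> l).
  move: df; rewrite /derivable -dl /derive.
  have -> // : (fun h : R => h^-1 *: ((f \o shift t) (h *: (1 : R)) - f t)) =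
         (fun h : R => h^-1 *: (f (h + t) - f t)).
  by apply/funext => h /=; rewrite [h *: 1]mulr1.
move/(@cvgrPdist_le _ R^o): cF => /(_ _ e0) [d /= d0 H]; exists d => // s sd.
have [->|s0] := eqVneq s 0; first by rewrite addr0 subrr mul0r subr0 normr0 mulr0.
have := H s; rewrite /= sub0r normrN => /(_ sd s0).
have -> : l - s^-1 * (f (s + t) - f t) = - (s^-1 * (f (t + s) - f t - s * l)).
  by rewrite [s + t]addrC; field.
by rewrite normrN normrM normfV mulrC ler_pdivrMr ?normr_gt0.
Qed.

Lemma is_derive_rderiv (f g : R -> R) t l m : is_derive t (1:R) f l ->
  is_derive t (1:R) g m -> rderiv (fun s => (f s +i* g s)%C) t (l +i* m)%C.
Proof.
move=> /is_derive_eps df /is_derive_eps dg e e0.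
have e'0 : 0 < e / 2 by rewrite divr_gt0.
have [d1 d10 H1] := df _ e'0; have [d2 d20 H2] := dg _ e'0.
exists (Num.min d1 d2); first by rewrite lt_min d10 d20.
move=> s; rewrite lt_min => /andP[/H1 {}H1 /H2 {}H2].
apply: (le_trans (cabs_le_ReIm _)).
rewrite !ReB !ImB ReM ImM ReC ImC !mul0r subr0 addr0/=.
by apply: (le_trans (lerD H1 H2)); rewrite -mulrDl -splitr.
Qed.

Lemma rderiv_ce t : rderiv ce t ('i%C * ce t).
Proof.
have -> : 'i%C * ce t = (- sin t +i* cos t)%C.
  by apply/eqP; rewrite eq_complex ReM ImM/= !mul0r !mul1r sub0r add0r !eqxx.
by apply: is_derive_rderiv.
Qed.

Lemma rcont_ce t : rcont ce t.
Proof. exact: rderiv_rcont (rderiv_ce t). Qed.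

Lemma cabs_i : cabs ('i%C : C) = 1.
Proof. by rewrite /ComplexField.Normc.normc/= expr0n expr1n add0r sqrtr1. Qed.

Lemma ii : 'i%C * 'i%C = -1 :> C.
Proof. by rewrite -expr2 sqr_i. Qed.

(** A chord is no longer than its arc: the difference is the integral of the derivative of [ce],
    which has modulus 1. *)
Lemma ce_lip s t : cabs (ce s - ce t) <= `|s - t|.
Proof.
wlog st : s t / t <= s.
  move=> W; have [/W//|/ltW/W] := leP t s.
  by rewrite cabsB distrC.
have ci : cont_on t s (fun u => 'i%C * ce u).
  by move=> u _; apply: rcontM; [exact: rcont_cst|exact: rcont_ce].
rewrite -(@cint_FTC _ t s ce (fun u => 'i%C * ce u))//; last by move=> u _; exact: rderiv_ce.
rewrite ger0_norm ?subr_ge0// -[X in _ <= X]mul1r.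
by apply: cint_norm => // u _; rewrite cabsM cabs_i cabs_ce mulr1.
Qed.

End CircleExp.

(** * Bisection of rectangles *)

Section Bisection.
Variable R : realType.

Lemma nested_intervals (x : nat -> R) (w : R) :
  (forall n, x n <= x n.+1) ->
  (forall n, x n.+1 + w / 2 ^+ n.+1 <= x n + w / 2 ^+ n) -> 0 <= w ->
  exists p, forall n, x n <= p <= x n + w / 2 ^+ n.
Proof.
move=> H1 H2 w0.
have M1 n k : x n <= x (n + k)%N.
  by elim: k => [|k IH]; rewrite ?addn0// addnS (le_trans IH).
have M2 n k : x (n + k)%N + w / 2 ^+ (n + k) <= x n + w / 2 ^+ n.
  by elim: k => [|k IH]; rewrite ?addn0// addnS (le_trans _ IH).
have P n : 0 <= w / 2 ^+ n by rewrite divr_ge0// exprn_ge0.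
have ub n m : x m <= x n + w / 2 ^+ n.
  case: (leqP m n) => [/subnKC <-|/ltnW/subnKC <-].
    by rewrite (le_trans (M1 m (n - m)%N))// lerDl.
  by rewrite (le_trans _ (M2 n (m - n)%N))// lerDl.
exists (sup (range x)) => n; apply/andP; split.
  apply: ub_le_sup; last by exists n.
  by exists (x 0 + w / 2 ^+ 0) => _ [m _ <-].
apply: ge_sup; first by exists (x 0), 0%N.
by move=> _ [m _ <-].
Qed.

(** Goursat's argument without the integrals. If [D] were positive on the whole rectangle, some
    quarter would carry at least a fourth of it, and so on; at the point common to the nested
    rectangles this contradicts the decay [e / 4 ^+ n]. *)
Lemma rect_bisection (D : R -> R -> nat -> R) (x0 y0 w h : R) :
  0 <= w -> 0 <= h ->
  let inside x y n := [/\ x0 <= x, x + w / 2 ^+ n <= x0 + w, y0 <= y & y + h / 2 ^+ n <= y0 + h] in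
  (forall x y n, inside x y n ->
     D x y n <= D x y n.+1 + D (x + w / 2 ^+ n.+1) y n.+1
              + D x (y + h / 2 ^+ n.+1) n.+1
              + D (x + w / 2 ^+ n.+1) (y + h / 2 ^+ n.+1) n.+1) ->
  (forall p q, x0 <= p <= x0 + w -> y0 <= q <= y0 + h -> forall e, 0 < e ->
     exists N, forall x y n, (N <= n)%N -> inside x y n ->
       x <= p <= x + w / 2 ^+ n -> y <= q <= y + h / 2 ^+ n ->
       D x y n <= e / 4 ^+ n) ->
  D x0 y0 0%N <= 0.
Proof.
move=> w0 h0 inside sub loc; rewrite leNgt; apply/negP => D0.
pose wn n : R := w / 2 ^+ n; pose hn n : R := h / 2 ^+ n.
have W n : wn n = wn n.+1 + wn n.+1.
  rewrite /wn exprS; have : (2:R) ^+ n != 0 by rewrite expf_neq0.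
  by move=> ?; field.
have H n : hn n = hn n.+1 + hn n.+1.
  rewrite /hn exprS; have : (2:R) ^+ n != 0 by rewrite expf_neq0.
  by move=> ?; field.
have wn0 n : 0 <= wn n by rewrite divr_ge0// exprn_ge0.
have hn0 n : 0 <= hn n by rewrite divr_ge0// exprn_ge0.
(* The first quarter that carries at least a fourth of [D]; when the first three fail, subadditivity
   forces the last. *)
pose next n (p : R * R) : R * R :=
  let: (x, y) := p in
  if D x y n <= 4 * D x y n.+1 then (x, y)
  else if D x y n <= 4 * D (x + wn n.+1) y n.+1 then (x + wn n.+1, y)
  else if D x y n <= 4 * D x (y + hn n.+1) n.+1 then (x, y + hn n.+1)
  else (x + wn n.+1, y + hn n.+1).
pose u := fix u n := if n is m.+1 then next m (u m) else (x0, y0).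
have nextP n x y : inside x y n ->
  [/\ inside (next n (x, y)).1 (next n (x, y)).2 n.+1,
      D x y n <= 4 * D (next n (x, y)).1 (next n (x, y)).2 n.+1,
      x <= (next n (x, y)).1, y <= (next n (x, y)).2 &
      (next n (x, y)).1 + wn n.+1 <= x + wn n /\ (next n (x, y)).2 + hn n.+1 <= y + hn n].
  move=> ins; have := sub _ _ _ ins; case: (ins) => i1 i2 i3 i4.
  rewrite -/(wn _) in i2; rewrite -/(hn _) in i4.
  have := W n; have := H n; have := wn0 n.+1; have := hn0 n.+1.
  rewrite /next -/(wn _) -/(hn _) => a1 a2 a3 a4 S.
  by case: ifP => /= c1; [|case: ifP => /= c2; [|case: ifP => /= c3]];
    rewrite /inside -/(wn _) -/(hn _); (split; [split; lra|lra|lra|lra|split; lra]).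
have uS n : u n.+1 = next n ((u n).1, (u n).2) by rewrite /=; case: (u n).
have insu n : inside (u n).1 (u n).2 n.
  elim: n => [|n IH]; first by rewrite /inside/= !expr0 !divr1.
  by rewrite uS; case: (nextP _ _ _ IH).
have Du n : D x0 y0 0%N <= 4 ^+ n * D (u n).1 (u n).2 n.
  elim: n => [|n IH]; first by rewrite expr0 mul1r.
  rewrite uS; case: (nextP _ _ _ (insu n)) => _ c _ _ _.
  by rewrite (le_trans IH)// exprSr -mulrA ler_wpM2l// exprn_ge0.
have [p pP] : exists p, forall n, (u n).1 <= p <= (u n).1 + w / 2 ^+ n.
  by apply: nested_intervals => // n; rewrite uS; case: (nextP _ _ _ (insu n)) => // ? ? ? ? [].
have [q qP] : exists q, forall n, (u n).2 <= q <= (u n).2 + h / 2 ^+ n.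
  by apply: nested_intervals => // n; rewrite uS; case: (nextP _ _ _ (insu n)) => // ? ? ? ? [].
have D20 : 0 < D x0 y0 0%N / 2 by rewrite divr_gt0.
have := loc p q _ _ _ D20.
have := pP 0%N; have := qP 0%N; rewrite /= !expr0 !divr1 => -> -> /(_ isT isT) [N HN].
have := HN _ _ _ (leqnn N) (insu N) (pP N) (qP N).
rewrite ler_pdivlMr ?exprn_gt0// mulrC => c; have := le_trans (Du N) c; lra.
Qed.

End Bisection.

(** * Cauchy's theorem on polar rectangles *)

Section ComplexDiff.
Variable R : realType.
Local Notation C := R[i].
Implicit Types (f g : C -> C) (z w l m : C).

Definition ccont f z : Prop := forall e : R, 0 < e ->
  exists2 d : R, 0 < d & forall w, cabs (w - z) < d -> cabs (f w - f z) <= e.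

Lemma ccontP f z : ccont f z <-> {for z, continuous (f : C^o -> C^o)}.
Proof.
have FF : Filter (nbhs (z : C^o)) by exact: nbhs_filter.
rewrite /prop_for /continuous_at.
split=> [cf|/(@cvgrPdist_le _ _ _ _ FF) cf].
- apply/(@cvgrPdist_le _ _ _ _ FF) => e e0.
  have [e' e'0 ee'] : exists2 e' : R, 0 < e' & e = (e'%:C)%C.
    exists (complex.Re e); first by move: e0; rewrite ltcE => /andP[].
    by case: e e0 => a b; rewrite ltcE/= => /andP[/eqP -> _].
  have [d d0 H] := cf _ e'0.
  exists (d%:C)%C => /=; first by rewrite ltcR.
  move=> w /=; rewrite !normC_cabs ltcR ee' lecR [cabs (f z - _)]cabsB => wd.
  by apply: H; rewrite cabsB.
- move=> e e0; have := cf (e%:C)%C; rewrite ltcR => /(_ e0) /= [d /= d0 H].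
  exists (complex.Re d); first by move: d0; rewrite ltcE => /andP[].
  move=> w hd; have := H w; rewrite /= !normC_cabs.
  have -> : d = ((complex.Re d)%:C)%C.
    by case: d d0 {H hd} => a b; rewrite ltcE/= => /andP[/eqP -> _].
  by rewrite ltcR lecR [cabs (z - w)]cabsB [cabs (f z - _)]cabsB; apply.
Qed.

Lemma ccontM f g z : ccont f z -> ccont g z -> ccont (fun w => f w * g w) z.
Proof.
move=> /ccontP cf /ccontP cg; apply/ccontP; rewrite /prop_for /continuous_at;
have FF : Filter (nbhs (z : C^o)) by exact: nbhs_filter.
exact: (@cvgM C _ _ FF (f : C^o -> C^o) (g : C^o -> C^o) (f z) (g z) cf cg).
Qed.

Lemma ccontD f g z : ccont f z -> ccont g z -> ccont (fun w => f w + g w) z.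
Proof.
move=> /ccontP cf /ccontP cg; apply/ccontP; rewrite /prop_for /continuous_at;
have FF : Filter (nbhs (z : C^o)) by exact: nbhs_filter.
exact: (@cvgD C _ _ _ FF (f : C^o -> C^o) (g : C^o -> C^o) (f z) (g z) cf cg).
Qed.

Lemma ccontV f z : ccont f z -> f z != 0 -> ccont (fun w => (f w)^-1) z.
Proof.
move=> /ccontP cf f0; apply/ccontP; rewrite /prop_for /continuous_at;
have FF : Filter (nbhs (z : C^o)) by exact: nbhs_filter.
exact: (@cvgV C _ _ FF (f : C^o -> C^o) (f z) f0 cf).
Qed.

Lemma ccont_cst (c : C) z : ccont (fun=> c) z.
Proof. by move=> e e0; exists 1 => // w _; rewrite subrr cabs0 ltW. Qed.

Lemma ccont_id z : ccont id z.
Proof. by move=> e e0; exists e => // w /ltW. Qed.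

Lemma ccont_comp f g z : ccont f z -> ccont g (f z) -> ccont (fun w => g (f w)) z.
Proof.
move=> cf cg e e0; have [d d0 H] := cg _ e0.
have d20 : 0 < d / 2 by rewrite divr_gt0.
have [d' d'0 H'] := cf _ d20; exists d' => // w /H' h; apply: H.
by rewrite (le_lt_trans h)// ltr_pdivrMr// ltr_pMr// ltr1n.
Qed.

Lemma ccont_rcont f (h : R -> C) t : ccont f (h t) -> rcont h t ->
  rcont (fun s => f (h s)) t.
Proof.
move=> cf ch e e0; have [d d0 H] := cf _ e0.
have d20 : 0 < d / 2 by rewrite divr_gt0.
have [d' d'0 H'] := ch _ d20; exists d' => // w /H' h'; apply: H.
by rewrite (le_lt_trans h')// ltr_pdivrMr// ltr_pMr// ltr1n.
Qed.

(** Caratheodory's form of the derivative: a continuous difference quotient. The product and chain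
    rules then reduce to algebra with continuous functions. *)
Lemma cdiff_quot f z l : cdiff f z l <->
  exists q : C -> C, [/\ ccont q z, q z = l & forall w, f w - f z = q w * (w - z)].
Proof.
split=> [df|[q [cq qz qE]]].
- exists (fun w => if w == z then l else (f w - f z) / (w - z)); split.
  + move=> e e0; have [d d0 H] := df _ e0; exists d => // w wz.
    rewrite eqxx; case: eqVneq => [_|wz0]; first by rewrite subrr cabs0 ltW.
    have w0 : w - z != 0 by rewrite subr_eq0.
    have -> : (f w - f z) / (w - z) - l = (f w - f z - l * (w - z)) / (w - z).
      by rewrite [RHS]mulrBl mulfK.
    rewrite cabsM cabsV ler_pdivrMr ?cabs_gt0//.
    by have := H _ wz; rewrite subrKC.
  + by rewrite eqxx.
  + move=> w; case: eqVneq => [->|wz0]; first by rewrite !subrr mulr0.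
    by rewrite divfK// subr_eq0.
- move=> e e0; have [d d0 H] := cq _ e0; exists d => // h hd.
  rewrite qE addrAC subrr add0r -qz -mulrBl cabsM ler_wpM2r ?cabs_ge0//.
  by apply: H; rewrite addrAC subrr add0r.
Qed.

Lemma cdiff_ccont f z l : cdiff f z l -> ccont f z.
Proof.
move=> /cdiff_quot[q [cq _ qE]].
have -> : f = (fun w => q w * (w - z) + f z) by apply/funext => w; rewrite -qE subrK.
apply: ccontD; last exact: ccont_cst.
by apply: ccontM => //; apply: ccontD; [exact: ccont_id|exact: ccont_cst].
Qed.

Lemma cdiff_cst (c : C) z : cdiff (fun=> c) z 0.
Proof.
by apply/cdiff_quot; exists (fun=> 0); split=> [|//|w];
  [exact: ccont_cst|rewrite mul0r subrr].
Qed.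

Lemma cdiff_id z : cdiff id z 1.
Proof.
by apply/cdiff_quot; exists (fun=> 1); split=> [|//|w]; [exact: ccont_cst|rewrite mul1r].
Qed.

Lemma cdiffD f g z l m : cdiff f z l -> cdiff g z m ->
  cdiff (fun w => f w + g w) z (l + m).
Proof.
move=> /cdiff_quot[q [cq <- qE]] /cdiff_quot[p [cp <- pE]]; apply/cdiff_quot.
exists (fun w => q w + p w); split=> //; first exact: ccontD.
by move=> w; rewrite mulrDl -qE -pE; ring.
Qed.

Lemma cdiffM f g z l m : cdiff f z l -> cdiff g z m ->
  cdiff (fun w => f w * g w) z (l * g z + f z * m).
Proof.
move=> df dg; move: (df) (dg) => /cdiff_quot[q [cq <- qE]] /cdiff_quot[p [cp <- pE]].
apply/cdiff_quot; exists (fun w => q w * g w + f z * p w); split=> //.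
  apply: ccontD; first by apply: ccontM => //; apply: cdiff_ccont dg.
  by apply: ccontM => //; exact: ccont_cst.
move=> w; have -> : f w * g w - f z * g z = (f w - f z) * g w + f z * (g w - g z) by ring.
by rewrite qE pE; ring.
Qed.

Lemma cdiffZ f (c : C) z l : cdiff f z l -> cdiff (fun w => c * f w) z (c * l).
Proof.
by move=> df; have := cdiffM (cdiff_cst c z) df; rewrite mul0r add0r.
Qed.

Lemma cdiffN f z l : cdiff f z l -> cdiff (fun w => - f w) z (- l).
Proof.
by move=> /(cdiffZ (-1)); under eq_fun do rewrite mulN1r; rewrite mulN1r.
Qed.

Lemma cdiffB f g z l m : cdiff f z l -> cdiff g z m ->
  cdiff (fun w => f w - g w) z (l - m).
Proof. by move=> df /cdiffN; apply: cdiffD. Qed.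

Lemma cdiff_comp f g z l m : cdiff f z l -> cdiff g (f z) m ->
  cdiff (fun w => g (f w)) z (m * l).
Proof.
move=> df; move: (df) => /cdiff_quot[q [cq <- qE]] /cdiff_quot[p [cp <- pE]].
apply/cdiff_quot; exists (fun w => p (f w) * q w); split=> //.
  by apply: ccontM => //; apply: (ccont_comp (g := p)) => //; exact: cdiff_ccont df.
by move=> w; rewrite pE qE mulrA.
Qed.

Lemma cdiffV z : z != 0 -> cdiff (fun w => w^-1) z (- z ^- 2).
Proof.
move=> z0; apply/cdiff_quot.
exists (fun w => if w == 0 then z ^- 2 else - (w * z)^-1).
have cz : 0 < cabs z by rewrite cabs_gt0.
split; last 1 first.
- move=> w; case: eqVneq => [->|w0]; first by rewrite invr0; field.
  by field; rewrite w0 z0.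
- have c : ccont (fun w => - (w * z)^-1) z.
    have -> : (fun w => - (w * z)^-1) = (fun w => (-1) * (w * z)^-1).
      by apply/funext => w; rewrite mulN1r.
    apply: ccontM; first exact: ccont_cst.
    apply: ccontV; last by rewrite mulf_neq0.
    by apply: ccontM; [exact: ccont_id|exact: ccont_cst].
  move=> e /c [d d0 H]; exists (Num.min d (cabs z)); first by rewrite lt_min d0.
  move=> w; rewrite lt_min => /andP[/H {}H wz].
  rewrite (negbTE z0); case: eqVneq => // w0.
  by move: wz; rewrite w0 sub0r cabsN ltxx.
- by rewrite (negbTE z0) expr2.
Qed.

Lemma cdiffX n z : cdiff (fun w => w ^+ n) z (n%:R * z ^+ n.-1).
Proof.
elim: n => [|n IH].
  by rewrite mul0r; under eq_fun do rewrite expr0; exact: cdiff_cst.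
under eq_fun do rewrite exprS.
have := cdiffM (cdiff_id z) IH.
case: n {IH} => [|n]; first by rewrite expr0 mul0r mulr0 addr0.
by rewrite mul1r !exprS mulrCA -exprS -[_.+2%:R]natr1 mulrDl mul1r addrC.
Qed.

Lemma rderiv_quot (H : R -> C) t l : rderiv H t l <->
  exists q : R -> C, [/\ rcont q t, q t = l & forall u, H u - H t = ((u - t)%:C)%C * q u].
Proof.
split=> [df|[q [cq qz qE]]].
- exists (fun u => if u == t then l else (H u - H t) / ((u - t)%:C)%C); split.
  + move=> e e0; have [d d0 HH] := df _ e0; exists d => // u ut.
    rewrite eqxx; case: eqVneq => [_|ut0]; first by rewrite subrr cabs0 ltW.
    have u0 : u - t != 0 by rewrite subr_eq0.
    have u0' : ((u - t)%:C)%C != 0.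
      by rewrite -cabs_eq0 cabs_real normr_eq0.
    have -> : (H u - H t) / ((u - t)%:C)%C - l =
        (H u - H t - ((u - t)%:C)%C * l) / ((u - t)%:C)%C.
      by rewrite [RHS]mulrBl [_%:C%C * l]mulrC mulfK.
    rewrite cabsM cabsV cabs_real ler_pdivrMr ?normr_gt0//.
    by have := HH _ ut; rewrite subrKC.
  + by rewrite eqxx.
  + move=> u; case: eqVneq => [->|ut0]; first by rewrite !subrr mul0r.
    rewrite mulrC divfK// -cabs_eq0 cabs_real normr_eq0 subr_eq0//.
- move=> e e0; have [d d0 HH] := cq _ e0; exists d => // s sd.
  rewrite qE addrAC subrr add0r -qz -mulrBr cabsM cabs_real mulrC ler_wpM2r//.
  by apply: HH; rewrite addrAC subrr add0r.
Qed.

Lemma rderiv_comp f (h : R -> C) t l m : cdiff f (h t) l -> rderiv h t m ->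
  rderiv (fun s => f (h s)) t (l * m).
Proof.
move=> df dh; move: (df) (dh) => /cdiff_quot[q [cq <- qE]] /rderiv_quot[p [cp <- pE]].
apply/rderiv_quot; exists (fun u => q (h u) * p u); split=> //.
  by apply: rcontM => //; apply: (ccont_rcont (f := q)) => //; exact: rderiv_rcont dh.
by move=> u; rewrite qE pE; ring.
Qed.

Lemma rderiv_lin (c : C) t : rderiv (fun s => (s%:C)%C * c) t c.
Proof.
apply/rderiv_quot; exists (fun=> c); split=> //; first exact: rcont_cst.
by move=> u; rewrite -mulrBl -real_cpxB.
Qed.

End ComplexDiff.

(** * Goursat's theorem in the punctured disc *)

Section Goursat.
Variable R : realType.
Local Notation C := R[i].
Variable f : C -> C.
Hypothesis df : forall z, 0 < cabs z < 1 -> exists l, cdiff f z l.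

Local Notation pt r t := ((r%:C)%C * ce t).

Lemma cabs_pt (r t : R) : cabs (pt r t) = `|r|.
Proof. by rewrite cabsM cabs_real cabs_ce mulr1. Qed.

(* [- 'i] times the integral of [F w / w] along the boundary of the polar
   rectangle [r1 <= r <= r2], [a <= t <= b]. *)
Definition bdry_form (F : C -> C) (r1 r2 a b : R) : C :=
  cint a b (fun t => F (pt r2 t) - F (pt r1 t)) +
  'i%C * cint r1 r2 (fun r => (F (pt r b) - F (pt r a)) * ((r%:C)%C)^-1).

Let punct (F : C -> C) := forall z, 0 < cabs z < 1 -> ccont F z.

Lemma punct_arc F r : punct F -> 0 < r < 1 -> forall t, rcont (fun t => F (pt r t)) t.
Proof.
move=> pF /andP[r0 r1] t; apply: (ccont_rcont (f := F)).
  by apply: pF; rewrite cabs_pt gtr0_norm// r0.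
by apply: rcontM; [exact: rcont_cst|exact: rcont_ce].
Qed.

Lemma rcont_id (r : R) : rcont (fun s => (s%:C)%C : C) r.
Proof. by apply: rcont_real. Qed.

Lemma rcont_inv (r : R) : 0 < r -> rcont (fun s => ((s%:C)%C : C)^-1) r.
Proof.
move=> r0; apply: (ccont_rcont (f := fun w => w^-1)); last exact: rcont_id.
by apply: ccontV; [exact: ccont_id|rewrite -cabs_eq0 cabs_real normr_eq0 gt_eqF].
Qed.

Lemma punct_ray F t : punct F -> forall r, 0 < r < 1 -> rcont (fun r => F (pt r t)) r.
Proof.
move=> pF r /andP[r0 r1]; apply: (ccont_rcont (f := F)).
  by apply: pF; rewrite cabs_pt gtr0_norm// r0.
by apply: rcontM; [exact: rcont_id|exact: rcont_cst].
Qed.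

Lemma punct_ray2 F a b : punct F -> forall r, 0 < r < 1 ->
  rcont (fun r => (F (pt r b) - F (pt r a)) * ((r%:C)%C)^-1) r.
Proof.
move=> pF r /[dup] r01 /andP[r0 _]; apply: rcontM; last exact: rcont_inv.
by apply: rcontB; apply: punct_ray.
Qed.

Lemma bdry_splitr F r1 r2 r3 a b : punct F -> 0 < r1 -> r1 <= r2 -> r2 <= r3 -> r3 < 1 ->
  bdry_form F r1 r3 a b = bdry_form F r1 r2 a b + bdry_form F r2 r3 a b.
Proof.
move=> pF r10 r12 r23 r31; rewrite /bdry_form (@cint_split _ r1 r2 r3)//; last first.
  by move=> r rr; apply: punct_ray2 => //; move: rr => /andP[? ?]; lra.
have c r : 0 < r < 1 -> cont_on a b (fun t => F (pt r t)).
  by move=> r01 t _; exact: punct_arc.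
rewrite !cintB; try (by apply: c; lra).
by ring.
Qed.

Lemma bdry_splita F r1 r2 a b c : punct F -> 0 < r1 -> r1 <= r2 -> r2 < 1 ->
  a <= b -> b <= c ->
  bdry_form F r1 r2 a c = bdry_form F r1 r2 a b + bdry_form F r1 r2 b c.
Proof.
move=> pF r10 r12 r21 ab bc; rewrite /bdry_form (@cint_split _ a b c)//; last first.
  by move=> t _; apply: rcontB; apply: punct_arc => //; lra.
have -> : cint r1 r2 (fun r => (F (pt r c) - F (pt r a)) * ((r%:C)%C)^-1) =
   cint r1 r2 (fun r => (F (pt r b) - F (pt r a)) * ((r%:C)%C)^-1) +
   cint r1 r2 (fun r => (F (pt r c) - F (pt r b)) * ((r%:C)%C)^-1).
  rewrite -cintD; first by apply: eq_cint => r _; ring.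
    by move=> r rr; apply: punct_ray2 => //; move: rr => /andP[? ?]; lra.
  by move=> r rr; apply: punct_ray2 => //; move: rr => /andP[? ?]; lra.
by ring.
Qed.

Lemma bdry_D F G r1 r2 a b : punct F -> punct G -> 0 < r1 -> r1 <= r2 -> r2 < 1 ->
  bdry_form (fun z => F z + G z) r1 r2 a b = bdry_form F r1 r2 a b + bdry_form G r1 r2 a b.
Proof.
move=> pF pG r10 r12 r21; rewrite /bdry_form.
have c1 H : punct H -> cont_on a b (fun t => H (pt r2 t) - H (pt r1 t)).
  by move=> pH t _; apply: rcontB; apply: punct_arc => //; lra.
have c2 H : punct H -> cont_on r1 r2 (fun r => (H (pt r b) - H (pt r a)) * ((r%:C)%C)^-1).
  by move=> pH r /andP[? ?]; apply: punct_ray2 => //; lra.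
rewrite (@eq_cint _ _ _ _ (fun t => (F (pt r2 t) - F (pt r1 t)) + (G (pt r2 t) - G (pt r1 t)))); last by move=> t _; ring.
rewrite [X in 'i%C * X](@eq_cint _ _ _ _ (fun r => (F (pt r b) - F (pt r a)) * ((r%:C)%C)^-1 +
   (G (pt r b) - G (pt r a)) * ((r%:C)%C)^-1)); last by move=> r _; ring.
rewrite (cintD (c1 _ pF) (c1 _ pG)) (cintD (c2 _ pF) (c2 _ pG)); ring.
Qed.

(** The constant [A] cancels in both differences; for [B * z] the arc integral is explicit because
    'i * [ce] has the primitive [ce], and the integrand on the rays is constant. *)
Lemma bdry_lin (A B : C) r1 r2 a b : 0 < r1 -> r1 <= r2 -> a <= b ->
  bdry_form (fun z => A + B * z) r1 r2 a b = 0.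
Proof.
move=> r10 r12 ab; rewrite /bdry_form.
pose K : C := ((r2 - r1)%:C)%C * B.
rewrite (@eq_cint _ _ _ _ (fun t => (- 'i%C * K) * ('i%C * ce t))); last first.
  move=> t _; rewrite /K real_cpxB mulrACA mulNr ii opprK mul1r; ring.
have ci : cont_on a b (fun u => 'i%C * ce u : C).
  by move=> u _; apply: rcontM; [exact: rcont_cst|exact: rcont_ce].
rewrite cintZ// (@cint_FTC _ a b (@ce R) (fun u => 'i%C * ce u))//; last by move=> u _; exact: rderiv_ce.
rewrite (@eq_cint _ r1 r2 _ (fun r => B * (ce b - ce a))); last first.
  move=> r /andP[rr _]; have r0 : ((r%:C)%C : C) != 0.
    by rewrite -cabs_eq0 cabs_real normr_eq0 gt_eqF// (lt_le_trans r10).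
  by field.
by rewrite cint_cst// /K; ring.
Qed.

Lemma bdry_bound F r1 r2 a b e : punct F -> 0 < r1 -> r1 <= r2 -> r2 < 1 -> a <= b ->
  (forall r t, r1 <= r <= r2 -> a <= t <= b -> cabs (F (pt r t)) <= e) ->
  cabs (bdry_form F r1 r2 a b) <= 2 * e * (b - a) + 2 * e / r1 * (r2 - r1).
Proof.
move=> pF r10 r12 r21 ab H; rewrite /bdry_form (le_trans (cabsD _ _))//.
have Ha t : r1 <= r1 <= r2 by rewrite lexx.
apply: lerD.
  apply: cint_norm => //.
    by move=> t _; apply: rcontB; apply: punct_arc => //; lra.
  move=> t tab; rewrite (le_trans (cabsBD _ _))// mulr_natl mulr2n.
  by rewrite lerD// H// ?lexx ?r12.
rewrite cabsM cabs_i mul1r; apply: cint_norm => //.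
  by move=> r /andP[? ?]; apply: punct_ray2 => //; lra.
move=> r /andP[rr1 rr2]; have r0 : 0 < r by apply: lt_le_trans rr1.
rewrite cabsM cabsV cabs_real gtr0_norm//.
apply: ler_pM; rewrite ?cabs_ge0 ?invr_ge0 ?(ltW r0)//.
  rewrite (le_trans (cabsBD _ _))// mulr_natl mulr2n.
  by rewrite lerD// H// ?lexx ?ab ?rr1 ?rr2.
by rewrite lef_pV2// posrE.
Qed.

Lemma punct_f : punct f.
Proof. by move=> z /df[l]; exact: cdiff_ccont. Qed.

Lemma punct_lin A B : punct (fun z => A + B * z).
Proof.
move=> z _; apply: ccontD; first exact: ccont_cst.
by apply: ccontM; [exact: ccont_cst|exact: ccont_id].
Qed.

(** The tangent affine function at the point contributes 0, and what remains is small compared with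
    the side sum [L] of the rectangle. Integration over a boundary of length of order [L] gives the
    square. *)
Lemma bdry_local (r1 r2 a b p q : R) : 0 < r1 -> r1 <= r2 -> r2 < 1 -> a <= b ->
  r1 <= p <= r2 -> a <= q <= b -> forall e, 0 < e ->
  exists2 d, 0 < d & forall s1 s2 u v, r1 <= s1 -> s1 <= p <= s2 -> s2 <= r2 ->
    a <= u -> u <= q <= v -> v <= b -> (s2 - s1) + (v - u) < d ->
    cabs (bdry_form f s1 s2 u v) <= e * ((s2 - s1) + (v - u)) ^+ 2.
Proof.
move=> r10 r12 r21 ab /andP[p1 p2] /andP[q1 q2] e e0.
set z0 := pt p q.
have p0 : 0 < p by apply: lt_le_trans p1.
have [|l dl] := @df z0; first by rewrite cabs_pt gtr0_norm// p0; lra.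
(* The factor lost in [bdry_bound]: 2 for the two arcs, 2 / r1 for the two rays, where the integrand
   is divided by the radius. *)
have k0 : 0 < 2 + 2 / r1 by rewrite addr_gt0// divr_gt0.
have e'0 : 0 < e / (2 + 2 / r1) by rewrite divr_gt0.
have [d d0 Hd] := dl _ e'0; exists d => // s1 s2 u v rs /andP[sp ps] sr au /andP[uq qv] vb.
set L := (_ + _) => Ld.
pose lin z := (f z0 - l * z0) + l * z.
pose g z := f z - lin z.
have pg : punct g.
  move=> z z01; apply: ccontD; first exact: punct_f.
  have -> : (fun w => - lin w) = (fun w => (- (f z0 - l * z0)) + (- l) * w).
    by apply/funext => w; rewrite /lin; ring.
  exact: punct_lin.
have -> : bdry_form f s1 s2 u v = bdry_form (fun z => lin z + g z) s1 s2 u v.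
  by congr bdry_form; apply/funext => z; rewrite /g; ring.
have s10 : 0 < s1 by apply: lt_le_trans rs.
rewrite bdry_D//; try lra; last exact: punct_lin.
rewrite bdry_lin ?add0r//; try lra.
have L0 : 0 <= L by rewrite /L; lra.
have B r t : s1 <= r <= s2 -> u <= t <= v -> cabs (g (pt r t)) <= e / (2 + 2 / r1) * L.
  move=> /andP[r_1 r_2] /andP[t1 t2].
  have zl : cabs (pt r t - z0) <= L.
    have -> : pt r t - z0 = ((r - p)%:C)%C * ce t + (p%:C)%C * (ce t - ce q).
      by rewrite real_cpxB /z0; ring.
    rewrite (le_trans (cabsD _ _))// !cabsM !cabs_real cabs_ce mulr1 /L.
    apply: lerD; first by rewrite ler_norml; lra.
    have := ce_lip t q; have : `|t - q| <= v - u by rewrite ler_norml; lra.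
    have := cabs_ge0 (ce t - ce q); rewrite (gtr0_norm p0) => x1 x2 x3.
    apply: (le_trans _ x2); apply: (le_trans _ x3).
    by rewrite ler_piMl//; lra.
  have := Hd _ (le_lt_trans zl Ld); rewrite subrKC.
  have -> : f (pt r t) - f z0 - l * (pt r t - z0) = g (pt r t) by rewrite /g /lin; ring.
  by move/le_trans; apply; rewrite ler_wpM2l// ltW.
have := bdry_bound pg s10 _ _ _ B.
move=> /(_ _ _ _)/le_trans; apply; try lra.
set K := e / _ in e'0 B *.
have Ke : K * (2 + 2 / r1) = e by rewrite /K divfK// gt_eqF.
have : 2 * (K * L) / s1 * (s2 - s1) <= 2 * (K * L) / r1 * L.
  apply: ler_pM; first by rewrite divr_ge0 ?(ltW s10)// mulr_ge0// mulr_ge0// ltW.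
  - by rewrite subr_ge0 (le_trans sp).
  - by apply: ler_wpM2l; [rewrite mulr_ge0// mulr_ge0// ltW|rewrite lef_pV2 ?posrE].
  - by rewrite /L lerDl subr_ge0 (le_trans uq).
have : 2 * (K * L) * (v - u) <= 2 * (K * L) * L.
  apply: ler_wpM2l; first by rewrite mulr_ge0// mulr_ge0// ltW.
  by rewrite /L lerDr subr_ge0 (le_trans sp).
move=> h1 h2; apply: (le_trans (lerD h1 h2)).
by rewrite -Ke -subr_ge0 le_eqVlt; apply/orP; left; apply/eqP; field; rewrite gt_eqF.
Qed.

Lemma goursat r1 r2 a b : 0 < r1 -> r1 <= r2 -> r2 < 1 -> a <= b ->
  bdry_form f r1 r2 a b = 0.
Proof.
move=> r10 r12 r21 ab; apply/eqP; rewrite -cabs_eq0 eq_le cabs_ge0 andbT.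
have [w wE] : exists w, w = r2 - r1 by exists (r2 - r1).
have [h hE] : exists h, h = b - a by exists (b - a).
have w0 : 0 <= w by rewrite wE subr_ge0.
have h0 : 0 <= h by rewrite hE subr_ge0.
have := @rect_bisection R (fun x y n => cabs (bdry_form f x (x + w / 2 ^+ n) y (y + h / 2 ^+ n)))
  r1 a w h w0 h0.
have rw : r1 + w = r2 by rewrite wE subrKC.
have ah : a + h = b by rewrite hE subrKC.
rewrite /= expr0 !divr1 rw ah; apply.
- move=> x y n [i1 i2 i3 i4].
  have W : w / 2 ^+ n = w / 2 ^+ n.+1 + w / 2 ^+ n.+1.
    rewrite exprS; have : (2:R) ^+ n != 0 by rewrite expf_neq0.
    by move=> ?; field.
  have H : h / 2 ^+ n = h / 2 ^+ n.+1 + h / 2 ^+ n.+1.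
    rewrite exprS; have : (2:R) ^+ n != 0 by rewrite expf_neq0.
    by move=> ?; field.
  rewrite W H in i2 i4 *; rewrite !addrA in i2 i4 *.
  set wn := w / 2 ^+ n.+1 in i2 *; set hn := h / 2 ^+ n.+1 in i4 *.
  have wn0 : 0 <= wn by rewrite divr_ge0// exprn_ge0.
  have hn0 : 0 <= hn by rewrite divr_ge0// exprn_ge0.
  have i2' : x + wn + wn < 1 by lra.
  rewrite (@bdry_splitr f x (x + wn) (x + wn + wn)) //; [|exact: punct_f|lra|lra|lra].
  rewrite (@bdry_splita f x (x + wn) y (y + hn)) //; [|exact: punct_f|lra|lra|lra|lra|lra].
  rewrite (@bdry_splita f (x + wn) (x + wn + wn) y (y + hn)) //; [|exact: punct_f|lra|lra|lra|lra].
  set A := bdry_form _ _ _ _ _; set B := bdry_form _ _ _ _ _.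
  set A' := bdry_form _ _ _ _ _; set B' := bdry_form _ _ _ _ _.
  have h1 := cabsD (A + B) (A' + B'); have h2 := cabsD A B; have h3 := cabsD A' B'.
  lra.
- move=> p q pP qP e e0.
  (* The added 1 keeps the divisor positive when the rectangle is degenerate. *)
  have wh : 0 < (w + h + 1) ^+ 2 by rewrite exprn_gt0//; lra.
  have [d d0 Hd] := bdry_local r10 r12 r21 ab pP qP (divr_gt0 e0 wh).
  have [N HN] : exists N : nat, (w + h + 1) / d < N%:R.
    by exists (Num.bound ((w + h + 1) / d)); rewrite archi_boundP// divr_ge0 ?ltW//; lra.
  exists N => x y n Nn [i1 i2 i3 i4] /andP[xp px] /andP[yq qy].
  have two : (w + h + 1) / 2 ^+ n < d.
    rewrite ltr_pdivrMr ?exprn_gt0// -ltr_pdivrMl// mulrC (lt_trans HN)//.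
    rewrite -natrX ltr_nat (leq_ltn_trans Nn)// ltn_expl//.
  have n0 : 0 < (2:R) ^+ n by rewrite exprn_gt0.
  have wD : x + w / 2 ^+ n - x + (y + h / 2 ^+ n - y) = (w + h) / 2 ^+ n.
    by rewrite [x + _]addrC addrK [y + _]addrC addrK [RHS]mulrDl.
  have := Hd x (x + w / 2 ^+ n) y (y + h / 2 ^+ n) i1.
  rewrite xp px yq qy wD => /(_ isT _ i3 isT _ _) H.
  apply: (le_trans (H _ _ _)); [lra|lra| |].
    by apply: le_lt_trans two; rewrite ler_pM2r ?invr_gt0//; lra.
  have -> : ((w + h) / 2 ^+ n) ^+ 2 = (w + h) ^+ 2 / 4 ^+ n.
    rewrite expr_div_n -exprM mulnC exprM.
    by have -> : (2:R) ^+ 2 = 4 by rewrite expr2; ring.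
  rewrite mulrA ler_wpM2r ?invr_ge0 ?exprn_ge0// mulrAC ler_pdivrMr// ler_pM2l//.
  by rewrite ler_pXn2r ?nnegrE//; lra.
Qed.

(** Over a full turn the two rays coincide and cancel, so only the circles remain. As [f] need not
    be differentiable at 0, the lemma also applies to products with negative powers. *)
Lemma circle_integral_const r1 r2 : 0 < r1 -> r1 <= r2 -> r2 < 1 ->
  cint 0 (2 * pi) (fun t => f (pt r2 t)) = cint 0 (2 * pi) (fun t => f (pt r1 t)).
Proof.
move=> r10 r12 r21.
have p0 : 0 <= 2 * pi :> R by rewrite mulr_ge0// pi_ge0.
have := goursat r10 r12 r21 p0; rewrite /bdry_form.
under [X in 'i%C * X]eq_cint do rewrite ce2pi ce0 subrr mul0r.
rewrite cint0 mulr0 addr0 cintB.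
- by move/eqP; rewrite subr_eq0 => /eqP.
- by move=> t _; apply: punct_arc; [exact: punct_f|lra].
- by move=> t _; apply: punct_arc; [exact: punct_f|lra].
Qed.

End Goursat.

(** * Complex series *)

Section Series.
Variable R : realType.
Local Notation C := R[i].
Implicit Types (u : nat -> C) (b : nat -> R).

Definition csum u (s : C) : Prop := forall e : R, 0 < e ->
  exists N, forall n, (N <= n)%N -> cabs (\sum_(k < n) u k - s) <= e.

Definition summable b : Prop :=
  (forall k, 0 <= b k) /\ exists B, forall n, \sum_(k < n) b k <= B.

Lemma le_eps0 (x : R) : 0 <= x -> (forall e, 0 < e -> x <= e) -> x = 0.
Proof.
move=> x0 H; apply/eqP; rewrite eq_le x0 andbT; apply/ler_addgt0Pr => e e0.
by rewrite add0r H.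
Qed.

Lemma le_eps (x y : R) : (forall e, 0 < e -> x <= y + e) -> x <= y.
Proof. by move=> H; apply/ler_addgt0Pr. Qed.

Lemma csum_unique u s t : csum u s -> csum u t -> s = t.
Proof.
move=> us ut; apply/eqP; rewrite -subr_eq0 -cabs_eq0; apply/eqP.
apply: le_eps0; first exact: cabs_ge0.
move=> e e0; have e2 : 0 < e / 2 by rewrite divr_gt0.
have [N HN] := us _ e2; have [M HM] := ut _ e2.
have := HN _ (leq_maxl N M); have := HM _ (leq_maxr N M).
set S := \sum_(_ < _) _ => h1 h2.
have -> : s - t = (S - t) - (S - s) by ring.
by rewrite (le_trans (cabsBD _ _))// (splitr e) lerD.
Qed.

Lemma csum_le u s (B : R) : csum u s -> (forall n, cabs (\sum_(k < n) u k) <= B) -> cabs s <= B.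
Proof.
move=> us H; apply: le_eps => e e0; have [N HN] := us _ e0.
have := HN _ (leqnn N); rewrite cabsB => h.
by rewrite (le_trans (cabs_le_sub _ (\sum_(k < N) u k)))// lerD.
Qed.

Lemma csumZ u s c : csum u s -> csum (fun k => c * u k) (c * s).
Proof.
move=> us e e0; have c0 : 0 < cabs c + 1 by rewrite ltr_wpDl ?cabs_ge0.
have [N HN] := us (e / (cabs c + 1)) (divr_gt0 e0 c0); exists N => n /HN.
rewrite -mulr_sumr -mulrBr cabsM ler_pdivlMr// mulrC; apply: le_trans.
by rewrite ler_wpM2r ?cabs_ge0// lerDl.
Qed.

Lemma csumD u v s t : csum u s -> csum v t -> csum (fun k => u k + v k) (s + t).
Proof.
move=> us vt e e0; have e2 : 0 < e / 2 by rewrite divr_gt0.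
have [N HN] := us _ e2; have [M HM] := vt _ e2; exists (maxn N M) => n.
rewrite geq_max => /andP[/HN h1 /HM h2]; rewrite big_split/=.
set S := \sum_(_ < _) _ in h1 *; set T := \sum_(_ < _) _ in h2 *.
have -> : S + T - (s + t) = (S - s) + (T - t) by ring.
by rewrite (le_trans (cabsD _ _))// (splitr e) lerD.
Qed.

Lemma eq_csum u v s : (forall k, u k = v k) -> csum u s -> csum v s.
Proof. by move=> E; have -> : v = u by apply/funext. Qed.

Lemma csum_shift u s : csum (fun k => u k.+1) s -> csum u (u 0%N + s).
Proof.
move=> us e e0; have [N HN] := us _ e0; exists N.+1 => -[//|n] Nn.
by rewrite big_ord_recl/= opprD addrACA subrr add0r; exact: HN.
Qed.

Lemma summable_tail b : summable b -> forall e, 0 < e ->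
  exists N, forall n m, (N <= n)%N -> \sum_(n <= k < m) b k <= e.
Proof.
move=> [b0 [B HB]] e e0.
pose S := [set \sum_(k < n) b k | n in [set: nat]].
have hS : has_sup S.
  by split; [exists (\sum_(k < 0) b k), 0%N|exists B => _ [n _ <-]].
have [_ [N _ <-] HN] := sup_adherent e0 hS.
exists N => n m Nn.
have [nm|/ltnW mn] := leqP n m; last by rewrite big_geq// ltW.
have h1 : \sum_(k < m) b k <= sup S by apply: ub_le_sup; [case: hS|exists m].
have h2 : \sum_(0 <= k < N) b k <= \sum_(0 <= k < n) b k.
  rewrite (@big_cat_nat _ _ _ N 0 n)//= lerDl; exact: sumr_ge0.
move: h1 HN; rewrite -!(big_mkord xpredT) (@big_cat_nat _ _ _ n 0 m)//= => h1 HN; lra.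
Qed.

Lemma cabs_tail u b n m : (forall k, cabs (u k) <= b k) -> (n <= m)%N ->
  cabs (\sum_(k < m) u k - \sum_(k < n) u k) <= \sum_(n <= k < m) b k.
Proof.
move=> ub nm; rewrite -!(big_mkord xpredT) (@big_cat_nat _ _ _ n 0 m)//= addrAC subrr add0r.
by rewrite (le_trans (cabs_sum _ _ _))// ler_sum.
Qed.

(** The index [N] depends on the majorant alone, which makes the estimate uniform when [u] and [s]
    depend on a parameter. *)
Lemma csum_tail u s b e N : (forall k, cabs (u k) <= b k) -> csum u s ->
  (forall n m, (N <= n)%N -> \sum_(n <= k < m) b k <= e) ->
  forall n, (N <= n)%N -> cabs (\sum_(k < n) u k - s) <= e.
Proof.
move=> ub us H n Nn; apply: le_eps => d d0; have [M HM] := us _ d0.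
have := HM _ (leq_maxl M n).
set m := maxn M n; have nm : (n <= m)%N by exact: leq_maxr.
have := le_trans (cabs_tail ub nm) (H n m Nn).
set S := \sum_(k < m) u k; set T := \sum_(k < n) u k => h1 h2.
have -> : T - s = (S - s) - (S - T) by ring.
rewrite (le_trans (cabsBD _ _))// addrC; exact: lerD.
Qed.

Lemma cauchy_cvg (x : nat -> R) :
  (forall e, 0 < e -> exists N, forall n, (N <= n)%N -> `|x n - x N| <= e) ->
  exists l, forall e, 0 < e -> exists N, forall n, (N <= n)%N -> `|x n - l| <= e.
Proof.
move=> H; have : cvgn x.
  apply/cauchy_cvgP/cauchy_exP => e e0.
  have e2 : 0 < e / 2 by rewrite divr_gt0.
  have [N HN] := H _ e2; exists (x N); exists N => //= n /HN.
  rewrite /ball/= distrC => h; apply: le_lt_trans h _.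
  by rewrite ltr_pdivrMr// ltr_pMr// ltr1n.
move=> /cvg_ex[l /cvgrPdist_le xl]; exists l => e /xl [N _ HN]; exists N => n /HN/=.
by rewrite distrC.
Qed.

Lemma csum_exists u b : summable b -> (forall k, cabs (u k) <= b k) -> exists s, csum u s.
Proof.
move=> sb ub.
have tail e : 0 < e -> exists N, forall n, (N <= n)%N ->
    cabs (\sum_(k < n) u k - \sum_(k < N) u k) <= e.
  move=> e0; have [N HN] := summable_tail sb e0; exists N => n Nn.
  exact: le_trans (cabs_tail ub Nn) (HN _ _ (leqnn N)).
have [|a Ha] := @cauchy_cvg (fun n => complex.Re (\sum_(k < n) u k)).
  move=> e /tail[N HN]; exists N => n /HN; apply: le_trans.
  by rewrite -ReB cabs_Re.
have [|c Hc] := @cauchy_cvg (fun n => complex.Im (\sum_(k < n) u k)).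
  move=> e /tail[N HN]; exists N => n /HN; apply: le_trans.
  by rewrite -ImB cabs_Im.
exists (a +i* c)%C => e e0; have e2 : 0 < e / 2 by rewrite divr_gt0.
have [N HN] := Ha _ e2; have [M HM] := Hc _ e2; exists (maxn N M) => n.
rewrite geq_max => /andP[/HN h1 /HM h2].
by rewrite (le_trans (cabs_le_ReIm _))// ReB ImB (splitr e) lerD.
Qed.

Lemma summable_le b c : (forall k, 0 <= b k) -> (forall k, b k <= c k) -> summable c -> summable b.
Proof.
move=> b0 bc [_ [B HB]]; split=> //; exists B => n; apply: le_trans (HB n).
by apply: ler_sum.
Qed.

Lemma summableZ b (c : R) : 0 <= c -> summable b -> summable (fun k => c * b k).
Proof.
move=> c0 [b0 [B HB]]; split=> [k|]; first by rewrite mulr_ge0.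
by exists (c * B) => n; rewrite -mulr_sumr ler_wpM2l.
Qed.

Lemma csum_cint (u' : nat -> R -> C) (s : R -> C) b a c : a <= c -> summable b ->
  (forall k, cont_on a c (u' k)) -> cont_on a c s ->
  (forall k t, a <= t <= c -> cabs (u' k t) <= b k) ->
  (forall t, a <= t <= c -> csum (fun k => u' k t) (s t)) ->
  csum (fun k => cint a c (u' k)) (cint a c s).
Proof.
move=> ac sb cu cs ub us e e0.
have k0 : 0 < (c - a) + 1 by lra.
have [N HN] := summable_tail sb (divr_gt0 e0 k0); exists N => n Nn.
rewrite -cint_sum; last by move=> i _; exact: cu.
rewrite -cintB//; last by move=> t tac; apply: rcont_sum => i _; exact: cu.
have := @cint_norm _ a c (fun t => \sum_(i < n) u' i t - s t) (e / (c - a + 1)) ac.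
move=> /(_ _ _)/le_trans; apply.
- by move=> t tac; apply: rcontB; [apply: rcont_sum => i _; exact: cu|exact: cs].
- move=> t tac; apply: (@csum_tail (fun k => u' k t) _ b) Nn => //.
    by move=> k; exact: ub.
  exact: us.
- by rewrite mulrAC ler_pdivrMr// ler_pM2l//; lra.
Qed.

Lemma csum_continuous (u' : nat -> R -> C) (s : R -> C) b a c : summable b ->
  (forall k t, a <= t <= c -> rcont (u' k) t) ->
  (forall k t, cabs (u' k t) <= b k) ->
  (forall t, csum (fun k => u' k t) (s t)) ->
  cont_on a c s.
Proof.
move=> sb cu ub us t tac e e0; have e3 : 0 < e / 3 by rewrite divr_gt0.
have [N HN] := summable_tail sb e3.
have T x : cabs (\sum_(k < N) u' k x - s x) <= e / 3.
  by apply: (@csum_tail (fun k => u' k x) _ b) (leqnn N) => // k; exact: ub.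
have [|d d0 Hd] := @rcont_sum _ N u' t _ _ e3; first by move=> i _; exact: cu.
exists d => // x /Hd; have := T x; have := T t.
set A := \sum_(_ < _) _; set B := \sum_(_ < _) _ => h1 h2 h3.
have -> : s x - s t = (B - A) + (A - s t) - (B - s x) by ring.
apply: (le_trans (cabsBD _ _)); apply: (le_trans (lerD (cabsD _ _) (lexx _))).
lra.
Qed.

(** Pascal's rule: multiplication by 1 - x lowers the order of the negative binomial series by one,
    up to a boundary term. *)
Lemma binS_sum (N M : nat) (x : C) :
  (1 - x) * \sum_(n < M) 'C(N.+1 + n, n)%:R * x ^+ n =
  \sum_(n < M) 'C(N + n, n)%:R * x ^+ n - 'C(N + M, N.+1)%:R * x ^+ M.
Proof.
elim: M => [|M IH]; first by rewrite !big_ord0 mulr0 addn0 bin_small// mul0r subrr.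
rewrite !big_ord_recr/= mulrDr IH.
have -> : 'C(N + M.+1, N.+1) = ('C(N + M, N.+1) + 'C(N + M, N))%N by rewrite addnS binS.
have -> : 'C(N.+1 + M, M) = ('C(N + M, N.+1) + 'C(N + M, N))%N.
  by rewrite addSn -binS -(@bin_sub _ N.+1) ?subSS ?addKn// ltnS leq_addr.
have -> : 'C(N + M, M) = 'C(N + M, N).
  by rewrite -(@bin_sub _ N) ?addKn ?leq_addr.
by rewrite natrD exprS; ring.
Qed.

Lemma geo_bounded (x : R) : 0 <= x < 1 -> forall e, 0 < e ->
  exists N, forall n, (N <= n)%N -> x ^+ n <= e.
Proof.
move=> /andP[x0 x1] e e0.
have : x ^+ n @[n --> \oo] --> 0 by apply: cvg_expr; rewrite ger0_norm.
move=> /(@cvgrPdist_le _ R^o) /(_ _ e0) [N _ H]; exists N => n /H /=.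
by rewrite sub0r normrN ger0_norm// exprn_ge0.
Qed.

(** Induction on the order through [binS_sum], whose boundary term has a favourable sign for real
    [x] and is dropped. *)
Lemma bin_geo_sum (N M : nat) (x : R) : 0 <= x < 1 ->
  \sum_(n < M) 'C(N + n, n)%:R * x ^+ n <= (1 - x) ^- N.+1.
Proof.
move=> /andP[x0 x1]; have y0 : 0 < 1 - x by lra.
elim: N => [|N IH].
  rewrite expr1 -[X in _ <= X]mul1r ler_pdivlMr// mulrC.
  under eq_bigr do rewrite add0n binn mul1r.
  by rewrite -[1 - x]opprB mulNr -subrX1 opprB lerBlDr lerDl exprn_ge0.
rewrite exprSr invfM -[X in _ <= _ * X]mul1r mulrA mulr1 ler_pdivlMr// mulrC.
apply: le_trans IH.
rewrite -lecR real_cpxM raddf_sum/=.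
have E k : (\sum_(n < M) (('C(k + n, n)%:R * x ^+ n)%:C)%C : C) =
    \sum_(n < M) 'C(k + n, n)%:R * ((x%:C)%C : C) ^+ n.
  by apply: eq_bigr => n _; rewrite real_cpxM real_cpxX (rmorph_nat (real_complex R)).
rewrite E real_cpxB binS_sum -E raddf_sum/=.
rewrite lerBlDr lerDl -(rmorph_nat (real_complex R)) -real_cpxX -real_cpxM.
by rewrite ler0c mulr_ge0// exprn_ge0.
Qed.

Lemma summable_bin_geo N (x : R) : 0 <= x < 1 ->
  summable (fun n => 'C(N + n, n)%:R * x ^+ n).
Proof.
move=> x01; split=> [n|]; first by rewrite mulr_ge0// exprn_ge0//; case/andP: x01.
by exists ((1 - x) ^- N.+1) => M; exact: bin_geo_sum.
Qed.

Lemma summable_cvg0 b : summable b -> forall e, 0 < e ->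
  exists N, forall n, (N <= n)%N -> b n <= e.
Proof.
move=> sb e e0; have [N HN] := summable_tail sb e0; exists N => n Nn.
by have := HN n n.+1 Nn; rewrite big_nat1.
Qed.

(** A sum exists by absolute convergence. Its value follows by induction on the order: times 1 - x,
    it is the sum of the preceding order. *)
Lemma csum_binomial (N : nat) (x : C) : cabs x < 1 ->
  csum (fun n => 'C(N + n, n)%:R * x ^+ n) ((1 - x) ^- N.+1).
Proof.
move=> x1; have x01 : 0 <= cabs x < 1 by rewrite cabs_ge0.
have nz : 1 - x != 0 by rewrite -[x]mul1r mulrC disc_one_sub ?cabs1.
elim: N => [|N IH].
  move=> e e0.
  have y0 : 0 < cabs (1 - x) by rewrite cabs_gt0.
  have [M HM] := geo_bounded x01 (mulr_gt0 e0 y0); exists M => n /HM h.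
  under eq_bigr do rewrite add0n binn mul1r.
  have -> : \sum_(k < n) x ^+ k - (1 - x) ^- 1 = - (x ^+ n / (1 - x)).
    apply: (mulfI nz); rewrite mulrBr expr1 mulrN mulrCA divff// mulr1.
    by rewrite -[1 - x]opprB mulNr -subrX1; ring.
  by rewrite cabsN cabsM cabsV cabsX ler_pdivrMr.
have [s sP] : exists s, csum (fun n => 'C(N.+1 + n, n)%:R * x ^+ n) s.
  apply: (csum_exists (summable_bin_geo N.+1 x01)) => k.
  by rewrite cabsM cabs_nat cabsX.
suff -> : (1 - x) ^- N.+2 = s by [].
apply: (mulfI nz); rewrite exprS invfM mulVKf//.
apply: (csum_unique IH).
move=> e e0; have e2 : 0 < e / 2 by rewrite divr_gt0.
have [M1 H1] := csumZ (1 - x) sP e2.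
(* The boundary term is at most a term of the convergent series of order [N.+1], hence tends to
   0. *)
have [M2 H2] := summable_cvg0 (summable_bin_geo N.+1 x01) e2.
exists (maxn M1 M2) => n; rewrite geq_max => /andP[/H1 h1 /H2 h2].
move: h1; rewrite -mulr_sumr binS_sum => h1.
set S := \sum_(_ < _) _ in h1 *.
have -> : S - (1 - x) * s = (S - 'C(N + n, N.+1)%:R * x ^+ n - (1 - x) * s)
   + 'C(N + n, N.+1)%:R * x ^+ n by ring.
rewrite (le_trans (cabsD _ _))// (splitr e) lerD// (le_trans _ h2)//.
rewrite cabsM cabs_nat cabsX ler_wpM2r ?exprn_ge0 ?cabs_ge0// ler_nat.
have -> : 'C(N.+1 + n, n) = 'C(N.+1 + n, N.+1).
  by rewrite -(@bin_sub _ N.+1) ?addKn// leq_addr.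
by rewrite addSn binS leq_addr.
Qed.

End Series.

(** * Taylor series of analytic functions *)

Section Fourier.
Variable R : realType.
Local Notation C := R[i].
Local Notation tpi := (2 * pi : R).

Lemma ReN (z : C) : complex.Re (- z) = - complex.Re z.
Proof. by case: z. Qed.

Lemma conjM (z w : C) : ((z * w)^*)%C = (z^*)%C * (w^*)%C.
Proof. exact: (rmorphM (@conjc R)). Qed.

Lemma conjX (z : C) n : ((z ^+ n)^*)%C = (z^*)%C ^+ n.
Proof. by elim: n => [|n IH]; rewrite ?expr0 ?conjc1// !exprS conjM IH. Qed.

Lemma conjB (z w : C) : ((z - w)^*)%C = (z^*)%C - (w^*)%C.
Proof. exact: (rmorphB (@conjc R)). Qed.

Lemma tpi_gt0 : 0 < tpi.
Proof. by rewrite mulr_gt0// pi_gt0. Qed.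

Lemma tpi_ge0 : 0 <= tpi.
Proof. exact: ltW tpi_gt0. Qed.

Lemma cint_char (E : R -> C) (c : C) k : (forall t, rderiv E t (c * E t)) ->
  c != 0 -> E tpi = E 0 -> cint 0 tpi (fun t => E t ^+ k.+1) = 0.
Proof.
move=> dE c0 EE.
have cE t : rcont E t by exact: rderiv_rcont (dE t).
have d t : rderiv (fun s => E s ^+ k.+1) t ((k.+1%:R * c) * E t ^+ k.+1).
  have := rderiv_comp (cdiffX k.+1 (E t)) (dE t).
  by congr (rderiv _ _ _); rewrite /= exprS; ring.
have cX : cont_on 0 tpi (fun t => E t ^+ k.+1) by move=> t _; exact: rcontX.
have := @cint_FTC _ 0 tpi _ (fun t => (k.+1%:R * c) * E t ^+ k.+1) tpi_ge0 _ (fun t _ => d t).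
rewrite cintZ// EE subrr => /(_ _)/eqP; rewrite mulf_eq0 (negbTE (mulf_neq0 _ c0)) ?pnatr_eq0//=.
move=> H; apply/eqP; apply: H => t _; apply: rcontM; [exact: rcont_cst|exact: rcontX].
Qed.

Lemma rderiv_ceN t : rderiv (fun s => ce (- s) : C) t (- 'i%C * ce (- t)).
Proof.
have E (s : R) : ce (- s) = (ce s)^-1 :> C.
  by apply: (mulfI (ce_neq0 s)); rewrite -ceD subrr ce0 divff// ce_neq0.
have -> : (fun s => ce (- s) : C) = (fun s => (ce s)^-1) by apply/funext => s; exact: E.
have := rderiv_comp (cdiffV (ce_neq0 t)) (rderiv_ce t).
congr (rderiv _ _ _); rewrite E expr2 invfM; field; exact: ce_neq0.
Qed.

Lemma rcont_ceN t : rcont (fun s => ce (- s) : C) t.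
Proof. exact: rderiv_rcont (rderiv_ceN t). Qed.

Lemma i_neq0 : 'i%C != 0 :> C.
Proof. by rewrite -cabs_eq0 cabs_i oner_eq0. Qed.

Lemma cint_ce k : cint 0 tpi (fun t => (ce t : C) ^+ k.+1) = 0.
Proof. by apply: (cint_char _ (@rderiv_ce R)); [exact: i_neq0|rewrite ce2pi ce0]. Qed.

Lemma cint_ceN k : cint 0 tpi (fun t => (ce (- t) : C) ^+ k.+1) = 0.
Proof.
apply: (cint_char _ rderiv_ceN); first by rewrite oppr_eq0 i_neq0.
by rewrite oppr0 ce0 ceN ce2pi conjc1.
Qed.

(** Bessel's inequality makes the squared moduli of the Fourier coefficients summable, so the
    coefficients tend to 0. The abstract pair [E], [F] covers both signs of the frequency. *)
Lemma bessel (H E F : R -> C) : cont_on 0 tpi H ->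
  (forall t, rcont E t) -> (forall t, rcont F t) ->
  (forall t, E t * F t = 1) -> (forall t, F t = ((E t)^*)%C) ->
  (forall k, cint 0 tpi (fun t => E t ^+ k.+1) = 0) ->
  (forall k, cint 0 tpi (fun t => F t ^+ k.+1) = 0) ->
  forall e, 0 < e -> exists N, forall n, (N <= n)%N ->
    cabs (cint 0 tpi (fun t => H t * F t ^+ n)) <= e.
Proof.
move=> cH cE cF EF FE oE oF.
pose P n := cint 0 tpi (fun t => H t * F t ^+ n).
have [M HM] := cont_on_bounded tpi_ge0 cH.
pose c n := ((tpi^-1)%:C)%C * P n.
have t0 := tpi_gt0.
have orth k l : cint 0 tpi (fun t => E t ^+ k * F t ^+ l) = if k == l then (tpi%:C)%C else 0.
  case: ltngtP => [kl|kl|->].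
  - rewrite -(oF (l - k).-1); apply: eq_cint => t _.
    by rewrite prednK ?subn_gt0// -{1}(subnKC (ltnW kl)) exprD mulrA -exprMn EF expr1n mul1r.
  - rewrite -(oE (k - l).-1); apply: eq_cint => t _.
    by rewrite prednK ?subn_gt0// -{1}(subnK (ltnW kl)) exprD -mulrA -exprMn EF expr1n mulr1.
  - rewrite -[RHS]mulr1 -[tpi in RHS]subr0 -cint_cst ?tpi_ge0//.
    by apply: eq_cint => t _; rewrite -exprMn EF expr1n.
have cS (d : nat -> C) (G : R -> C) K : (forall t, rcont G t) ->
    forall t, rcont (fun t => \sum_(k < K) d k * G t ^+ k) t.
  move=> cG t; apply: (@rcont_sum _ K (fun k t => d k * G t ^+ k)) => k _; apply: rcontM; [exact: rcont_cst|exact: rcontX].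
(* [S] is the partial Fourier sum of [H] and [T] its conjugate. The integral of |H - S|^2 is
   nonnegative, and by orthogonality its mixed term and its square term are the same multiple of the
   sum of the |P k|^2. *)
have key K : \sum_(k < K) cabs (P k) ^+ 2 <= (M ^+ 2 * tpi) * tpi.
  pose S t := \sum_(k < K) c k * E t ^+ k.
  pose T t := \sum_(k < K) ((c k)^*)%C * F t ^+ k.
  have ST t : T t = ((S t)^*)%C.
    rewrite /S (raddf_sum (@conjc R)) /T; apply: eq_bigr => k _.
    by rewrite [RHS]conjM conjX -FE.
  have cSS : forall t, rcont S t by exact: cS.
  have cTT : forall t, rcont T t by exact: (cS (fun k => ((c k)^*)%C)).
  have A1 : cint 0 tpi (fun t => H t * T t) =
      ((tpi^-1)%:C)%C * ((\sum_(k < K) cabs (P k) ^+ 2)%:C)%C.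
    rewrite (@eq_cint _ _ _ _ (fun t => \sum_(k < K) ((c k)^*)%C * (H t * F t ^+ k))); last first.
      by move=> t _; rewrite mulr_sumr; apply: eq_bigr => k _; rewrite mulrCA.
    have cHF k : cont_on 0 tpi (fun t => H t * F t ^+ k).
      by move=> t tt; apply: rcontM; [exact: cH|exact: rcontX].
    rewrite (@cint_sum _ 0 tpi K (fun k t => ((c k)^*)%C * (H t * F t ^+ k))); last first.
      by move=> k _ t tt; apply: (@rcontM _ (fun=> ((c k)^*)%C)); [exact: rcont_cst|exact: cHF].
    rewrite (raddf_sum (real_complex R)) mulr_sumr; apply: eq_bigr => k _.
    rewrite cintZ// -/(P k) /c conjM conjc_real -mulrA.
    by rewrite [_^*%C * _]mulrC mul_conj.
  have A2 : cint 0 tpi (fun t => S t * T t) =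
      ((tpi^-1)%:C)%C * ((\sum_(k < K) cabs (P k) ^+ 2)%:C)%C.
    rewrite (@eq_cint _ _ _ _ (fun t => \sum_(k < K) c k * (E t ^+ k * T t))); last first.
      by move=> t _; rewrite mulr_suml; apply: eq_bigr => k _; rewrite mulrA.
    rewrite (@cint_sum _ 0 tpi K (fun k t => c k * (E t ^+ k * T t))); last first.
      move=> k _ t tt; apply: rcontM; first exact: rcont_cst.
      by apply: rcontM; [exact: rcontX|exact: cTT].
    rewrite (raddf_sum (real_complex R)) mulr_sumr; apply: eq_bigr => k _.
    rewrite cintZ; last by move=> t tt; apply: rcontM; [exact: rcontX|exact: cTT].
    rewrite (@eq_cint _ _ _ _ (fun t => \sum_(l < K) ((c l)^*)%C * (E t ^+ k * F t ^+ l))); last first.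
      by move=> t _; rewrite mulr_sumr; apply: eq_bigr => l _; rewrite mulrCA.
    have cEF l : cont_on 0 tpi (fun t => E t ^+ k * F t ^+ l).
      by move=> t tt; apply: rcontM; exact: rcontX.
    rewrite (@cint_sum _ 0 tpi K (fun l t => ((c l)^*)%C * (E t ^+ k * F t ^+ l))); last first.
      by move=> l _ t tt; apply: (@rcontM _ (fun=> ((c l)^*)%C)); [exact: rcont_cst|exact: cEF].
    rewrite (bigD1 k)//= cintZ// orth eqxx big1 ?addr0; last first.
      move=> l lk; rewrite cintZ// orth; case: eqP => [kl|]; last by rewrite mulr0.
      by move: lk; rewrite -val_eqE/= kl eqxx.
    rewrite mulrA mul_conj /c cabsM cabs_real exprMn real_normK ?num_real//.
    rewrite -!real_cpxM; congr (_%:C)%C.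
    by rewrite mulrAC; congr (_ * _); rewrite expr2 -mulrA mulVf ?mulr1// gt_eqF.
  have := @cint_norm _ 0 tpi (fun t => H t * ((H t)^*)%C) (M ^+ 2) tpi_ge0.
  have cHc : cont_on 0 tpi (fun t => ((H t)^*)%C).
    move=> t tt e e0; have [d d0 Hd] := cH t tt e e0; exists d => // s /Hd.
    by rewrite -conjB cabs_conj.
  have cHH : cont_on 0 tpi (fun t => H t * ((H t)^*)%C).
    by move=> t tt; apply: rcontM; [exact: cH|exact: cHc].
  move=> /(_ cHH) B; rewrite subr0 in B.
  have {}B : cabs (cint 0 tpi (fun t => H t * ((H t)^*)%C)) <= M ^+ 2 * tpi.
    by apply: B => t tt; rewrite cabsM cabs_conj -expr2 ler_pXn2r ?nnegrE ?cabs_ge0 ?HM//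
      (le_trans (cabs_ge0 _) (HM _ tt)).
  have cHT : cont_on 0 tpi (fun t => H t * T t).
    by move=> t tt; apply: rcontM; [exact: cH|exact: cTT].
  have cST : cont_on 0 tpi (fun t => S t * T t).
    by move=> t tt; apply: rcontM; [exact: cSS|exact: cTT].
  have := @cint_Re_ge0 _ 0 tpi (fun t => H t * ((H t)^*)%C - (1 + 1) * (H t * T t) + S t * T t).
  rewrite cintD//; last first.
    move=> t tt; apply: rcontB; first exact: cHH.
    by apply: rcontM; [exact: rcont_cst|exact: cHT].
  rewrite cintB//; last by move=> t tt; apply: rcontM; [exact: rcont_cst|exact: cHT].
  rewrite cintZ// A1 A2 => /(_ _) G.
  have {}G : 0 <= complex.Re (cint 0 tpi (fun t => H t * ((H t)^*)%C)) -
       tpi^-1 * \sum_(k < K) cabs (P k) ^+ 2.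
    have := G _; rewrite ReD ReB -real_cpxM [(1 + 1) * _]mulrDl mul1r ReD !(ReC (tpi^-1 * _)).
    move=> H'; have : 0 <= complex.Re (cint 0 tpi (fun t => H t * ((H t)^*)%C)) -
     (tpi^-1 * (\sum_(k < K) cabs (P k) ^+ 2) + tpi^-1 * (\sum_(k < K) cabs (P k) ^+ 2)) +
       tpi^-1 * (\sum_(k < K) cabs (P k) ^+ 2); last by lra.
    apply: H' => t tt.
    have -> : complex.Re (H t * ((H t)^*)%C - (1 + 1) * (H t * T t) + S t * T t) =
       complex.Re ((H t - S t) * ((H t - S t)^*)%C).
      rewrite ST conjB.
      have -> : (H t - S t) * ((H t)^*%C - (S t)^*%C) =
        H t * (H t)^*%C - (H t * (S t)^*%C + (H t * (S t)^*%C)^*%C) + S t * (S t)^*%C.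
        by rewrite conjM (conjcK (S t)); ring.
      rewrite [(1 + 1) * _]mulrDl mul1r !ReD !ReN !ReD.
      have -> : complex.Re (H t * (S t)^*%C)^*%C = complex.Re (H t * (S t)^*%C).
        by case: (H t * _).
      by [].
    by rewrite mul_conj ReC sqr_ge0.
  have B2 := le_trans (ler_norm _) (le_trans (cabs_Re _) B).
  rewrite -ler_pdivrMr// mulrC; lra.
have sP : summable (fun k => cabs (P k) ^+ 2).
  by split=> [k|]; [exact: sqr_ge0|exists (M ^+ 2 * tpi * tpi)].
move=> e e0; have [N HN] := summable_cvg0 sP (exprn_gt0 2 e0); exists N => n /HN.
by rewrite ler_pXn2r// ?nnegrE ?cabs_ge0 ?(ltW e0).
Qed.

End Fourier.

(** * Fourier coefficients on circles and Taylor coefficients *)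

Section Taylor.
Variable R : realType.
Local Notation C := R[i].
Local Notation tpi := (2 * pi : R).
Local Notation pt r t := ((r%:C)%C * ce t).

Definition holo (f : C -> C) : Prop := forall z, cabs z < 1 -> exists l, cdiff f z l.

(** The k-th Fourier coefficient on the circle of radius [r], that is, the Taylor coefficient with
    the factor r^k still attached. *)
Definition taylor_coef (f : C -> C) (r : R) k : C :=
  ((tpi^-1)%:C)%C * cint 0 tpi (fun t => f (pt r t) * ce (- t) ^+ k).

Section OneFunction.
Variable f : C -> C.
Hypothesis hf : holo f.

Lemma holo_ccont z : cabs z < 1 -> ccont f z.
Proof. by move=> /hf[l]; exact: cdiff_ccont. Qed.

Lemma holo_arc (r : R) : 0 <= r < 1 -> forall t, rcont (fun t => f (pt r t)) t.
Proof.
move=> /andP[r0 r1] t; apply: (ccont_rcont (f := f)).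
  by apply: holo_ccont; rewrite cabs_pt ger0_norm.
by apply: rcontM; [exact: rcont_cst|exact: rcont_ce].
Qed.

Lemma pt_inv (r t : R) : 0 < r -> (pt r t)^-1 = ((r^-1)%:C)%C * ce (- t).
Proof.
move=> r0; have r0' : ((r%:C)%C : C) != 0 by rewrite -cabs_eq0 cabs_real normr_eq0 gt_eqF.
have p0 : pt r t != 0 by rewrite mulf_neq0// ce_neq0.
apply: (mulfI p0); rewrite divff// mulrACA -real_cpxM -ceD subrr ce0 mulr1.
by rewrite divff// gt_eqF.
Qed.

Lemma real_cpx_neq0 (r : R) : 0 < r -> ((r%:C)%C : C) != 0.
Proof. by move=> r0; rewrite -cabs_eq0 cabs_real normr_eq0 gt_eqF. Qed.

(** Both sides are circle means of f(w) w^-k, which is differentiable away from 0, so the radius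
    does not matter. *)
Lemma taylor_coef_scale (r s : R) k : 0 < r -> r <= s -> s < 1 ->
  (((s^-1)%:C)%C ^+ k) * taylor_coef f s k = (((r^-1)%:C)%C ^+ k) * taylor_coef f r k.
Proof.
move=> r0 rs s1.
have dg z : 0 < cabs z < 1 -> exists l, cdiff (fun w => f w * w^-1 ^+ k) z l.
  move=> /andP[z0 z1]; have [l dl] := hf z1; rewrite cabs_gt0 in z0.
  eexists; apply: cdiffM; first exact: dl.
  exact: cdiff_comp (cdiffV z0) (cdiffX k z^-1).
have E u : 0 < u < 1 -> cint 0 tpi (fun t => f (pt u t) * (pt u t)^-1 ^+ k) =
   (((u^-1)%:C)%C ^+ k) * cint 0 tpi (fun t => f (pt u t) * ce (- t) ^+ k).
  move=> /andP[u0 u1]; rewrite -cintZ.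
    by apply: eq_cint => t _; rewrite pt_inv// exprMn; ring.
  move=> t _; apply: rcontM; first by apply: holo_arc; rewrite ltW.
  by apply: rcontX; exact: rcont_ceN.
have r01 : 0 < r < 1 by rewrite r0 (le_lt_trans rs).
have s01 : 0 < s < 1 by rewrite s1 (lt_le_trans r0).
have H := etrans (esym (E _ s01)) (etrans (circle_integral_const dg r0 rs s1) (E _ r01)).
by rewrite /taylor_coef [LHS]mulrCA H mulrCA.
Qed.

Lemma cint_const_ball (h : R -> C) (c : C) e : 0 <= e ->
  (forall t, rcont h t) -> (forall t, cabs (h t - c) <= e) ->
  cabs (cint 0 tpi h - (tpi%:C)%C * c) <= e * tpi.
Proof.
move=> e0 ch H; have := @cint_norm _ 0 tpi (fun t => h t - c) e (@tpi_ge0 R).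
rewrite cintB//; last by move=> t _; exact: rcont_cst.
rewrite cint_cst ?tpi_ge0// subr0; apply => // t _.
by apply: rcontB => //; exact: rcont_cst.
Qed.

(** The circle integral of f(w) w^(k+1) is the same for all radii and tends to 0 with the radius. *)
Lemma positive_freq_zero (r : R) k : 0 < r < 1 ->
  cint 0 tpi (fun t => f (pt r t) * ce t ^+ k.+1) = 0.
Proof.
move=> /andP[r0 r1].
have dg z : 0 < cabs z < 1 -> exists l, cdiff (fun w => f w * w ^+ k.+1) z l.
  move=> /andP[z0 z1]; have [l dl] := hf z1.
  by eexists; apply: cdiffM; [exact: dl|exact: cdiffX].
have E u : 0 < u < 1 -> cint 0 tpi (fun t => f (pt u t) * (pt u t) ^+ k.+1) =
   (u%:C)%C ^+ k.+1 * cint 0 tpi (fun t => f (pt u t) * ce t ^+ k.+1).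
  move=> /andP[u0 u1]; rewrite -cintZ.
    by apply: eq_cint => t _; rewrite exprMn; ring.
  move=> t _; apply: rcontM; first by apply: holo_arc; rewrite ltW.
  by apply: rcontX; exact: rcont_ce.
suff : cint 0 tpi (fun t => f (pt r t) * (pt r t) ^+ k.+1) = 0.
  rewrite E ?r0// => /eqP; rewrite mulf_eq0 expf_eq0/= (negbTE (real_cpx_neq0 r0)).
  by move=> /eqP.
apply/eqP; rewrite -cabs_eq0; apply/eqP; apply: le_eps0; first exact: cabs_ge0.
move=> e e0.
have c0 : ccont (fun w => f w * w ^+ k.+1) 0.
  apply: ccontM; first by apply: holo_ccont; rewrite cabs0.
  exact: cdiff_ccont (cdiffX _ _).
have t0 := @tpi_gt0 R.
have [d d0 Hd] := c0 _ (divr_gt0 e0 t0).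
pose u := Num.min r (d / 2).
have u0 : 0 < u by rewrite lt_min r0 divr_gt0.
have ur : u <= r by rewrite ge_min lexx.
have ud : u < d by rewrite (@le_lt_trans _ _ (d / 2)) ?ge_min ?lexx ?orbT//; lra.
rewrite (circle_integral_const dg u0 ur r1).
have -> : e = e / tpi * (tpi - 0) by rewrite subr0 divfK// gt_eqF.
apply: cint_norm; first exact: tpi_ge0.
  move=> t _; apply: rcontM; first by apply: holo_arc; rewrite (ltW u0)/= (le_lt_trans ur).
  apply: rcontX; apply: rcontM; [exact: rcont_cst|exact: rcont_ce].
move=> t _; have := Hd (pt u t); rewrite subr0 cabs_pt gtr0_norm// => /(_ ud).
by rewrite [0 ^+ _]exprS mul0r mulr0 subr0.
Qed.

(* With q the difference quotient of f at the point, the partial sums telescope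
   up to a Fourier coefficient of q, which tends to 0 by Bessel's inequality. *)
Lemma fourier_inversion (r t0 : R) : 0 < r < 1 ->
  csum (fun k => taylor_coef f r k * ce t0 ^+ k) (f (pt r t0)).
Proof.
move=> r01; have /andP[r0 r1] := r01.
set z0 := pt r t0.
have z01 : cabs z0 < 1 by rewrite cabs_pt gtr0_norm.
have [l /cdiff_quot[q [cq _ qE]]] := hf z01.
have cqr t : rcont (fun t => q (pt r t)) t.
  apply: (ccont_rcont (f := q)); last by apply: rcontM; [exact: rcont_cst|exact: rcont_ce].
  have [->//|wz] := eqVneq (pt r t) z0.
  have cw : cabs (pt r t) < 1 by rewrite cabs_pt gtr0_norm.
  have c2 : ccont (fun w => (f w - f z0) * (w - z0)^-1) (pt r t).
    apply: ccontM; first by apply: ccontD; [exact: holo_ccont|exact: ccont_cst].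
    apply: ccontV; first by apply: ccontD; [exact: ccont_id|exact: ccont_cst].
    by rewrite subr_eq0.
  have E w : w != z0 -> q w = (f w - f z0) * (w - z0)^-1.
    by move=> w0; rewrite qE mulfK// subr_eq0.
  move=> e e0; have [d d0 Hd] := c2 _ e0.
  exists (Num.min d (cabs (pt r t - z0))); first by rewrite lt_min d0 cabs_gt0 subr_eq0.
  move=> w; rewrite lt_min => /andP[wd wz0].
  rewrite !E//; first exact: Hd.
  by apply/eqP => wz'; move: wz0; rewrite wz' cabsB ltxx.
pose P k := cint 0 tpi (fun t => q (pt r t) * ce (- t) ^+ k).
pose N k := cint 0 tpi (fun t => q (pt r t) * ce t ^+ k).
have eN t : ce (- t) * ce t = 1 :> C by rewrite -ceD addNr ce0.
have eP t : ce t * ce (- t) = 1 :> C by rewrite -ceD subrr ce0.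
have cP k : cont_on 0 tpi (fun t => q (pt r t) * ce (- t) ^+ k).
  by move=> t _; apply: rcontM => //; apply: rcontX; exact: rcont_ceN.
have cN k : cont_on 0 tpi (fun t => q (pt r t) * ce t ^+ k).
  by move=> t _; apply: rcontM => //; apply: rcontX; exact: rcont_ce.
have P0 : forall e, 0 < e -> exists M, forall n, (M <= n)%N -> cabs (P n) <= e.
  apply: (@bessel _ _ (fun t => ce t) (fun t => ce (- t))) => //.
  - by move=> t; exact: rcont_ce.
  - by move=> t; exact: rcont_ceN.
  - by move=> t; rewrite ceN.
  - exact: cint_ce.
  - exact: cint_ceN.
have N0 : forall e, 0 < e -> exists M, forall n, (M <= n)%N -> cabs (N n) <= e.
  apply: (@bessel _ _ (fun t => ce (- t)) (fun t => ce t)) => //.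
  - by move=> t; exact: rcont_ceN.
  - by move=> t; exact: rcont_ce.
  - by move=> t; rewrite -ceN opprK.
  - exact: cint_ceN.
  - exact: cint_ce.
have fE t : f (pt r t) = f z0 + q (pt r t) * (pt r t - z0) by rewrite -qE addrC subrK.
pose Rr : C := (r%:C)%C.
have AP k : cint 0 tpi (fun t => f (pt r t) * ce (- t) ^+ k.+1) = Rr * P k - z0 * P k.+1.
  rewrite (@eq_cint _ _ _ _ (fun t => f z0 * ce (- t) ^+ k.+1 +
    (Rr * (q (pt r t) * ce (- t) ^+ k) - z0 * (q (pt r t) * ce (- t) ^+ k.+1)))); last first.
    move=> t _; rewrite fE exprS.
    have -> : (f z0 + q (pt r t) * (pt r t - z0)) * (ce (- t) * ce (- t) ^+ k) =
      f z0 * (ce (- t) * ce (- t) ^+ k) + (Rr * (q (pt r t) * ((ce t * ce (- t)) * ce (- t) ^+ k)) -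
       z0 * (q (pt r t) * (ce (- t) * ce (- t) ^+ k))) by rewrite /Rr; ring.
    by rewrite eP mul1r.
  have c1 : cont_on 0 tpi (fun t => Rr * (q (pt r t) * ce (- t) ^+ k)).
    by move=> t tt; apply: rcontM; [exact: rcont_cst|exact: cP].
  have c2 : cont_on 0 tpi (fun t => z0 * (q (pt r t) * ce (- t) ^+ k.+1)).
    by move=> t tt; apply: rcontM; [exact: rcont_cst|exact: cP].
  have c3 : cont_on 0 tpi (fun t => ce (- t) ^+ k.+1 : C).
    by move=> t _; apply: rcontX; exact: rcont_ceN.
  rewrite cintD; last by move=> t tt; apply: rcontB; [exact: c1|exact: c2].
    by rewrite (cintB c1 c2) (cintZ _ c3) (cintZ _ (cP k)) (cintZ _ (cP k.+1)) cint_ceN mulr0 add0r.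
  by move=> t tt; apply: rcontM; [exact: rcont_cst|exact: c3].
have AN k : cint 0 tpi (fun t => f (pt r t) * ce t ^+ k) =
    f z0 * cint 0 tpi (fun t => ce t ^+ k) + (Rr * N k.+1 - z0 * N k).
  rewrite (@eq_cint _ _ _ _ (fun t => f z0 * ce t ^+ k +
    (Rr * (q (pt r t) * ce t ^+ k.+1) - z0 * (q (pt r t) * ce t ^+ k)))); last first.
    by move=> t _; rewrite fE exprS /Rr; ring.
  have c1 : cont_on 0 tpi (fun t => Rr * (q (pt r t) * ce t ^+ k.+1)).
    by move=> t tt; apply: rcontM; [exact: rcont_cst|exact: cN].
  have c2 : cont_on 0 tpi (fun t => z0 * (q (pt r t) * ce t ^+ k)).
    by move=> t tt; apply: rcontM; [exact: rcont_cst|exact: cN].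
  have c3 : cont_on 0 tpi (fun t => ce t ^+ k : C).
    by move=> t _; apply: rcontX; exact: rcont_ce.
  rewrite cintD; last by move=> t tt; apply: rcontB; [exact: c1|exact: c2].
    by rewrite (cintB c1 c2) (cintZ _ c3) (cintZ _ (cN k)) (cintZ _ (cN k.+1)).
  by move=> t tt; apply: rcontM; [exact: rcont_cst|exact: c3].
pose u : C := ce t0.
have u1 : cabs u = 1 by exact: cabs_ce.
have Rr0 : Rr != 0 by exact: real_cpx_neq0.
have z0E : z0 = Rr * u by [].
(* The vanishing of the positive frequencies of [f] leaves this relation. It makes the modulus of
   [N k.+1] constant in [k], while Bessel's inequality sends it to 0, so [N 1] is 0. *)
have Nrec k : N k.+2 = u * N k.+1.
  have := AN k.+1; rewrite positive_freq_zero// cint_ce mulr0 add0r z0E -mulrA -mulrBr.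
  by move=> /esym/eqP; rewrite mulf_eq0 (negbTE Rr0)/= subr_eq0 => /eqP.
have N1 : N 1%N = 0.
  have Nk k : cabs (N k.+1) = cabs (N 1%N).
    by elim: k => [//|k IH]; rewrite Nrec cabsM u1 mul1r.
  apply/eqP; rewrite -cabs_eq0; apply/eqP; apply: le_eps0; first exact: cabs_ge0.
  by move=> e /N0[M HM]; rewrite -(Nk M) HM.
have PN : P 0%N = N 0%N by apply: eq_cint => t _; rewrite !expr0.
have tp0 := @tpi_gt0 R.
have tpC : ((tpi^-1)%:C)%C * (tpi%:C)%C = 1 :> C by rewrite -real_cpxM mulVf// gt_eqF.
have partial n : \sum_(k < n.+1) taylor_coef f r k * u ^+ k =
   f z0 - ((tpi^-1)%:C)%C * (z0 * u ^+ n * P n).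
  elim: n => [|n IH].
    rewrite big_ord_recl big_ord0 addr0 !expr0 !mulr1 PN /taylor_coef.
    rewrite (@eq_cint _ _ _ _ (fun t => f (pt r t) * ce t ^+ 0)); last by move=> t _; rewrite !expr0.
    rewrite AN N1 mulr0 add0r mulrDr mulrN.
    rewrite (@eq_cint _ _ _ _ (fun=> 1)); last by move=> t _; rewrite expr0.
    by rewrite cint_cst ?tpi_ge0// subr0 mulr1 mulrCA tpC mulr1.
  rewrite big_ord_recr/= IH /taylor_coef AP z0E exprS; ring.
move=> e e0.
have e'0 : 0 < e * tpi by rewrite mulr_gt0.
have [M HM] := P0 _ e'0; exists M.+1 => -[//|n] Mn.
rewrite -/u partial addrAC subrr add0r cabsN cabsM cabs_real.
rewrite (ger0_norm (_ : 0 <= tpi^-1)) ?invr_ge0 ?tpi_ge0// mulrC ler_pdivrMr//.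
rewrite cabsM [cabs (z0 * _)]cabsM cabsX u1 expr1n mulr1.
rewrite -[X in _ <= X]mul1r; apply: ler_pM; rewrite ?cabs_ge0//; first exact: ltW.
exact: HM.
Qed.

Lemma taylor_bound (r : R) k (M : R) : 0 <= r < 1 -> (forall t, cabs (f (pt r t)) <= M) ->
  cabs (taylor_coef f r k) <= M.
Proof.
move=> r01 H; rewrite /taylor_coef cabsM cabs_real.
have tp0 := @tpi_gt0 R.
rewrite ger0_norm ?invr_ge0 ?tpi_ge0// mulrC ler_pdivrMr// -[X in M * X]subr0.
apply: cint_norm; first exact: tpi_ge0.
  move=> t _; apply: rcontM; first exact: holo_arc.
  by apply: rcontX; exact: rcont_ceN.
by move=> t _; rewrite cabsM cabsX cabs_ce expr1n mulr1.
Qed.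

Lemma polar (z : C) : exists2 t : R, 0 <= t <= tpi & z = pt (cabs z) t.
Proof.
have [->|z0] := eqVneq z 0; first by exists 0; rewrite ?lexx ?tpi_ge0// cabs0 mul0r.
have cz : 0 < cabs z by rewrite cabs_gt0.
pose c := complex.Re z / cabs z.
have cB : -1 <= c <= 1.
  by rewrite -ler_norml normrM normfV (gtr0_norm cz) ler_pdivrMr// mul1r cabs_Re.
have s2 : (complex.Im z / cabs z) ^+ 2 = 1 - c ^+ 2.
  rewrite /c !expr_div_n; apply/eqP; rewrite -subr_eq0; apply/eqP.
  have -> : complex.Im z ^+ 2 = cabs z ^+ 2 - complex.Re z ^+ 2.
    by rewrite cabs_sqr addrAC subrr add0r.
  by field; rewrite gt_eqF.
have ac : 0 <= acos c <= pi by rewrite acos_ge0 ?acos_lepi.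
have cc : cos (acos c) = c by rewrite acosK// in_itv.
have sc : sin (acos c) = `|complex.Im z / cabs z|.
  rewrite sin_acos// -s2 sqrtr_sqr//.
have zE : z = (((cabs z) * c) +i* ((cabs z) * (complex.Im z / cabs z)))%C.
  apply/eqP; rewrite eq_complex/= /c; apply/andP; split; apply/eqP; field; by rewrite gt_eqF.
have [i0|i0] := leP 0 (complex.Im z).
  exists (acos c); first by move: ac => /andP[-> h]/=; have := @pi_ge0 R; lra.
  rewrite {1}zE; apply/eqP; rewrite eq_complex ReM ImM ReC ImC/= cc sc !mul0r subr0 addr0.
  by rewrite ger0_norm ?eqxx// divr_ge0// ltW.
exists (tpi - acos c); first by move: ac => /andP[h1 h2]; have := @pi_ge0 R; lra.
rewrite addrC ceD ce2pi mulr1.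
rewrite {1}zE; apply/eqP; rewrite eq_complex ReM ImM ReC ImC/= cosN sinN cc sc !mul0r subr0 addr0.
by rewrite ltr0_norm ?opprK ?eqxx// pmulr_llt0// invr_gt0.
Qed.

Lemma analytic_series : exists a : nat -> C,
  [/\ forall r, 0 < r < 1 -> forall k, taylor_coef f r k = a k * (r%:C)%C ^+ k,
      forall r : R, 0 <= r < 1 -> exists M, forall k, cabs (a k) * r ^+ k <= M &
      forall z, cabs z < 1 -> csum (fun k => a k * z ^+ k) (f z)].
Proof.
(* The radius 1/2 is arbitrary, since the normalised coefficient is the same at all radii. *)
pose a k := (((2^-1)^-1)%:C)%C ^+ k * taylor_coef f 2^-1 k.
have aE r : 0 < r < 1 -> forall k, taylor_coef f r k = a k * (r%:C)%C ^+ k.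
  move=> /andP[r0 r1] k; have rC := real_cpx_neq0 r0.
  have rV : (((r^-1)%:C)%C : C) ^+ k * (r%:C)%C ^+ k = 1.
    by rewrite -exprMn -real_cpxM mulVf ?gt_eqF// expr1n.
  apply: (@mulfI _ ((((r^-1)%:C)%C : C) ^+ k)).
    by rewrite expf_neq0// real_cpx_neq0// invr_gt0.
  rewrite [RHS]mulrCA rV mulr1 /a.
  have [rh|hr] := leP r 2^-1.
    by rewrite -(taylor_coef_scale k r0 rh)//; lra.
  by rewrite -(taylor_coef_scale k _ (ltW hr))//; lra.
exists a; split=> //.
- have B r : 0 < r < 1 -> exists M, forall k, cabs (a k) * r ^+ k <= M.
    move=> r01; have /andP[r0 r1] := r01.
    have [|M HM] := @cont_on_bounded _ 0 tpi (fun t => f (pt r t)) (@tpi_ge0 R).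
      by move=> t _; apply: holo_arc; rewrite ltW.
    exists M => k.
    have -> : cabs (a k) * r ^+ k = cabs (taylor_coef f r k).
      by rewrite aE// cabsM cabsX cabs_real gtr0_norm.
    apply: taylor_bound; first by rewrite ltW.
    move=> t; have [s ss] := polar (ce t); rewrite cabs_ce mul1r => ->.
    by exact: HM.
  move=> r /andP[r0 r1]; have [|M HM] := B ((1 + r) / 2); first by apply/andP; split; lra.
  exists M => k; apply: le_trans (HM k); rewrite ler_wpM2l ?cabs_ge0// lerXn2r ?nnegrE//; lra.
- move=> z z1; have [t tt zE] := polar z.
  have [z0|z0] := eqVneq z 0; last first.
    have r01 : 0 < cabs z < 1 by rewrite cabs_gt0 z0.
    have := fourier_inversion t r01; rewrite -zE; apply: eq_csum => k.
    by rewrite aE// -mulrA -exprMn -zE.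
  (* The origin lies on no circle of positive radius; its value is the limit of the circle means as
     the radius tends to 0. *)
  have a0 : a 0%N = f 0.
    apply/eqP; rewrite -subr_eq0 -cabs_eq0; apply/eqP; apply: le_eps0; first exact: cabs_ge0.
    move=> e e0; have c0 : ccont f 0 by apply: holo_ccont; rewrite cabs0.
    have [d d0 Hd] := c0 _ e0.
    pose r := Num.min 2^-1 (d / 2).
    have r0 : 0 < r by rewrite lt_min invr_gt0 ltr0n divr_gt0.
    have rd : r < d by rewrite (@le_lt_trans _ _ (d / 2)) ?ge_min ?lexx ?orbT//; lra.
    have r1 : r < 1 by rewrite (@le_lt_trans _ _ 2^-1) ?ge_min ?lexx//; lra.
    have tp0 := @tpi_gt0 R.
    have := aE r _ 0%N; rewrite r0 r1 expr0 mulr1 => /(_ isT) <-.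
    have H : cabs (cint 0 tpi (fun t => f (pt r t) * ce (- t) ^+ 0) - (tpi%:C)%C * f 0) <= e * tpi.
      apply: cint_const_ball; first exact: ltW.
        move=> u; apply: rcontM; first by apply: holo_arc; rewrite ltW.
        by apply: rcontX; exact: rcont_ceN.
      move=> u; rewrite expr0 mulr1; apply: Hd.
      by rewrite subr0 cabs_pt gtr0_norm.
    have -> : taylor_coef f r 0 - f 0 = ((tpi^-1)%:C)%C *
       (cint 0 tpi (fun t => f (pt r t) * ce (- t) ^+ 0) - (tpi%:C)%C * f 0).
      by rewrite mulrBr mulrA -real_cpxM mulVf ?mul1r// gt_eqF.
    by rewrite cabsM cabs_real ger0_norm ?invr_ge0 ?tpi_ge0// mulrC ler_pdivrMr.
  rewrite z0 -a0 => e e0; exists 1%N => -[//|n] _.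
  rewrite big_ord_recl/= expr0 mulr1 big1 ?addr0 ?subrr ?cabs0 ?ltW//.
  by move=> i _; rewrite exprS mul0r mulr0.
Qed.

End OneFunction.

End Taylor.

(** * Power series in the unit disc and the integral operator *)

Section PowerSeries.
Variable R : realType.
Local Notation C := R[i].
Implicit Types (a : nat -> C) (F f g h phi : C -> C).

Definition rad1 a : Prop := forall r : R, 0 <= r < 1 -> exists M, forall k, cabs (a k) * r ^+ k <= M.

Lemma radius_between (r : R) : 0 <= r < 1 -> exists p : R, [/\ 0 < p, r < p & 0 <= p < 1].
Proof.
move=> /andP[r0 r1]; exists ((1 + r) / 2); split; [lra|lra|].
by apply/andP; split; lra.
Qed.

(** A radius [p] strictly between [r] and 1 yields the geometric ratio r / p, which absorbs the
    polynomial growth of the binomial factor. That factor pays for derivatives of order up to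
    [N]. *)
Lemma rad1_summable a (r : R) N : rad1 a -> 0 <= r < 1 ->
  summable (fun k => 'C(N + k, k)%:R * (cabs (a k) * r ^+ k)).
Proof.
move=> ra r01; have [p [p0 rp p1]] := radius_between r01.
move: r01 => /andP[r0 r1].
have [M HM] := ra _ p1.
have q01 : 0 <= r / p < 1 by apply/andP; split; [exact: divr_ge0 r0 (ltW p0)|rewrite ltr_pdivrMr// mul1r].
have M0 : 0 <= M by apply: le_trans (HM 0%N); rewrite mulr_ge0 ?cabs_ge0// exprn_ge0// ltW.
apply: summable_le (summableZ M0 (summable_bin_geo N q01)) => k.
  by rewrite !mulr_ge0 ?cabs_ge0// exprn_ge0.
rewrite [X in _ <= X]mulrCA ler_wpM2l//.
have -> : cabs (a k) * r ^+ k = cabs (a k) * p ^+ k * (r / p) ^+ k.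
  by rewrite expr_div_n [_ / _]mulrC mulrA mulfK ?gt_eqF ?exprn_gt0.
by rewrite ler_wpM2r// exprn_ge0//; case/andP: q01.
Qed.

Lemma rad1_deriv a : rad1 a -> rad1 (fun k => k.+1%:R * a k.+1).
Proof.
move=> ra r r01; have [p [p0 rp p1]] := radius_between r01.
move: r01 => /andP[r0 r1].
have [_ [B HB]] := rad1_summable 1 ra p1.
exists (B / p) => k; rewrite ler_pdivlMr//; apply: le_trans (HB k.+2).
rewrite big_ord_recr/= cabsM cabs_nat.
have -> : 'C(1 + k.+1, k.+1) = k.+2 by rewrite add1n -[in LHS](@bin_sub _ k.+1)// subSnn bin1.
apply: ler_wpDl.
  by apply: sumr_ge0 => i _; rewrite !mulr_ge0 ?cabs_ge0// exprn_ge0// ltW.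
rewrite -!mulrA; apply: ler_pM; rewrite ?mulr_ge0 ?cabs_ge0 ?exprn_ge0 ?(ltW p0)//.
  by rewrite ler_nat.
rewrite ler_wpM2l ?cabs_ge0// exprSr ler_wpM2r ?(ltW p0)// lerXn2r ?nnegrE ?(ltW p0)//.
exact: ltW.
Qed.

(** Second-order remainder of a power, by induction on the exponent. The quotient p^n / p^2 replaces
    the exponent n - 2, which would be truncated for n < 2. *)
Lemma pow_taylor (z w : C) (p : R) n : 0 < p -> cabs z <= p -> cabs w <= p ->
  cabs (w ^+ n - z ^+ n - n%:R * z ^+ n.-1 * (w - z)) <=
    n%:R ^+ 2 * p ^+ n / p ^+ 2 * cabs (w - z) ^+ 2.
Proof.
move=> p0 zp wp; elim: n => [|n IH].
  rewrite !expr0 subrr !mul0r subrr cabs0 expr0n/= !mul0r//.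
have -> : w ^+ n.+1 - z ^+ n.+1 - n.+1%:R * z ^+ n * (w - z) =
  w * (w ^+ n - z ^+ n - n%:R * z ^+ n.-1 * (w - z)) + n%:R * z ^+ n.-1 * (w - z) ^+ 2.
  case: n {IH} => [|n]; first by rewrite !expr0 !expr1 !mul0r; ring.
  by rewrite /= -[n.+2%:R]natr1 -[n.+1%:R]natr1 !exprS; ring.
apply: (le_trans (cabsD _ _)); rewrite !cabsM !cabsX cabs_nat.
set h := cabs (w - z) in IH *.
have h0 : 0 <= h ^+ 2 by rewrite sqr_ge0.
have X1 : cabs w * cabs (w ^+ n - z ^+ n - n%:R * z ^+ n.-1 * (w - z)) <=
   p * (n%:R ^+ 2 * p ^+ n / p ^+ 2 * h ^+ 2).
  by apply: ler_pM; rewrite ?cabs_ge0.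
have X2 : n%:R * cabs z ^+ n.-1 * h ^+ 2 <= n%:R * p ^+ n.+1 / p ^+ 2 * h ^+ 2.
  rewrite ler_wpM2r//; case: n {IH X1} => [|n]; first by rewrite !mul0r.
  rewrite -mulrA ler_wpM2l// !exprSr expr0 mul1r invfM mulrA mulfK ?gt_eqF// mulfK ?gt_eqF//.
  by rewrite lerXn2r// nnegrE ?cabs_ge0// ltW.
apply: (le_trans (lerD X1 X2)).
have -> : p * (n%:R ^+ 2 * p ^+ n / p ^+ 2 * h ^+ 2) + n%:R * p ^+ n.+1 / p ^+ 2 * h ^+ 2 =
  (n%:R ^+ 2 + n%:R) * (p ^+ n.+1 / p ^+ 2 * h ^+ 2) by rewrite [p ^+ n.+1]exprS; ring.
have -> : n.+1%:R ^+ 2 * p ^+ n.+1 / p ^+ 2 * h ^+ 2 =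
  n.+1%:R ^+ 2 * (p ^+ n.+1 / p ^+ 2 * h ^+ 2) by ring.
apply: ler_wpM2r; first by rewrite mulr_ge0// divr_ge0// exprn_ge0// ltW.
by rewrite -natr1; have : 0 <= n%:R :> R by []; nra.
Qed.

(** The second-order remainders of the powers are summed term by term. Their factor k^2 is at most
    (k+2)(k+1), twice the binomial coefficient of [rad1_summable 2], so the total remainder is of
    order |w - z|^2. *)
Lemma pser_cdiff a F : rad1 a ->
  (forall z, cabs z < 1 -> csum (fun k => a k * z ^+ k) (F z)) ->
  forall z, cabs z < 1 -> exists2 l,
    csum (fun k => k.+1%:R * a k.+1 * z ^+ k) l & cdiff F z l.
Proof.
move=> ra sF z z1; have z0 := cabs_ge0 z.
have z01 : 0 <= cabs z < 1 by rewrite z0.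
have [p [p0 zp p01]] := radius_between z01.
have [l sl] : exists l, csum (fun k => k.+1%:R * a k.+1 * z ^+ k) l.
  apply: csum_exists (rad1_summable 0 (rad1_deriv ra) z01) _ => k.
  by rewrite add0n binn mul1r cabsM cabsX.
exists l => //.
have sl0 : csum (fun k => k%:R * a k * z ^+ k.-1) l.
  by have := @csum_shift _ (fun k => k%:R * a k * z ^+ k.-1) _ sl; rewrite !mul0r add0r.
have [_ [B HB]] := rad1_summable 2 ra p01.
have B0 : 0 <= B by have := HB 0%N; rewrite big_ord0.
pose K := 2 * B / p ^+ 2.
have K0 : 0 <= K by apply: divr_ge0; [exact: mulr_ge0|rewrite exprn_ge0// ltW].
have main w : cabs w < p -> cabs (F w - F z - l * (w - z)) <= K * cabs (w - z) ^+ 2.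
  move=> wp.
  have w1 : cabs w < 1 by case/andP: p01 => _; apply: lt_trans.
  have S : csum (fun k => a k * (w ^+ k - z ^+ k - k%:R * z ^+ k.-1 * (w - z)))
      (F w - F z - l * (w - z)).
    have := csumD (csumD (sF _ w1) (csumZ (-1) (sF _ z1))) (csumZ (- (w - z)) sl0).
    have -> : F w + -1 * F z + - (w - z) * l = F w - F z - l * (w - z) by ring.
    by apply: eq_csum => k; ring.
  apply: (csum_le S) => n; apply: (le_trans (cabs_sum _ _ _)).
  apply: (@le_trans _ _ (\sum_(k < n) (2 / p ^+ 2 * cabs (w - z) ^+ 2) *
     ('C(2 + k, k)%:R * (cabs (a k) * p ^+ k)))).
    apply: ler_sum => k _; rewrite cabsM.
    apply: (le_trans (ler_wpM2l (cabs_ge0 _) (pow_taylor k p0 (ltW zp) (ltW wp)))).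
    have -> : cabs (a k) * (k%:R ^+ 2 * p ^+ k / p ^+ 2 * cabs (w - z) ^+ 2) =
       (p ^- 2 * cabs (w - z) ^+ 2) * (k%:R ^+ 2 * (cabs (a k) * p ^+ k)) by ring.
    have -> : 2 / p ^+ 2 * cabs (w - z) ^+ 2 * ('C(2 + k, k)%:R * (cabs (a k) * p ^+ k)) =
       (p ^- 2 * cabs (w - z) ^+ 2) * ((2 * 'C(2 + k, k)%:R) * (cabs (a k) * p ^+ k)) by ring.
    apply: ler_wpM2l; first by rewrite mulr_ge0 ?invr_ge0 ?exprn_ge0 ?cabs_ge0 ?(ltW p0).
    apply: ler_wpM2r; first by rewrite mulr_ge0 ?exprn_ge0 ?cabs_ge0 ?(ltW p0).
    rewrite -natrX -natrM ler_nat -[in X in (_ <= X)%N](@bin_sub _ k) ?leq_addl// addnK.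
    have := mul_bin_diag (k.+2) 1; rewrite bin1 /= => E.
    rewrite -[(2 + k)%N]/(k.+2) -E -mulnn leq_mul//.
    by rewrite ltnW.
  rewrite -mulr_sumr /K.
  have -> : 2 * B / p ^+ 2 * cabs (w - z) ^+ 2 = 2 / p ^+ 2 * cabs (w - z) ^+ 2 * B by ring.
  apply: ler_wpM2l => //.
  by rewrite mulr_ge0 ?exprn_ge0 ?cabs_ge0// divr_ge0// exprn_ge0// ltW.
move=> e e0; have K1 : 0 < K + 1 by lra.
exists (Num.min (p - cabs z) (e / (K + 1))); first by rewrite lt_min subr_gt0 zp divr_gt0.
move=> h; rewrite lt_min ltr_pdivlMr// => /andP[h1 h2].
have := main (z + h); rewrite [z + h - z]addrAC subrr add0r => /(_ _)/le_trans; apply.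
  by rewrite (le_lt_trans (cabsD _ _))// -ltrBrDl.
rewrite expr2 mulrA ler_wpM2r ?cabs_ge0//; have := cabs_ge0 h; nra.
Qed.

Lemma cdiff_local f g z l : cabs z < 1 -> (forall w, cabs w < 1 -> f w = g w) ->
  cdiff f z l -> cdiff g z l.
Proof.
move=> z1 fg df e e0; have [d d0 H] := df _ e0.
exists (Num.min d (1 - cabs z)); first by rewrite lt_min d0 subr_gt0.
move=> h; rewrite lt_min => /andP[hd h1]; rewrite -!fg//; first exact: H.
by rewrite (le_lt_trans (cabsD _ _))// -ltrBrDl.
Qed.

Lemma analytic_holo f : analytic_on_disc f <-> holo f.
Proof.
split=> [af z z1|hf z z1]; first by exists (cderiv f z); exact: derivable_cdiff (af _ z1).
by have [l dl] := hf z z1; case: (cdiff_derivable dl).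
Qed.

Lemma cderivE f z l : cdiff f z l -> cderiv f z = l.
Proof. by move=> df; case: (cdiff_derivable df). Qed.

Lemma holo_cdiff f z : holo f -> cabs z < 1 -> cdiff f z (cderiv f z).
Proof. by move=> hf z1; have [l dl] := hf z z1; rewrite (cderivE dl). Qed.

Lemma holo_series f : holo f -> exists a : nat -> C,
  [/\ rad1 a, forall z, cabs z < 1 -> csum (fun k => a k * z ^+ k) (f z),
      forall z, cabs z < 1 -> csum (fun k => k.+1%:R * a k.+1 * z ^+ k) (cderiv f z) &
      forall r, 0 < r < 1 -> forall k, taylor_coef f r k = a k * (r%:C)%C ^+ k].
Proof.
move=> hf; have [a [tE ra sF]] := analytic_series hf; exists a; split=> // z z1.
by have [l sl dl] := pser_cdiff ra sF z1; rewrite (cderivE dl).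
Qed.

Lemma holo_cderiv f : holo f -> holo (cderiv f).
Proof.
move=> hf; have [a [ra _ sd _]] := holo_series hf => z z1.
by have [l _ dl] := pser_cdiff (rad1_deriv ra) sd z1; exists l.
Qed.

Lemma holo_primitive h : holo h -> exists2 H : C -> C, H 0 = 0 &
  forall z, cabs z < 1 -> cdiff H z (h z).
Proof.
move=> hh; have [a [ra sh _ _]] := holo_series hh.
pose b k : C := if k is k'.+1 then k'.+1%:R^-1 * a k' else 0.
have rb : rad1 b.
  move=> r /[dup] r01 /andP[r0 r1]; have [M HM] := ra r r01.
  have M0 : 0 <= M by apply: le_trans (HM 0%N); rewrite mulr_ge0 ?cabs_ge0// exprn_ge0.
  exists M => -[|k]; first by rewrite cabs0 mul0r.
  apply: le_trans (HM k); rewrite /b cabsM exprS.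
  have n1 : cabs (k.+1%:R^-1 : C) <= 1.
    by rewrite cabsV cabs_nat invf_le1// ler1n.
  have X := cabs_ge0 (a k); have Y : 0 <= r ^+ k by rewrite exprn_ge0.
  have Z := cabs_ge0 (k.+1%:R^-1 : C).
  rewrite [cabs _ * cabs _ * _]mulrACA [_ * r]mulrC -[X in _ <= X]mul1r.
  apply: ler_pM; rewrite ?mulr_ge0//.
  by rewrite -[X in _ <= X]mul1r ler_pM// ltW.
have ex z : exists s, cabs z < 1 -> csum (fun k => b k * z ^+ k) s.
  have [z1|z1] := ltP (cabs z) 1; last by exists 0.
  have z01 : 0 <= cabs z < 1 by rewrite cabs_ge0.
  have [k|s sP] := @csum_exists _ (fun k => b k * z ^+ k) _ (rad1_summable 0 rb z01).
    by rewrite add0n binn mul1r cabsM cabsX.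
  by exists s.
have [H HP] := choice ex.
exists H.
  apply: csum_unique (HP 0 _) _; first by rewrite cabs0.
  move=> e e0; exists 0%N => n _; rewrite big1 ?subrr ?cabs0 ?ltW// => -[[|k] _] _ /=.
    by rewrite mul0r.
  by rewrite exprS mul0r mulr0.
move=> z z1; have [l sl dl] := pser_cdiff rb HP z1.
suff -> : h z = l by [].
apply: csum_unique (sh _ z1) _; apply: eq_csum sl => k.
by rewrite /b mulrA divff ?mul1r// pnatr_eq0.
Qed.

Lemma holoM f g : holo f -> holo g -> holo (fun z => f z * g z).
Proof. by move=> hf hg z z1; eexists; apply: cdiffM; exact: holo_cdiff. Qed.

Lemma holo_comp f phi : holo f -> holo phi -> (forall z, cabs z < 1 -> cabs (phi z) < 1) ->
  holo (fun z => f (phi z)).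
Proof.
move=> hf hp sp z z1; eexists; apply: cdiff_comp; first exact: holo_cdiff.
by apply: holo_cdiff => //; exact: sp.
Qed.

Lemma radial_integral h (H : C -> C) z : holo h -> cabs z < 1 ->
  (forall w, cabs w < 1 -> cdiff H w (h w)) ->
  cintegral01 (fun t => h ((t%:C)%C * z) * z) = H z - H 0.
Proof.
move=> hh z1 dH; rewrite cintegral01E.
have tz t : 0 <= t <= 1 -> cabs ((t%:C)%C * z) < 1.
  move=> /andP[t0 t1]; rewrite cabsM cabs_real ger0_norm//.
  by apply: le_lt_trans z1; rewrite ler_piMl ?cabs_ge0.
have d t : 0 <= t <= 1 -> rderiv (fun t => H ((t%:C)%C * z)) t (h ((t%:C)%C * z) * z).
  move=> /tz t1; apply: rderiv_comp (rderiv_lin z t); exact: dH.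
rewrite (@cint_FTC _ 0 1 (fun t => H ((t%:C)%C * z)) (fun t => h ((t%:C)%C * z) * z)) ?ler01//.
  by rewrite -[(1%:C)%C]/(1 : C) -[(0%:C)%C]/(0 : C) mul1r mul0r.
move=> t tt; apply: rcontM; last exact: rcont_cst.
apply: (ccont_rcont (f := h)); first by apply: holo_ccont => //; exact: tz.
by apply: rcontM; [exact: rcont_id|exact: rcont_cst].
Qed.

Section Operator.
Variables g phi : C -> C.
Hypothesis hg : holo g.
Hypothesis hphi : holo phi.
Hypothesis sphi : forall z, cabs z < 1 -> cabs (phi z) < 1.

Lemma Sop_spec f : holo f ->
  [/\ HD R (Sop g phi f), Sop g phi f 0 = 0 &
      forall z, cabs z < 1 -> cderiv (Sop g phi f) z = cderiv f (phi z) * g z].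
Proof.
move=> hf.
have hh : holo (fun z => cderiv f (phi z) * g z).
  by apply: holoM => //; apply: (holo_comp (f := cderiv f)) => //; exact: holo_cderiv.
have [H H0 dH] := holo_primitive hh.
have SE z : cabs z < 1 -> H z = Sop g phi f z.
  move=> z1; rewrite /Sop mem_set//.
  by rewrite (@radial_integral (fun z => cderiv f (phi z) * g z) H)// H0 subr0.
have dS z : cabs z < 1 -> cdiff (Sop g phi f) z (cderiv f (phi z) * g z).
  by move=> z1; apply: (@cdiff_local H) => //; exact: dH.
split.
- split; first by apply/analytic_holo => z /dS ?; eexists; eassumption.
  by move=> z nz; rewrite /Sop memNset.
- by rewrite -SE ?cabs0.
- by move=> z /dS/cderivE.
Qed.

End Operator.

End PowerSeries.

(** * Weights at dyadic radii *)

Section Weights.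
Variable R : realType.
Local Notation C := R[i].

Definition dyadic (m : nat) : R := 2^-1 ^+ m.
Local Notation dy := dyadic.

Lemma dy_gt0 m : 0 < dy m.
Proof. by rewrite exprn_gt0// invr_gt0. Qed.

Lemma dy_ge0 m : 0 <= dy m.
Proof. exact: ltW (dy_gt0 m). Qed.

Lemma dyD m n : dy (m + n) = dy m * dy n.
Proof. exact: exprD. Qed.

Lemma dyS m : dy m = 2 * dy m.+1.
Proof. by rewrite /dyadic exprS mulrA divff ?mul1r// pnatr_eq0. Qed.

Lemma dy0 : dy 0 = 1.
Proof. exact: expr0. Qed.

Lemma dy_le1 m : dy m <= 1.
Proof. by rewrite exprn_ile1// ?invr_ge0// invf_le1// ler1n. Qed.

Lemma dy_le m n : (m <= n)%N -> dy n <= dy m.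
Proof.
by move=> /subnKC <-; rewrite dyD ler_piMr ?dy_le1// dy_ge0.
Qed.

Lemma dy_exp m : dy m = 2 ^- m.
Proof. by rewrite /dyadic exprVn. Qed.

Lemma dy_mul2 m : dy m * 2 ^+ m = 1.
Proof. by rewrite dy_exp mulVf// expf_neq0// pnatr_eq0. Qed.

Lemma dy_small (e : R) : 0 < e -> exists m, dy m <= e.
Proof.
move=> e0; have [|N HN] := @geo_bounded R 2^-1 _ e e0; last by exists N; exact: HN.
by rewrite invr_ge0 ler0n/= invf_lt1// ltr1n.
Qed.

Lemma dy_rad m : 0 <= 1 - dy m < 1.
Proof. by rewrite subr_ge0 dy_le1/= ltrBlDr ltrDl dy_gt0. Qed.

Variable nu : C -> R.
Hypothesis hnu : normal_weight nu.

Definition weight_at (r : R) : R := nu (r%:C)%C.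
Definition dyadic_weight (m : nat) : R := weight_at (1 - dy m).

Lemma disc_real (r : R) : 0 <= r < 1 -> disc R (r%:C)%C.
Proof. by move=> /andP[r0 r1]; rewrite /disc/= cabs_real ger0_norm. Qed.

Lemma weight_vr z : disc R z -> nu z = weight_at (cabs z).
Proof. by case: hnu => -[_ _ rad _] _ _; exact: rad. Qed.

Lemma vr_gt0 r : 0 <= r < 1 -> 0 < weight_at r.
Proof. by case: hnu => -[_ pos _ _] _ _ r01; apply: pos; exact: disc_real. Qed.

Lemma vm_gt0 m : 0 < dyadic_weight m.
Proof. exact: vr_gt0 (dy_rad m). Qed.

Lemma weight_gt0 z : disc R z -> 0 < nu z.
Proof. by case: hnu => -[_ pos _ _] _ _; exact: pos. Qed.

Lemma vr_le r s : 0 <= r -> r <= s -> s < 1 -> weight_at s <= weight_at r.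
Proof.
case: hnu => -[_ _ _ mono] _ _ r0 rs s1; have s0 := le_trans r0 rs.
apply: mono; [apply: disc_real|apply: disc_real|]; rewrite ?r0 ?s0 ?s1 ?(le_lt_trans rs)//.
by rewrite !cabs_real !ger0_norm.
Qed.

Lemma one_sub_sqr (d : R) : 1 - (1 - d) ^+ 2 = d * (2 - d).
Proof. ring. Qed.

(** Condition (I) read at dyadic radii. For r = 1 - d one has 1 - r^2 = d (2 - d), which lies
    between d and 2 d; this costs the factor 2^beta in [C1]. *)
Lemma weight_I (beta : R) : normal_I nu beta -> exists2 C1, 0 < C1 &
  forall m i, dyadic_weight m <= C1 * (2 `^ beta) ^+ i * dyadic_weight (m + i).
Proof.
move=> [b0 [C0 C00 H]]; exists (C0 * 2 `^ beta).
  by rewrite mulr_gt0// powR_gt0.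
move=> m i; have /andP[r0 r1] := dy_rad m; have /andP[s0 s1] := dy_rad (m + i).
have rs : 1 - dy m <= 1 - dy (m + i) by rewrite lerD2l lerN2 dy_le// leq_addr.
have := H _ _ r0 rs s1; rewrite /weight_quotient -!/(weight_at _) -!/(dyadic_weight _).
rewrite !one_sub_sqr => HH.
have d0 := dy_gt0 m; have d'0 := dy_gt0 (m + i); have d1 := dy_le1 m; have d'1 := dy_le1 (m + i).
set x := dy m * _ in HH; set y := dy (m + i) * _ in HH.
have x0 : 0 < x by rewrite /x mulr_gt0//; lra.
have y0 : 0 < y by rewrite /y mulr_gt0//; lra.
have x2 : x <= 2 * 2 ^+ i * y.
  have E : dy m = 2 ^+ i * dy (m + i) by rewrite dyD mulrCA [2 ^+ i * _]mulrC dy_mul2 mulr1.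
  rewrite /x /y {1}E; have : 0 <= 2 ^+ i * dy (m + i) by rewrite mulr_ge0 ?exprn_ge0 ?ltW.
  set t := 2 ^+ i * _ => t0.
  have -> : 2 * 2 ^+ i * (dy (m + i) * (2 - dy (m + i))) = t * (2 * (2 - dy (m + i))).
    by rewrite /t; ring.
  by apply: ler_wpM2l => //; lra.
have xp : 0 < x `^ beta by rewrite powR_gt0.
have yp : 0 < y `^ beta by rewrite powR_gt0.
have xy : x `^ beta <= 2 `^ beta * (2 `^ beta) ^+ i * y `^ beta.
  have p2 : 0 <= 2 ^+ i :> R by rewrite exprn_ge0.
  have p3 : 0 <= 2 * 2 ^+ i :> R by rewrite mulr_ge0.
  have p4 : 0 <= 2 * 2 ^+ i * y by rewrite mulr_ge0// ltW.
  apply: (le_trans (@ge0_ler_powR _ _ (ltW b0) _ _ _ _ x2)); rewrite ?nnegrE ?(ltW x0)//.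
  rewrite (powRM _ p3 (ltW y0)) (powRM _ _ p2)//.
  by rewrite -(powR_mulrn i (ler0n R 2)) -powRrM [i%:R * _]mulrC powRrM powR_mulrn// powR_ge0.
move: HH; rewrite ler_pdivrMr// => /le_trans; apply.
have V0 := vm_gt0 (m + i).
have -> : C0 * (dyadic_weight (m + i) / y `^ beta) * x `^ beta = (C0 * dyadic_weight (m + i)) * (x `^ beta / y `^ beta) by ring.
have -> : C0 * 2 `^ beta * (2 `^ beta) ^+ i * dyadic_weight (m + i) = (C0 * dyadic_weight (m + i)) * (2 `^ beta * (2 `^ beta) ^+ i) by ring.
by rewrite ler_pM2l ?mulr_gt0// ler_pdivrMr.
Qed.

(** Condition (II) at dyadic radii, with [G] equal to 2^-gamma. *)
Lemma weight_II : exists2 C2, 0 < C2 & exists2 G, 0 < G < 1 &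
  forall m i, dyadic_weight (m + i) <= C2 * G ^+ i * dyadic_weight m.
Proof.
case: hnu => _ _ [gam [g0 [C0 C00 H]]].
exists (C0 * 2 `^ gam); first by rewrite mulr_gt0// powR_gt0.
exists ((2^-1) `^ gam).
  rewrite powR_gt0/=; last by rewrite invr_gt0.
  have := @gt0_ltr_powR R gam g0 2^-1 1; rewrite powR1 !nnegrE invr_ge0 => /(_ (ler0n _ _) ler01); apply.
  by rewrite invf_lt1// ltr1n.
move=> m i; have /andP[r0 r1] := dy_rad m; have /andP[s0 s1] := dy_rad (m + i).
have rs : 1 - dy m <= 1 - dy (m + i) by rewrite lerD2l lerN2 dy_le// leq_addr.
have := H _ _ r0 rs s1; rewrite /weight_quotient -!/(weight_at _) -!/(dyadic_weight _).
rewrite !one_sub_sqr => HH.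
have d0 := dy_gt0 m; have d'0 := dy_gt0 (m + i); have d1 := dy_le1 m; have d'1 := dy_le1 (m + i).
set x := dy m * _ in HH; set y := dy (m + i) * _ in HH.
have x0 : 0 < x by rewrite /x mulr_gt0//; lra.
have y0 : 0 < y by rewrite /y mulr_gt0//; lra.
have x2 : y <= 2 * 2^-1 ^+ i * x.
  rewrite /x /y dyD -/(dy i).
  have -> : 2 * dy i * (dy m * (2 - dy m)) = (dy m * dy i) * (2 * (2 - dy m)) by ring.
  apply: ler_wpM2l; first by rewrite mulr_ge0 ?dy_ge0.
  by rewrite -dyD; lra.
have xp : 0 < x `^ gam by rewrite powR_gt0.
have yp : 0 < y `^ gam by rewrite powR_gt0.
have xy : y `^ gam <= 2 `^ gam * ((2^-1) `^ gam) ^+ i * x `^ gam.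
  have p2 : 0 <= 2^-1 ^+ i :> R by exact: dy_ge0.
  have p3 : 0 <= 2 * 2^-1 ^+ i :> R by rewrite mulr_ge0.
  have p4 : 0 <= 2 * 2^-1 ^+ i * x by rewrite mulr_ge0// ltW.
  apply: (le_trans (@ge0_ler_powR _ _ (ltW g0) _ _ _ _ x2)); rewrite ?nnegrE ?(ltW y0)//.
  rewrite (powRM _ p3 (ltW x0)) (powRM _ _ p2)//.
  by rewrite -(powR_mulrn i (_ : 0 <= 2^-1)) ?invr_ge0// -powRrM [i%:R * _]mulrC powRrM powR_mulrn// powR_ge0.
move: HH; rewrite ler_pdivrMr// => /le_trans; apply.
have V0 := vm_gt0 m.
have -> : C0 * (dyadic_weight m / x `^ gam) * y `^ gam = (C0 * dyadic_weight m) * (y `^ gam / x `^ gam) by ring.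
have -> : C0 * 2 `^ gam * (2^-1 `^ gam) ^+ i * dyadic_weight m = (C0 * dyadic_weight m) * (2 `^ gam * (2^-1 `^ gam) ^+ i) by ring.
by rewrite ler_pM2l ?mulr_gt0// ler_pdivrMr.
Qed.

(** Condition (II) forces the weight to 0 at the boundary; this puts every bounded analytic function
    into [Hzero]. *)
Lemma vr_small (e : R) : 0 < e -> exists2 r0 : R, 0 <= r0 < 1 &
  forall r, r0 <= r -> r < 1 -> weight_at r <= e.
Proof.
move=> e0; have [C2 C20 [G /andP[G0 G1] H]] := weight_II.
have V0 := vm_gt0 0.
have K0 : 0 < C2 * dyadic_weight 0 by rewrite mulr_gt0.
have G01 : 0 <= G < 1 by rewrite ltW.
have [N HN] := geo_bounded G01 (divr_gt0 e0 K0).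
exists (1 - dy N); first exact: dy_rad.
move=> r r0 r1; have /andP[d0 _] := dy_rad N.
apply: (le_trans (vr_le d0 r0 r1)); apply: (le_trans (H 0%N N)).
have := HN N (leqnn N); rewrite ler_pdivlMr// => h.
by apply: le_trans h; rewrite mulrAC mulrC.
Qed.

End Weights.

(** * The function spaces *)

Section Spaces.
Variable R : realType.
Local Notation C := R[i].
Implicit Types (f : C -> C) (nu mu : C -> R).

Lemma sup_norm_ub nu f z : disc R z -> ((nu z * cabs (f z))%:E <= sup_norm nu f)%E.
Proof. by move=> z1; apply: ereal_sup_ubound; exists z. Qed.

Lemma sup_norm_le nu f (M : R) : (forall z, disc R z -> nu z * cabs (f z) <= M) ->
  (sup_norm nu f <= M%:E)%E.
Proof. by move=> H; apply: ge_ereal_sup => _ [z z1 <-]; rewrite lee_fin; exact: H. Qed.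

Lemma disc0 : disc R 0.
Proof. by rewrite /disc/= cabs0. Qed.

Lemma sup_norm_ge0 nu f : (forall z, disc R z -> 0 < nu z) -> (0 <= sup_norm nu f)%E.
Proof.
move=> nu0; apply: le_trans (sup_norm_ub nu f disc0).
by rewrite lee_fin mulr_ge0 ?cabs_ge0// ltW// nu0//; exact: disc0.
Qed.

Lemma sup_norm_fin nu f : (forall z, disc R z -> 0 < nu z) -> (sup_norm nu f < +oo)%E ->
  exists2 M : R, 0 <= M & (sup_norm nu f = M%:E)%E /\
    forall z, disc R z -> nu z * cabs (f z) <= M.
Proof.
move=> nu0 fin; have s0 := sup_norm_ge0 f nu0; exists (fine (sup_norm nu f)).
  exact: fine_ge0.
have E : (sup_norm nu f = (fine (sup_norm nu f))%:E)%E by rewrite fineK// ge0_fin_numE.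
by split=> // z z1; rewrite -lee_fin -E; exact: sup_norm_ub.
Qed.

Definition ext0 f : C -> C := fun z => if z \in disc R then f z else 0.

Lemma ext0E f z : cabs z < 1 -> ext0 f z = f z.
Proof. by move=> z1; rewrite /ext0 mem_set. Qed.

Lemma holo_ext0 f : holo f -> holo (ext0 f).
Proof.
move=> hf z z1; have [l dl] := hf z z1; exists l.
by apply: cdiff_local dl => // w w1; rewrite ext0E.
Qed.

Lemma HD_ext0 f : holo f -> HD R (ext0 f).
Proof.
move=> hf; split; first by apply/analytic_holo; exact: holo_ext0.
by move=> z nz; rewrite /ext0 memNset.
Qed.

Lemma HD_holo f : HD R f -> holo f.
Proof. by case=> /analytic_holo. Qed.

Lemma cdiff_ext0 f z l : cabs z < 1 -> cdiff f z l -> cdiff (ext0 f) z l.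
Proof. by move=> z1; apply: cdiff_local => // w w1; rewrite ext0E. Qed.

Lemma HD_lin (a : C) f g : HD R f -> HD R g -> HD R (a *: f + g).
Proof.
move=> [af f0] [ag g0]; split.
  apply/analytic_holo => z z1.
  have /analytic_holo hf := af; have /analytic_holo hg := ag.
  have [l dl] := hf z z1; have [m dm] := hg z z1.
  by exists (a * l + m); exact: cdiffD (cdiffZ a dl) dm.
move=> z nz; rewrite /GRing.scale/= !fctE.
by have := f0 z nz; have := g0 z nz; rewrite /= => -> ->; rewrite scaler0 addr0.
Qed.

Lemma holo_bounded f (r : R) : holo f -> 0 <= r < 1 ->
  exists2 B : R, 0 <= B & forall z, cabs z <= r -> cabs (f z) <= B.
Proof.
move=> hf r01; have [a [ra sf _ _]] := holo_series hf.
have [_ [B HB]] := rad1_summable 0 ra r01.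
exists B; first by have := HB 0%N; rewrite big_ord0.
have /andP[r0 r1] := r01.
move=> z zr; apply: (csum_le (sf z (le_lt_trans zr r1))) => n.
apply: (le_trans (cabs_sum _ _ _)); apply: le_trans (HB n); apply: ler_sum => k _.
rewrite add0n binn mul1r cabsM cabsX ler_wpM2l ?cabs_ge0//.
by rewrite lerXn2r ?nnegrE ?cabs_ge0.
Qed.

Variables nu mu : C -> R.
Hypothesis hnu : normal_weight nu.

Lemma nu_le0 z : disc R z -> nu z <= nu 0.
Proof.
move=> z1; rewrite (weight_vr hnu z1) (weight_vr hnu disc0) cabs0.
by apply: vr_le => //; exact: cabs_ge0.
Qed.

Lemma Hinf_bounded f (M : R) : HD R f -> (forall z, disc R z -> nu z * cabs (f z) <= M) ->
  carrier (Hinf nu) f.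
Proof. by move=> hf H; split=> //; apply: le_lt_trans (sup_norm_le H) (ltry _). Qed.

Lemma Hzero_bounded f (M : R) : HD R f -> (forall z, disc R z -> cabs (f z) <= M) ->
  carrier (Hzero nu) f.
Proof.
move=> hf H; split=> // e e0.
have M0 : 0 <= M by apply: le_trans (H 0 disc0); exact: cabs_ge0.
have e'0 : 0 < e / (2 * (M + 1)) by rewrite divr_gt0// mulr_gt0//; lra.
have [r0 /andP[r00 r01] Hr] := vr_small hnu e'0.
near=> r => z zr.
have r1 : r < 1 by near: r; exact: nbhs_left_lt.
have rr : r0 <= r by near: r; exact: nbhs_left_ge.
have z1 : disc R z by rewrite /disc/= zr.
rewrite (weight_vr hnu z1) zr.
have h1 := Hr r rr r1; have h2 := H z z1.
apply: (@le_lt_trans _ _ (e / (2 * (M + 1)) * M)).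
  by apply: ler_pM; rewrite ?cabs_ge0//; apply/ltW/vr_gt0 => //; rewrite r1 (le_trans r00).
by rewrite mulrAC ltr_pdivrMr ?mulr_gt0//; nra.
Unshelve. all: by end_near. Qed.

(** Near the circle the limit condition with bound 1 suffices; on the remaining closed disc [f] is
    bounded by its absolutely convergent series. *)
Lemma Hzero_Hinf f : carrier (Hzero nu) f -> carrier (Hinf nu) f.
Proof.
move=> [hf /(_ 1 ltr01) [d /= d0 Hd]].
pose r := Num.max 0 (1 - d / 2).
have r0 : 0 <= r by rewrite le_max lexx.
have rd : 1 - d / 2 <= r by rewrite le_max lexx orbT.
have r1 : r < 1 by rewrite gt_max ltr01/= ltrBlDr ltrDl divr_gt0.
have r01 : 0 <= r < 1 by rewrite r0.
have [B B0 HB] := holo_bounded (HD_holo hf) r01.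
have n0 : 0 < nu 0 by apply: (weight_gt0 hnu); exact: disc0.
apply: (@Hinf_bounded _ (nu 0 * B + 1)) => // z z1.
have nz := weight_gt0 hnu z1.
have [zr|rz] := leP (cabs z) r.
  apply: (@le_trans _ _ (nu 0 * B)); last by rewrite lerDl.
  by apply: ler_pM; rewrite ?cabs_ge0 ?(ltW nz) ?nu_le0 ?HB.
have := Hd (cabs z); rewrite /ball_/= => H; apply: ltW; apply: (@lt_le_trans _ _ 1).
  apply: H => //; rewrite ger0_norm; first by lra.
  by rewrite subr_ge0 ltW.
by rewrite lerDr mulr_ge0// ltW.
Qed.

Lemma dual_Hzero x' : dual (Hinf nu) x' -> dual (Hzero nu) x' /\
  (dual_norm (Hzero nu) x' <= dual_norm (Hinf nu) x')%E.
Proof.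
move=> [lin fin].
have le : (dual_norm (Hzero nu) x' <= dual_norm (Hinf nu) x')%E.
  apply: le_ereal_sup => _ [f [cf nf] <-]; exists f => //; split=> //; exact: Hzero_Hinf.
split=> //; split; last exact: le_lt_trans fin.
by move=> a f g cf cg; apply: lin; exact: Hzero_Hinf.
Qed.

Hypothesis hmu : normal_weight mu.

Lemma Bloch_norm_ge0 f : (0 <= snorm (Bloch mu) f)%E.
Proof.
rewrite /= adde_ge0// ?lee_fin ?cabs_ge0//.
by apply: sup_norm_ge0; exact: weight_gt0.
Qed.

Lemma dual_norm_ge0 (X : normed_subspace (C -> C)) x' f : carrier X f ->
  (snorm X f <= 1)%E -> (0 <= dual_norm X x')%E.
Proof.
move=> cf nf; apply: (@le_trans _ _ (cabs (x' f))%:E); first by rewrite lee_fin cabs_ge0.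
by apply: ereal_sup_ubound; exists f.
Qed.

Lemma HD0 : HD R 0.
Proof.
split=> //; apply/analytic_holo => z _; exists 0; exact: cdiff_cst.
Qed.

Lemma Hzero0 : carrier (Hzero nu) 0.
Proof. by apply: (@Hzero_bounded _ 0); [exact: HD0|move=> z _; rewrite /= cabs0]. Qed.

Lemma sup_norm0 : (sup_norm nu 0%R <= 1)%E.
Proof. by apply: sup_norm_le => z _; rewrite /= cabs0 mulr0. Qed.

(** The same representation serves on the smaller space, whose unit ball is smaller, so the dual
    norms do not increase. *)
Lemma nuclear_restrict T : nuclear (Hinf nu) (Bloch mu) T -> nuclear (Hzero nu) (Bloch mu) T.
Proof.
move=> [m lin [x' [y [dx cy fin cv]]]]; split.
- by move=> f /Hzero_Hinf; exact: m.
- by move=> a f g /Hzero_Hinf cf /Hzero_Hinf cg; apply: lin.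
exists x', y; split=> //.
- by move=> k; case: (dual_Hzero (dx k)).
- apply: le_lt_trans fin; apply: lee_nneseries => [k _ _|k _].
    apply: mule_ge0; last exact: Bloch_norm_ge0.
    exact: (dual_norm_ge0 _ Hzero0 sup_norm0).
  by apply: lee_wpmul2r; [exact: Bloch_norm_ge0|case: (dual_Hzero (dx k))].
- by move=> f /Hzero_Hinf; exact: cv.
Qed.

End Spaces.

(** * A discrete Forelli-Rudin estimate *)

Section Lattice.
Variable R : realType.
Local Notation C := R[i].
Local Notation dy := (dyadic R).

Definition dyadic_root (m : nat) : C := ce (2 * pi * dy m).

Lemma om0 : dyadic_root 0 = 1.
Proof. by rewrite /dyadic_root dy0 mulr1 ce2pi. Qed.

Lemma om_sq m : dyadic_root m.+1 ^+ 2 = dyadic_root m.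
Proof. by rewrite /dyadic_root -ceMn (dyS R m) -[in LHS]mulr_natl; congr ce; ring. Qed.

Lemma cabs_om m : cabs (dyadic_root m) = 1.
Proof. exact: cabs_ce. Qed.

Lemma om_pow m : dyadic_root m ^+ (2 ^ m) = 1.
Proof. by elim: m => [|m IH]; rewrite ?expn0 ?om0 ?expr1// expnS exprM om_sq. Qed.

Lemma om_half m : dyadic_root m.+1 ^+ (2 ^ m) = -1.
Proof.
elim: m => [|m IH]; last by rewrite expnS exprM om_sq.
rewrite expn0 expr1 /dyadic_root /dy expr1 mulrAC divff ?mul1r ?pnatr_eq0//.
by rewrite /ce cospi sinpi; apply/eqP; rewrite eq_complex/= oppr0 !eqxx.
Qed.

Lemma om_neq1 m a : (0 < a < 2 ^ m)%N -> dyadic_root m ^+ a != 1.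
Proof.
elim: m a => [|m IH] a; first by rewrite expn0 ltnS => /andP[a0 /(leq_trans a0)].
move=> /andP[a0 am]; have := odd_double_half a; case: (odd a) => /= aE.
  apply/eqP => /(congr1 (fun x => x ^+ (2 ^ m))); rewrite expr1n -exprM mulnC exprM om_half.
  rewrite -aE add1n exprS -muln2 mulnC exprM sqrrN expr1n expr1n mulr1 => /eqP.
  by rewrite -subr_eq0 -opprD oppr_eq0 (_ : 1 + 1 = 2%:R) ?pnatr_eq0.
rewrite -aE add0n -muln2 mulnC exprM om_sq; apply: IH.
by rewrite -aE add0n -muln2 expnS mulnC ltn_mul2l/= in am; rewrite am andbT lt0n;
  apply: contraTneq a0 => h; rewrite -aE h.
Qed.

(** Induction by squaring: |1 - x^2| = |1 - x| |1 + x| is at most 2 |1 - x|, so the distance at most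
    halves from one level to the next. *)
Lemma root_separation m (x : C) : x ^+ (2 ^ m) = 1 -> x != 1 -> 4 * dy m <= cabs (1 - x).
Proof.
elim: m x => [|m IH] x; first by rewrite expn0 expr1 => ->; rewrite eqxx.
move=> xm x1.
have xn : cabs x = 1.
  have : cabs x ^+ (2 ^ m.+1) = 1 by rewrite -cabsX xm cabs1.
  by move=> /eqP; rewrite pexpr_eq1 ?expn_gt0// ?cabs_ge0// => /eqP.
have [x2|x2] := eqVneq (x ^+ 2) 1.
  have -> : x = -1.
    move/eqP: x2; rewrite -subr_eq0 subr_sqr_1 mulf_eq0 subr_eq0 (negbTE x1)/= addr_eq0.
    by move/eqP.
  rewrite opprK (_ : 1 + 1 = 2%:R)// cabs_nat.
  by have := dyS R m; have := dy_le1 R m; lra.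
have := IH (x ^+ 2); rewrite -exprM -expnS => /(_ xm x2).
have -> : 1 - x ^+ 2 = (1 - x) * (1 + x) by ring.
rewrite cabsM (dyS R m) => h.
have : cabs (1 + x) <= 2 by rewrite (le_trans (cabsD _ _))// cabs1 xn; lra.
have := cabs_ge0 (1 - x); have := cabs_ge0 (1 + x); nra.
Qed.

Lemma om_sum0 m a : (0 < a < 2 ^ m)%N -> \sum_(j < 2 ^ m) (dyadic_root m ^+ j) ^+ a = 0.
Proof.
move=> am; have x1 := om_neq1 am.
under eq_bigr do rewrite -exprM mulnC exprM.
apply: (@mulfI _ (dyadic_root m ^+ a - 1)); first by rewrite subr_eq0.
by rewrite -subrX1 mulr0 -exprM mulnC exprM om_pow expr1n subrr.
Qed.

Lemma cabs_one_sub (x : C) : 1 - cabs x <= cabs (1 - x).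
Proof. by rewrite lerBlDr (le_trans _ (cabsD _ _))// subrK cabs1. Qed.

(** Each summand is a finite geometric sum divided by 1 - x^(2^m); summation over the roots of unity
    kills every power but the zeroth. *)
Lemma sum_resolvent m (x : C) : cabs x < 1 ->
  \sum_(j < 2 ^ m) (1 - x * dyadic_root m ^+ j)^-1 = (2 ^ m)%:R / (1 - x ^+ (2 ^ m)).
Proof.
move=> x1; set L := (2 ^ m)%N; have L0 : (0 < L)%N by rewrite expn_gt0.
have xL : 1 - x ^+ L != 0.
  rewrite -cabs_gt0 (lt_le_trans _ (cabs_one_sub _))// subr_gt0 cabsX exprn_ilt1 ?cabs_ge0//.
  by rewrite -lt0n.
have E j : (1 - x * dyadic_root m ^+ j)^-1 = (1 - x ^+ L)^-1 * \sum_(a < L) (x * dyadic_root m ^+ j) ^+ a.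
  have nz : 1 - x * dyadic_root m ^+ j != 0.
    rewrite -cabs_gt0 (lt_le_trans _ (cabs_one_sub _))// subr_gt0 cabsM !cabsX cabs_om expr1n.
    by rewrite mulr1.
  apply: (mulfI nz); rewrite divff// mulrCA.
  have -> : (1 - x * dyadic_root m ^+ j) * \sum_(a < L) (x * dyadic_root m ^+ j) ^+ a = 1 - x ^+ L.
    rewrite -[1 - x * _]opprB mulNr -subrX1 opprB exprMn -exprM mulnC exprM om_pow expr1n.
    by rewrite mulr1.
  by rewrite mulVf.
under eq_bigr do rewrite E.
rewrite -mulr_sumr exchange_big/= mulrC; congr (_ * _).
rewrite (bigD1 (Ordinal L0))//= [X in _ + X]big1 ?addr0.
  by under eq_bigr do rewrite expr0; rewrite sumr_const card_ord.
move=> a a0; under eq_bigr do rewrite exprMn.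
rewrite -mulr_sumr om_sum0 ?mulr0//.
by rewrite ltn_ord andbT lt0n -val_eqE in a0 *.
Qed.

Lemma poisson_re (y : C) : cabs y < 1 ->
  (1 - cabs y ^+ 2) / cabs (1 - y) ^+ 2 = 2 * complex.Re (1 - y)^-1 - 1.
Proof.
move=> y1; have nz : 1 - y != 0.
  by rewrite -cabs_gt0 (lt_le_trans _ (cabs_one_sub _))// subr_gt0.
have n0 : cabs (1 - y) ^+ 2 != 0 by rewrite expf_neq0// cabs_eq0.
have E : (1 - y)^-1 = ((cabs (1 - y) ^- 2)%:C)%C * ((1 - y)^*)%C.
  apply: (mulfI nz); rewrite divff// mulrCA mul_conj -real_cpxM.
  by rewrite -[LHS]/((1%:C)%C : C) -(mulVf n0).
rewrite E ReM ReC ImC mul0r subr0.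
apply: (mulIf n0); rewrite divfK// mulrBl mul1r.
have F (D X : R) : D != 0 -> 2 * (D^-1 * X) * D = 2 * X by move=> D0; field.
rewrite F//.
by rewrite !cabs_sqr !ReB !ImB; case: y {y1 nz n0 E} => a b /=; ring.
Qed.

(** Discrete counterpart of the mean of the Poisson kernel. The kernel is the real part of a
    resolvent, and resolvents sum explicitly over the roots of unity. *)
Lemma poisson_sum m (x : C) : cabs x < 1 ->
  \sum_(j < 2 ^ m) cabs (1 - x * dyadic_root m ^+ j) ^- 2 <=
  2 * 2 ^+ m / ((1 - cabs x) * (1 - cabs x ^+ (2 ^ m))).
Proof.
move=> x1; have c0 := cabs_ge0 x.
have xj j : cabs (x * dyadic_root m ^+ j) = cabs x by rewrite cabsM cabsX cabs_om expr1n mulr1.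
have xL : cabs x ^+ (2 ^ m) < 1 by rewrite exprn_ilt1 ?cabs_ge0// -lt0n expn_gt0.
have d0 : 0 < 1 - cabs x ^+ 2.
  by rewrite subr_gt0 exprn_ilt1.
have : (1 - cabs x ^+ 2) * \sum_(j < 2 ^ m) cabs (1 - x * dyadic_root m ^+ j) ^- 2 <=
   2 * 2 ^+ m / (1 - cabs x ^+ (2 ^ m)).
  rewrite mulr_sumr.
  have -> : \sum_(j < 2 ^ m) (1 - cabs x ^+ 2) * cabs (1 - x * dyadic_root m ^+ j) ^- 2 =
     \sum_(j < 2 ^ m) (2 * complex.Re (1 - x * dyadic_root m ^+ j)^-1 - 1).
    by apply: eq_bigr => j _; rewrite -poisson_re ?xj.
  rewrite big_split/= -mulr_sumr.
  have -> : \sum_(j < 2 ^ m) complex.Re (1 - x * dyadic_root m ^+ j)^-1 =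
      complex.Re (\sum_(j < 2 ^ m) (1 - x * dyadic_root m ^+ j)^-1).
    elim: (2 ^ m)%N => [|k IH]; first by rewrite !big_ord0.
    by rewrite !big_ord_recr/= IH ReD.
  rewrite sum_resolvent//.
  apply: (@le_trans _ _ (2 * complex.Re ((2 ^ m)%:R / (1 - x ^+ (2 ^ m))))).
    by rewrite gerDl sumr_le0// => i _; rewrite oppr_le0.
  rewrite -mulrA ler_pM2l//; apply: (le_trans (ler_norm _)); apply: (le_trans (cabs_Re _)).
  rewrite cabsM cabs_nat cabsV natrX ler_pM2l ?exprn_gt0//.
  have lb : 1 - cabs x ^+ (2 ^ m) <= cabs (1 - x ^+ (2 ^ m)).
    by rewrite -cabsX cabs_one_sub.
  have p1 : 0 < 1 - cabs x ^+ (2 ^ m) by rewrite subr_gt0.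
  by rewrite lef_pV2 ?posrE// (lt_le_trans p1).
move=> h.
have d1 : 0 < 1 - cabs x by rewrite subr_gt0.
rewrite [(1 - cabs x) * _]mulrC invfM mulrA ler_pdivlMr// mulrC.
apply: le_trans h; apply: ler_wpM2r.
  by apply: sumr_ge0 => j _; rewrite invr_ge0 exprn_ge0 ?cabs_ge0.
by rewrite lerD2l lerN2 expr2 ler_piMr// ltW.
Qed.

Definition lattice_point (m j : nat) : C := ((1 - dy m)%:C)%C * dyadic_root m ^+ j.

Lemma cabs_lp m j : cabs (lattice_point m j) = 1 - dy m.
Proof.
rewrite cabsM cabsX cabs_om expr1n mulr1 cabs_real ger0_norm//.
by case/andP: (dy_rad R m).
Qed.

Lemma ker_conj (p w : C) : cabs (1 - (p^*)%C * w) = cabs (1 - (w^*)%C * p).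
Proof.
rewrite -[in LHS]cabs_conj conjB conjc1 conjM conjcK mulrC//.
Qed.

(** Bernoulli's inequality gives (1 + d)^(1/d) >= 2 for d = 2^-m, and (1 - d)(1 + d) <= 1. It keeps
    the denominator 1 - |x|^(2^m) of the Poisson sum at least 1/2 for |x| <= 1 - d. *)
Lemma half_pow m : (1 - dy m) ^+ (2 ^ m) <= 2^-1.
Proof.
have d0 := dy_gt0 R m; have /andP[r0 r1] := dy_rad R m.
have b : 2 <= (1 + dy m) ^+ (2 ^ m).
  have bern k : 1 + k%:R * dy m <= (1 + dy m) ^+ k.
    elim: k => [|k IH]; first by rewrite mul0r addr0 expr0.
    rewrite exprS -natr1; have : 0 <= k%:R :> R by [].
    by nra.
  by apply: le_trans (bern _); rewrite natrX mulrC dy_mul2; lra.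
have : (1 - dy m) ^+ (2 ^ m) * (1 + dy m) ^+ (2 ^ m) <= 1.
  rewrite -exprMn; apply: exprn_ile1; last by nra.
  by rewrite mulr_ge0//; lra.
have : 0 <= (1 - dy m) ^+ (2 ^ m) by rewrite exprn_ge0.
nra.
Qed.

(** All but two of the kernel factors are bounded by 1 - t; the remaining square is summed by
    [poisson_sum]. *)
Lemma lattice_kernel_sum m n (w : C) (t : R) : cabs w < 1 -> t = (1 - dy m) * cabs w ->
  \sum_(j < 2 ^ m) cabs (1 - ((lattice_point m j)^*)%C * w) ^- n.+2 <= 4 * 2 ^+ m / (1 - t) ^+ n.+1.
Proof.
move=> w1 tE; have /andP[r0 r1] := dy_rad R m; have w0 := cabs_ge0 w.
pose x : C := ((1 - dy m)%:C)%C * (w^*)%C.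
have xt : cabs x = t by rewrite tE cabsM cabs_conj cabs_real ger0_norm.
have t0 : 0 <= t by rewrite -xt cabs_ge0.
have t1 : t < 1 by rewrite tE; nra.
have E (j : nat) : cabs (1 - ((lattice_point m j)^*)%C * w) = cabs (1 - x * dyadic_root m ^+ j).
  by rewrite ker_conj /lattice_point /x; congr (cabs (1 - _)); ring.
have lb (j : nat) : 1 - t <= cabs (1 - x * dyadic_root m ^+ j).
  apply: le_trans (cabs_one_sub _); rewrite lerD2l lerN2.
  by rewrite cabsM cabsX cabs_om expr1n mulr1 xt.
have tp : 0 < 1 - t by lra.
have th : t ^+ (2 ^ m) <= 2^-1.
  apply: le_trans (half_pow m); rewrite lerXn2r ?nnegrE// tE; nra.
apply: (@le_trans _ _ (\sum_(j < 2 ^ m) cabs (1 - x * dyadic_root m ^+ j) ^- 2 * (1 - t) ^- n)).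
  apply: ler_sum => j _; rewrite E.
  have p0 : 0 < cabs (1 - x * dyadic_root m ^+ j) by apply: lt_le_trans (lb j).
  have -> : cabs (1 - x * dyadic_root m ^+ j) ^- n.+2 = cabs (1 - x * dyadic_root m ^+ j) ^- 2 * cabs (1 - x * dyadic_root m ^+ j) ^- n.
    by rewrite -invfM -exprD.
  rewrite ler_wpM2l ?invr_ge0 ?exprn_ge0 ?cabs_ge0//.
  by rewrite lef_pV2 ?posrE ?exprn_gt0// lerXn2r ?nnegrE ?(ltW tp) ?(ltW p0).
rewrite -mulr_suml.
have x1 : cabs x < 1 by rewrite xt.
have P := poisson_sum m x1; rewrite xt in P.
rewrite exprS invfM mulrA; apply: ler_wpM2r; first by rewrite invr_ge0 exprn_ge0// ltW.
apply: (le_trans P); rewrite invfM mulrA mulrAC.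
apply: ler_wpM2r; first by rewrite invr_ge0 ltW.
rewrite ler_pdivrMr; last by lra.
have : 0 < (2:R) ^+ m by rewrite exprn_gt0.
by nra.
Qed.

Section ForelliRudin.
Variables (V : nat -> R) (C1 C2 B G : R) (n : nat).
Hypothesis V0 : forall m, 0 < V m.
Hypothesis C10 : 0 < C1.
Hypothesis C20 : 0 < C2.
Hypothesis B0 : 0 < B.
Hypothesis G01 : 0 < G < 1.
Hypothesis Bn : B * dy n.+1 < 1.
Hypothesis HB : forall m i, V m <= C1 * B ^+ i * V (m + i)%N.
Hypothesis HG : forall m i, V (m + i)%N <= C2 * G ^+ i * V m.

Lemma geo_le (q : R) k : 0 <= q < 1 -> \sum_(i < k) q ^+ i <= (1 - q)^-1.
Proof.
move=> q01; have := bin_geo_sum 0 k q01; rewrite expr1; apply: le_trans.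
by apply: ler_sum => i _; rewrite add0n binn mul1r.
Qed.

(* The two terms come from the levels above and below that of the point [w]; the
   geometric ratios [G] and [B * dy n.+1] are where the two halves of normality
   enter. *)
Definition fr_const := 4 * C2 / (1 - G) + 4 * 2 ^+ n.+1 * C1 / (1 - B * dy n.+1).

(** A lower bound [s] for 1 - (1 - dy m)|w| bounds the share of level m by a multiple of (V M0 / V
    m)(dy m / s)^(n+1). Coarse levels, m <= M0, use s = dy m; finer ones use s = dy M0.+1. The given
    bound on 1 - |w| enters only at the finer levels. *)
Lemma discrete_forelli_rudin (w : C) (M0 M : nat) :
  dy M0.+1 < 1 - cabs w -> cabs w < 1 ->
  V M0 * \sum_(m < M) (dy m ^+ n.+2 / V m *
     \sum_(j < 2 ^ m) cabs (1 - ((lattice_point m j)^*)%C * w) ^- n.+2) <= fr_const.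
Proof.
move=> wM w1; have w0 := cabs_ge0 w.
pose f m := V M0 * (dy m ^+ n.+2 / V m *
     \sum_(j < 2 ^ m) cabs (1 - ((lattice_point m j)^*)%C * w) ^- n.+2).
have f0 m : 0 <= f m.
  rewrite /f; apply: mulr_ge0; first exact: ltW.
  apply: mulr_ge0; first by rewrite divr_ge0 ?exprn_ge0 ?dy_ge0 ?(ltW (V0 _)).
  by apply: sumr_ge0 => j _; rewrite invr_ge0 exprn_ge0// cabs_ge0.
have fle m (s : R) : 0 < s -> s <= 1 - (1 - dy m) * cabs w ->
    f m <= 4 * (V M0 / V m) * (dy m / s) ^+ n.+1.
  move=> s0 st.
  have K := @lattice_kernel_sum m n w _ w1 erefl.
  have K2 : 4 * 2 ^+ m / (1 - (1 - dy m) * cabs w) ^+ n.+1 <= 4 * 2 ^+ m / s ^+ n.+1.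
    apply: ler_wpM2l; first by rewrite mulr_ge0// exprn_ge0.
    rewrite lef_pV2 ?posrE ?exprn_gt0 ?(lt_le_trans s0)// lerXn2r// ?nnegrE ?(ltW s0)//.
    by apply: le_trans st; exact: ltW.
  have {}K := le_trans K K2.
  apply: (@le_trans _ _ (V M0 * (dy m ^+ n.+2 / V m * (4 * 2 ^+ m / s ^+ n.+1)))).
    apply: ler_wpM2l; first exact: ltW.
    by apply: ler_wpM2l => //; rewrite divr_ge0 ?exprn_ge0 ?dy_ge0 ?(ltW (V0 _)).
  have -> : V M0 * (dy m ^+ n.+2 / V m * (4 * 2 ^+ m / s ^+ n.+1)) =
     4 * (V M0 / V m) * (dy m ^+ n.+1 / s ^+ n.+1) * (dy m * 2 ^+ m).
    by rewrite [dy m ^+ n.+2]exprS; ring.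
  by rewrite dy_mul2 mulr1 expr_div_n.
have G0 : 0 <= G by case/andP: G01 => /ltW.
have G1 : 0 <= G < 1 by rewrite G0; case/andP: G01.
have q01 : 0 <= B * dy n.+1 < 1 by rewrite Bn andbT mulr_ge0 ?dy_ge0// ltW.
have small m : (m <= M0)%N -> f m <= 4 * C2 * G ^+ (M0 - m).
  move=> mM; have h := fle m (dy m) (dy_gt0 _ _).
  apply: (le_trans (h _)).
    by have := dy_gt0 R m; have := dy_le1 R m; nra.
  rewrite divff ?gt_eqF ?dy_gt0// expr1n mulr1 -mulrA ler_pM2l//.
  by rewrite ler_pdivrMr//; have := HG m (M0 - m); rewrite subnKC.
have large i : f (M0.+1 + i)%N <= 4 * 2 ^+ n.+1 * C1 * (B * dy n.+1) ^+ i.+1.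
  have h := fle (M0.+1 + i)%N (dy M0.+1) (dy_gt0 _ _).
  apply: (le_trans (h _)).
    have := dy_gt0 R (M0.+1 + i); have := dy_le1 R (M0.+1 + i); nra.
  have -> : dy (M0.+1 + i) / dy M0.+1 = dy i by rewrite dyD mulrC mulKf// gt_eqF// dy_gt0.
  have E : (dy i) ^+ n.+1 = 2 ^+ n.+1 * dy n.+1 ^+ i.+1.
    rewrite -[dy n.+1 ^+ _]/((2^-1 ^+ n.+1) ^+ i.+1) -exprM mulnC exprM -/(dy i.+1).
    by rewrite -exprMn -dyS.
  rewrite E exprMn.
  have -> : 4 * (V M0 / V (M0.+1 + i)) * (2 ^+ n.+1 * dy n.+1 ^+ i.+1) =
     (4 * 2 ^+ n.+1 * dy n.+1 ^+ i.+1) * (V M0 / V (M0.+1 + i)%N) by ring.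
  have -> : 4 * 2 ^+ n.+1 * C1 * (B ^+ i.+1 * dy n.+1 ^+ i.+1) =
     (4 * 2 ^+ n.+1 * dy n.+1 ^+ i.+1) * (C1 * B ^+ i.+1) by ring.
  apply: ler_wpM2l; first by rewrite !mulr_ge0 ?exprn_ge0 ?dy_ge0.
  by rewrite ler_pdivrMr// addSnnS; exact: HB.
rewrite mulr_sumr -/(f _).
(* The range is enlarged so that it splits at [M0] whatever [M] is. *)
apply: (@le_trans _ _ (\sum_(m < M0.+1 + M) f m)).
  rewrite addnC big_split_ord/= lerDl; apply: sumr_ge0 => i _; exact: f0.
rewrite big_split_ord/= /fr_const; apply: lerD.
  apply: (@le_trans _ _ (\sum_(i < M0.+1) 4 * C2 * G ^+ (M0 - i))).
    by apply: ler_sum => i _; apply: small; rewrite -ltnS.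
  rewrite -mulr_sumr -mulrA -[X in _ <= X]mulrA; apply: ler_wpM2l => //; apply: ler_wpM2l; first exact: ltW.
  rewrite (reindex_inj rev_ord_inj)/=.
  under eq_bigr => i _ do rewrite subSS subKn -1?ltnS//.
  exact: geo_le.
apply: (@le_trans _ _ (\sum_(i < M) 4 * 2 ^+ n.+1 * C1 * (B * dy n.+1) ^+ i)).
  apply: ler_sum => i _; apply: (le_trans (large i)); apply: ler_wpM2l.
    by rewrite !mulr_ge0 ?exprn_ge0// ltW.
  rewrite exprS ler_piMl ?(ltW Bn)// exprn_ge0//; by case/andP: q01.
rewrite -mulr_sumr; apply: ler_wpM2l; last exact: geo_le.
by rewrite !mulr_ge0 ?exprn_ge0// ltW.
Qed.

End ForelliRudin.

End Lattice.

(** * A lower bound for nuclear representations *)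

Section Duality.
Variable R : realType.
Local Notation C := R[i].
Local Notation dy := (dyadic R).
Variable nu : C -> R.
Hypothesis hnu : normal_weight nu.
Implicit Types (f : C -> C).

(** The class of test functions: it is stable under linear combinations and contained in [Hzero] for
    every normal weight. *)
Definition bHD f : Prop := HD R f /\ exists M : R, forall z, disc R z -> cabs (f z) <= M.

Lemma bHD_Hzero f : bHD f -> carrier (Hzero nu) f.
Proof. by case=> hf [M HM]; exact: Hzero_bounded HM. Qed.

Lemma bHD0 : bHD 0.
Proof. by split; [exact: HD0|exists 0 => z _; rewrite /= cabs0]. Qed.

Lemma bHD_lin a f g : bHD f -> bHD g -> bHD (a *: f + g).
Proof.
move=> [hf [M HM]] [hg [M' HM']]; split; first exact: HD_lin.
exists (cabs a * M + M') => z z1; rewrite /GRing.scale/= !fctE.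
rewrite (le_trans (cabsD _ _))// lerD ?HM'// cabsM ler_wpM2l ?cabs_ge0//.
exact: HM.
Qed.

Lemma dual_zero (X : normed_subspace (C -> C)) x' : dual X x' -> carrier X 0 -> x' 0 = 0.
Proof.
move=> [lin _] c0; have := lin 1 0 0 c0 c0; rewrite !scale1r addr0 => /eqP.
by rewrite -subr_eq subrr => /eqP.
Qed.

Lemma dual_apply x' f (M : R) : dual (Hzero nu) x' -> bHD f -> 0 < M ->
  (forall z, disc R z -> nu z * cabs (f z) <= M) ->
  cabs (x' f) <= fine (dual_norm (Hzero nu) x') * M.
Proof.
move=> dx bf M0 HM; have [lin fin] := dx.
have c0 := @Hzero0 R nu hnu.
have n0 := dual_norm_ge0 x' c0 (sup_norm0 nu).
have E : (dual_norm (Hzero nu) x' = (fine (dual_norm (Hzero nu) x'))%:E)%E.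
  by rewrite fineK// ge0_fin_numE.
have Mc : ((M^-1)%:C)%C != 0 :> C by rewrite real_cpx_neq0// invr_gt0.
(* The summand 0 matches the shape in which linearity of a functional is stated. *)
pose f1 := ((M^-1)%:C)%C *: f + 0.
have b1 : bHD f1 by apply: bHD_lin => //; exact: bHD0.
have : (cabs (x' f1))%:E%E \in [set (cabs (x' f))%:E | f in [set f | carrier (Hzero nu) f /\ (snorm (Hzero nu) f <= 1)%E]].
  apply/mem_set; exists f1 => //; split; first exact: bHD_Hzero.
  apply: sup_norm_le => z z1; rewrite /f1 /GRing.scale/= !fctE addr0 cabsM cabs_real.
  rewrite ger0_norm ?invr_ge0 ?(ltW M0)// mulrCA mulrC ler_pdivrMr// mul1r.
  exact: HM.
move=> /set_mem/ereal_sup_ubound; rewrite -/(dual_norm _ _) E lee_fin.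
rewrite /f1 (lin _ _ _ (bHD_Hzero bf) c0) (dual_zero dx c0) addr0.
rewrite [X in cabs X](_ : _ = ((M^-1)%:C)%C * x' f)// cabsM cabs_real.
by rewrite ger0_norm ?invr_ge0 ?(ltW M0)// mulrC ler_pdivrMr.
Qed.

Lemma bHD_sum (I : Type) (r : seq I) (c : I -> C) (K : I -> C -> C) :
  (forall i, bHD (K i)) -> bHD (\sum_(i <- r) c i *: K i).
Proof.
move=> bK; elim: r => [|i r IH]; first by rewrite big_nil; exact: bHD0.
by rewrite big_cons; exact: bHD_lin.
Qed.

Lemma dual_sum x' (I : Type) (r : seq I) (c : I -> C) (K : I -> C -> C) :
  dual (Hzero nu) x' -> (forall i, bHD (K i)) ->
  x' (\sum_(i <- r) c i *: K i) = \sum_(i <- r) c i * x' (K i).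
Proof.
move=> dx bK; elim: r => [|i r IH].
  by rewrite !big_nil; exact: dual_zero dx (@Hzero0 R nu hnu).
rewrite !big_cons; have [lin _] := dx; rewrite lin ?IH//; apply: bHD_Hzero => //.
exact: bHD_sum.
Qed.

Lemma sum_apply (I : Type) (r : seq I) (c : I -> C) (K : I -> C -> C) z :
  (\sum_(i <- r) c i *: K i) z = \sum_(i <- r) c i * K i z.
Proof. by elim: r => [|i r IH]; rewrite ?big_nil// !big_cons -IH. Qed.

Lemma unimodular (z : C) : exists u : C, cabs u <= 1 /\ u * z = ((cabs z)%:C)%C.
Proof.
have [->|z0] := eqVneq z 0; first by exists 0; rewrite cabs0 mulr0.
have c0 : cabs z != 0 by rewrite cabs_eq0.
exists (((cabs z)^-1)%:C * z^*)%C; split.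
  by rewrite cabsM cabs_conj cabs_real ger0_norm ?invr_ge0 ?cabs_ge0// mulVf.
rewrite -mulrA [_^*%C * z]mulrC mul_conj -real_cpxM expr2 mulKf//.
Qed.

(* Evaluate x' on the combination of the [K i] with unimodular coefficients that
   align the values [x' (K i)]. *)
Lemma dual_l1 x' (I : finType) (lam : I -> R) (K : I -> C -> C) (M : R) :
  dual (Hzero nu) x' -> (forall i, bHD (K i)) -> (forall i, 0 <= lam i) -> 0 < M ->
  (forall z, disc R z -> nu z * \sum_i lam i * cabs (K i z) <= M) ->
  \sum_i lam i * cabs (x' (K i)) <= fine (dual_norm (Hzero nu) x') * M.
Proof.
move=> dx bK l0 M0 HM.
have [u uP] := choice (fun i => unimodular (x' (K i))).
have := @dual_apply x' (\sum_i (((lam i)%:C)%C * u i) *: K i) M dx (bHD_sum _ _ bK) M0.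
rewrite dual_sum// => /(_ _) H.
have -> : \sum_i lam i * cabs (x' (K i)) =
   cabs (\sum_i ((lam i)%:C)%C * u i * x' (K i)).
  rewrite [X in _ = cabs X](_ : _ = ((\sum_i lam i * cabs (x' (K i)))%:C)%C).
    by rewrite cabs_real ger0_norm//; apply: sumr_ge0 => i _; rewrite mulr_ge0 ?cabs_ge0.
  rewrite (raddf_sum (real_complex R)); apply: eq_bigr => i _.
  by rewrite -mulrA; case: (uP i) => _ ->; rewrite -real_cpxM.
apply: H => z z1; apply: le_trans (HM z z1).
apply: ler_wpM2l; first by apply/ltW/(weight_gt0 hnu).
rewrite sum_apply (le_trans (cabs_sum _ _ _))//; apply: ler_sum => i _.
rewrite !cabsM cabs_real ger0_norm// -mulrA ler_wpM2l// ler_piMl ?cabs_ge0//.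
by case: (uP i).
Qed.

End Duality.

(** * Kernels as test functions for a nuclear representation *)

Section Kernels.
Variable R : realType.
Local Notation C := R[i].

Definition kern (N : nat) (p : C) : C -> C := fun w => (1 - (p^*)%C * w) ^- N.

Lemma kern_neq0 (p w : C) : cabs p < 1 -> cabs w <= 1 -> 1 - (p^*)%C * w != 0.
Proof. by move=> p1 w1; rewrite disc_one_sub// cabs_conj. Qed.

Lemma kern_lb (p w : C) : cabs w <= 1 -> 1 - cabs p <= cabs (1 - (p^*)%C * w).
Proof.
move=> w1; apply: le_trans (cabs_one_sub _).
by rewrite lerD2l lerN2 cabsM cabs_conj ler_piMr ?cabs_ge0.
Qed.

Lemma cdiff_kern N p w : cabs p < 1 -> cabs w < 1 ->
  cdiff (kern N p) w (N%:R * (p^*)%C * kern N.+1 p w).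
Proof.
move=> p1 w1; have nz := kern_neq0 p1 (ltW w1).
have d1 : cdiff (fun w => 1 - (p^*)%C * w) w (- (p^*)%C).
  by have := cdiffB (cdiff_cst 1 w) (cdiffZ (p^*)%C (cdiff_id w)); rewrite sub0r mulr1.
have := cdiff_comp d1 (cdiff_comp (cdiffV nz) (cdiffX N _)).
have -> : (fun w => (1 - (p^*)%C * w)^-1 ^+ N) = kern N p.
  by apply/funext => x; rewrite /kern exprVn.
congr (cdiff _ _ _); rewrite /kern -!exprVn.
move: (1 - _)^-1 => v; case: N => [|N]; rewrite /= ?exprS; ring.
Qed.

Lemma holo_kern N p : cabs p < 1 -> holo (kern N p).
Proof. by move=> p1 w w1; eexists; exact: cdiff_kern. Qed.

Lemma bHD_kern N p : cabs p < 1 -> bHD (ext0 (kern N p)).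
Proof.
move=> p1; split; first by apply: HD_ext0; exact: holo_kern.
exists ((1 - cabs p) ^- N) => z z1; rewrite ext0E// /kern cabsV cabsX.
have h0 : 0 < 1 - cabs p by rewrite subr_gt0.
have h := kern_lb p (ltW z1).
rewrite lef_pV2 ?posrE ?exprn_gt0 ?(lt_le_trans h0)// lerXn2r ?nnegrE ?(ltW h0)//.
exact: cabs_ge0.
Qed.

Variables mu : C -> R.
Variables g phi : C -> C.
Variable Mg : R.
Hypothesis hmu : normal_weight mu.
Hypothesis sphi : forall z, cabs z < 1 -> cabs (phi z) < 1.
Hypothesis HMg : forall z, disc R z -> mu z * cabs (g z) <= Mg.

Definition Jset (N : nat) (p : C) : set R :=
  [set mu z * cabs (g z) * cabs (1 - (p^*)%C * phi z) ^- N | z in disc R].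

(** A supremum of reals, meaningful when the set is bounded; [Jterm_le] ensures this for |p| < 1
    through the bound [Mg] on mu |g|. *)
Definition kernel_sup N p : R := sup (Jset N p).

Lemma Jterm_ge0 N p z : disc R z -> 0 <= mu z * cabs (g z) * cabs (1 - (p^*)%C * phi z) ^- N.
Proof.
move=> z1; rewrite mulr_ge0 ?invr_ge0 ?exprn_ge0 ?cabs_ge0//.
rewrite mulr_ge0 ?cabs_ge0//; exact: ltW (weight_gt0 hmu z1).
Qed.

Lemma Jterm_le N p z : cabs p < 1 -> disc R z ->
  mu z * cabs (g z) * cabs (1 - (p^*)%C * phi z) ^- N <= Mg * (1 - cabs p) ^- N.
Proof.
move=> p1 z1; have h0 : 0 < 1 - cabs p by rewrite subr_gt0.
have h := kern_lb p (ltW (sphi z1)).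
apply: ler_pM; rewrite ?HMg ?invr_ge0 ?exprn_ge0 ?cabs_ge0//.
  by rewrite mulr_ge0 ?cabs_ge0//; exact: ltW (weight_gt0 hmu z1).
rewrite lef_pV2 ?posrE ?exprn_gt0 ?(lt_le_trans h0)// lerXn2r ?nnegrE ?(ltW h0)//.
exact: cabs_ge0.
Qed.

Lemma Jf_ub N p z : cabs p < 1 -> disc R z ->
  mu z * cabs (g z) * cabs (1 - (p^*)%C * phi z) ^- N <= kernel_sup N p.
Proof.
move=> p1 z1; apply: ub_le_sup; last by exists z.
by exists (Mg * (1 - cabs p) ^- N) => _ [w w1 <-]; exact: Jterm_le.
Qed.

Lemma Jf_le N p b : (forall z, disc R z ->
  mu z * cabs (g z) * cabs (1 - (p^*)%C * phi z) ^- N <= b) -> kernel_sup N p <= b.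
Proof.
move=> H; apply: ge_sup; first by eexists; exists 0 => //; exact: disc0.
by move=> _ [z z1 <-]; exact: H.
Qed.

Lemma Jf_ge0 N p : cabs p < 1 -> 0 <= kernel_sup N p.
Proof. by move=> p1; apply: le_trans (Jf_ub N p1 (@disc0 R)); apply: Jterm_ge0; exact: disc0. Qed.

Lemma cderiv_lin_sum (n : nat) (c : nat -> C) (y : nat -> C -> C) z :
  (forall k, HD R (y k)) -> cabs z < 1 ->
  cdiff (\sum_(0 <= k < n) c k *: y k) z (\sum_(k < n) c k * cderiv (y k) z).
Proof.
move=> hy z1; elim: n => [|n IH].
  by rewrite big_nil big_ord0; exact: cdiff_cst.
rewrite big_nat_recr//= big_ord_recr/=.
apply: cdiffD; first exact: IH.
by apply: (@cdiffZ _ (y n)); apply: holo_cdiff => //; exact: HD_holo.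
Qed.

Lemma ereal_cvg0 (u : nat -> \bar R) : u n @[n --> \oo] --> 0%E ->
  forall e : R, 0 < e -> exists N, forall n, (N <= n)%N -> (u n <= e%:E)%E.
Proof.
move=> /fine_cvgP[[N1 _ H1] /(@cvgrPdist_le _ R^o) H2] e /H2[N2 _ H3].
exists (maxn N1 N2) => n; rewrite geq_max => /andP[n1 n2].
have f1 := H1 n n1; have := H3 n n2; rewrite /= sub0r normrN => h.
by rewrite -(fineK f1) lee_fin (le_trans (ler_norm _)).
Qed.

Section NuclearLowerBound.
Variable nu : C -> R.
Hypothesis hnu : normal_weight nu.
Hypothesis hg : holo g.
Hypothesis hphi : holo phi.
Hypothesis hT : nuclear (Hzero nu) (Bloch mu) (Sop g phi).

(** The image of the kernel at p has derivative N conj(p) kern(N+1, p)(phi) g, so its Bloch seminorm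
    is N |p| times the kernel supremum. When it is expanded in the representation, [dual_l1] handles
    all test points at once for each functional, so [T] depends on the representation only. *)
Lemma nuclear_sum_bound : exists2 T : R, 0 <= T &
  forall (I : finType) (lam : I -> R) (p : I -> C) (N : nat) (M : R),
    (forall i, 0 <= lam i) -> (forall i, cabs (p i) < 1) -> 0 < M ->
    (forall z, disc R z -> nu z * \sum_i lam i * cabs (kern N (p i) z) <= M) ->
    \sum_i lam i * (N%:R * cabs (p i) * kernel_sup N.+1 (p i)) <= T * M.
Proof.
have [mT lin [x' [y [dx cy fin cv]]]] := hT.
have c0 := @Hzero0 R nu hnu.
pose X k := fine (dual_norm (Hzero nu) (x' k)).
pose Y k := fine (snorm (Bloch mu) (y k)).
have X0 k : (0 <= dual_norm (Hzero nu) (x' k))%E by exact: dual_norm_ge0 c0 (sup_norm0 nu).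
have Y0 k : (0 <= snorm (Bloch mu) (y k))%E by exact: Bloch_norm_ge0.
have XE k : (dual_norm (Hzero nu) (x' k) = (X k)%:E)%E.
  by rewrite /X fineK// ge0_fin_numE//; case: (dx k).
have YE k : (snorm (Bloch mu) (y k) = (Y k)%:E)%E.
  rewrite /Y fineK// ge0_fin_numE//; case: (cy k) => _ h.
  by rewrite /= lte_add_pinfty// ltry.
have XR k : 0 <= X k by exact: fine_ge0.
have YR k : 0 <= Y k by exact: fine_ge0.
set S := (\sum_(0 <= k <oo) _)%E in fin.
have S0 : (0 <= S)%E by apply: nneseries_ge0 => k _ _; exact: mule_ge0.
have SE : (S = (fine S)%:E)%E by rewrite fineK// ge0_fin_numE.
have Sn n : \sum_(k < n) X k * Y k <= fine S.
  rewrite -lee_fin -SE -sumEFin.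
  have := @nneseries_lim_ge R (fun k => dual_norm (Hzero nu) (x' k) * snorm (Bloch mu) (y k))%E xpredT 0 n.
  move=> /(_ (fun k _ _ => mule_ge0 (X0 k) (Y0 k))); apply: le_trans.
  rewrite big_mkord; apply: lee_sum => k _.
  by rewrite EFinM -XE -YE.
exists (fine S); first exact: fine_ge0.
move=> I lam p N M l0 p1 M0 HM.
pose K i := ext0 (kern N (p i)).
have bK i : bHD (K i) by exact: bHD_kern.
have HK z : disc R z -> nu z * \sum_i lam i * cabs (K i z) <= M.
  by move=> z1; apply: le_trans (HM z z1); rewrite /K; under eq_bigr do rewrite ext0E//.
apply: le_eps => e e0.
pose L := \sum_i lam i.
have L0 : 0 <= L by apply: sumr_ge0.
(* The truncation errors at the test points are weighted by [lam], whose total is [L]; together they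
   stay below [e]. *)
have e'0 : 0 < e / (L + 1) by rewrite divr_gt0//; lra.
have ex i : exists n0, forall n, (n0 <= n)%N ->
    (snorm (Bloch mu) (Sop g phi (K i) - \sum_(0 <= k < n) x' k (K i) *: y k) <= (e / (L + 1))%:E)%E.
  by apply: ereal_cvg0 => //; apply: cv; exact: bHD_Hzero.
have [n0 Hn0] := choice ex.
pose n := (\max_i n0 i)%N.
have J i : N%:R * cabs (p i) * kernel_sup N.+1 (p i) <= e / (L + 1) + \sum_(k < n) cabs (x' k (K i)) * Y k.
  have := Hn0 i n (leq_bigmax _); set D := Sop g phi (K i) - _ => hD.
  have zb z : disc R z -> N%:R * cabs (p i) * (mu z * cabs (g z) * cabs (1 - ((p i)^*)%C * phi z) ^- N.+1) <=
      e / (L + 1) + \sum_(k < n) cabs (x' k (K i)) * Y k.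
    move=> z1; have [hS _ dS] := Sop_spec hg hphi sphi (HD_holo (bK i).1).
    have mz := weight_gt0 hmu z1.
    have dD : cderiv D z = cderiv (Sop g phi (K i)) z - \sum_(k < n) x' k (K i) * cderiv (y k) z.
      apply: cderivE; apply: cdiffB.
        by apply: holo_cdiff z1; exact: HD_holo.
      by apply: (@cderiv_lin_sum n (fun k => x' k (K i))) => // k; case: (cy k).
    have cK : cderiv (K i) (phi z) = N%:R * ((p i)^*)%C * kern N.+1 (p i) (phi z).
      by apply: cderivE; apply: cdiff_ext0; [exact: sphi|apply: cdiff_kern => //; exact: sphi].
    have E1 : N%:R * cabs (p i) * (mu z * cabs (g z) * cabs (1 - ((p i)^*)%C * phi z) ^- N.+1) =
       mu z * cabs (cderiv (Sop g phi (K i)) z).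
      rewrite dS// cK !cabsM cabs_nat cabs_conj /kern cabsV cabsX; ring.
    rewrite E1.
    have -> : cderiv (Sop g phi (K i)) z = cderiv D z + \sum_(k < n) x' k (K i) * cderiv (y k) z.
      by rewrite dD subrK.
    apply: (le_trans (ler_wpM2l (ltW mz) (cabsD _ _))); rewrite mulrDr; apply: lerD.
      rewrite -lee_fin; apply: le_trans hD.
      apply: (le_trans (sup_norm_ub mu (cderiv D) z1)).
      by rewrite /= leeDr// lee_fin cabs_ge0.
    apply: (le_trans (ler_wpM2l (ltW mz) (cabs_sum _ _ _))); rewrite mulr_sumr.
    apply: ler_sum => k _; rewrite cabsM mulrCA; apply: ler_wpM2l; first exact: cabs_ge0.
    rewrite -lee_fin -YE; apply: (le_trans (sup_norm_ub mu (cderiv (y k)) z1)).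
    by rewrite /= leeDr// lee_fin cabs_ge0.
  (* The supremum is reached by dividing by this factor, which vanishes at the lattice point 0. *)
  have [Np|Np] := eqVneq (N%:R * cabs (p i)) 0.
    rewrite Np mul0r addr_ge0 ?(ltW e'0)//; apply: sumr_ge0 => k _.
    by rewrite mulr_ge0 ?cabs_ge0.
  have Np0 : 0 < N%:R * cabs (p i) by rewrite lt_neqAle eq_sym Np mulr_ge0 ?cabs_ge0.
  by rewrite -ler_pdivlMl//; apply: Jf_le => z z1; rewrite ler_pdivlMl//; exact: zb.
apply: (@le_trans _ _ (\sum_i lam i * (e / (L + 1) + \sum_(k < n) cabs (x' k (K i)) * Y k))).
  by apply: ler_sum => i _; apply: ler_wpM2l.
under eq_bigr do rewrite mulrDr.
rewrite big_split/= addrC; apply: lerD; last first.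
  rewrite -mulr_suml -/L mulrCA ler_piMr ?(ltW e0)// ler_pdivrMr ?mul1r; lra.
under eq_bigr do rewrite mulr_sumr.
rewrite exchange_big/=.
apply: (@le_trans _ _ (\sum_(k < n) X k * M * Y k)).
  apply: ler_sum => k _.
  under eq_bigr do rewrite mulrA.
  rewrite -mulr_suml; apply: ler_wpM2r => //.
  exact: (dual_l1 hnu (dx k) bK l0 M0 HK).
under eq_bigr do rewrite mulrAC.
by rewrite -mulr_suml ler_wpM2r// ltW.
Qed.

End NuclearLowerBound.

End Kernels.

(** * From nuclearity to the integral *)

Section Cells.
Variable R : realType.
Local Notation C := R[i].
Local Notation dy := (dyadic R).

Lemma dyadic_level (x : R) : 0 < x <= 1 -> exists m, dy m.+1 < x <= dy m.
Proof.
move=> /andP[x0 x1].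
have ex : exists m, dy m < x.
  have [m hm] := dy_small (divr_gt0 x0 (ltr0n R 2)); exists m.
  by apply: le_lt_trans hm _; rewrite ltr_pdivrMr// ltr_pMr// ltr1n.
case: (ex_minnP ex) => -[|m] mx min; first by move: mx; rewrite dy0; lra.
exists m; rewrite mx leNgt; apply/negP => /min.
by rewrite ltnn.
Qed.

Lemma nat_cell (y : R) L : (0 < L)%N -> 0 <= y <= L%:R ->
  exists2 j, (j < L)%N & j%:R <= y <= j.+1%:R.
Proof.
elim: L => [//|[|L] IH] _ /andP[y0 yL]; first by exists 0%N => //; rewrite y0.
have [yl|ly] := leP y L.+1%:R; last by exists L.+1 => //; rewrite (ltW ly).
have [|j jL jy] := IH isT; first by rewrite y0.
by exists j => //; rewrite ltnS ltnW.
Qed.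

Lemma om_ce m j : dyadic_root R m ^+ j = ce (2 * pi * (dy m * j%:R)).
Proof. by rewrite /dyadic_root -ceMn mulrA mulr_natr. Qed.

(* [j %/ 2 ^ (m - l)] is the index of the ancestor at the coarser level [l]. *)
Definition in_cell (z : C) (m j : nat) : Prop := dy m.+1 < 1 - cabs z <= dy m /\
  forall l, (l <= m)%N -> cabs (z - lattice_point R l (j %/ 2 ^ (m - l))) <= 9 * dy l.

Lemma pi_lt4 : pi < 4 :> R.
Proof. by have := @pihalf_lt2 R; rewrite ltr_pdivrMr// (_ : 2 * 2 = 4)//; lra. Qed.

(** In the constant 9, the radial distance to an ancestor counts for 1 and the angular one for 8:
    the angle differs by at most 2 pi 2^-l, and pi < 4. *)
Lemma cell_exists (z : C) : cabs z < 1 ->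
  exists m j, (j < 2 ^ m)%N /\ in_cell z m j.
Proof.
move=> z1; have z0 := cabs_ge0 z.
have [|m mz] := @dyadic_level (1 - cabs z); first by apply/andP; split; lra.
have [t /andP[t0 t2] zE] := polar z.
have tp := @tpi_gt0 R.
pose x := t / (2 * pi).
have x0 : 0 <= x by rewrite divr_ge0// ltW.
have x1 : x <= 1 by rewrite ler_pdivrMr// mul1r.
have tE : t = 2 * pi * x by rewrite mulrC divfK// gt_eqF.
have [||j jm /andP[j1 j2]] := @nat_cell (x * 2 ^+ m) (2 ^ m); first by rewrite expn_gt0.
  by rewrite mulr_ge0 ?exprn_ge0//= natrX ler_piMl ?exprn_ge0.
exists m, j; split=> //; split=> // l lm.
set k := (2 ^ (m - l))%N; have k0 : (0 < k)%N by rewrite expn_gt0.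
set j' := (j %/ k)%N.
have mE : (2:R) ^+ m = 2 ^+ l * k%:R by rewrite natrX -exprD subnKC.
have kR : 0 < k%:R :> R by rewrite ltr0n.
have b1 : j'%:R <= x * 2 ^+ l.
  rewrite -(ler_pM2r kR) -mulrA -mE; apply: le_trans j1.
  by rewrite -natrM ler_nat leq_divM.
have b2 : x * 2 ^+ l <= j'%:R + 1.
  rewrite -(ler_pM2r kR) -mulrA -mE; apply: (le_trans j2).
  by rewrite natr1 -natrM ler_nat ltn_ceil.
have d0 := dy_gt0 R l; have d2 := dy_mul2 R l.
have xl : `|x - dy l * j'%:R| <= dy l.
  have -> : x - dy l * j'%:R = dy l * (x * 2 ^+ l - j'%:R).
    by rewrite mulrBr mulrCA d2 mulr1.
  rewrite normrM (gtr0_norm d0) ler_piMr ?(ltW d0)//.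
  by rewrite ger0_norm; lra.
have -> : z - lattice_point R l j' = ((cabs z - (1 - dy l))%:C)%C * ce t +
    ((1 - dy l)%:C)%C * (ce t - dyadic_root R l ^+ j').
  by rewrite {1}zE /lattice_point real_cpxB; ring.
rewrite (le_trans (cabsD _ _))// !cabsM !cabs_real cabs_ce mulr1.
have := dy_le R lm; have := dy_le1 R l; move: mz => /andP[m1 m2] e1 e2.
have m0 := dy_gt0 R m.+1.
have h1 : `|cabs z - (1 - dy l)| <= dy l by rewrite ger0_norm; lra.
have h2 : cabs (ce t - dyadic_root R l ^+ j') <= 8 * dy l.
  rewrite om_ce {1}tE; apply: (le_trans (ce_lip _ _)).
  rewrite -mulrBr normrM gtr0_norm//.
  by have := pi_lt4; have := normr_ge0 (x - dy l * j'%:R); nra.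
have h3 : `|1 - dy l| <= 1 by rewrite ger0_norm; lra.
have h4 : `|1 - dy l| * cabs (ce t - dyadic_root R l ^+ j') <= 1 * (8 * dy l).
  by apply: ler_pM; rewrite ?cabs_ge0.
lra.
Qed.

Lemma dy_powR m (x : R) : (dy m) `^ x = (2 `^ x) ^- m.
Proof.
have h : (2^-1:R) `^ x = (2 `^ x)^-1.
  by rewrite -[2^-1]powR_inv1// -powRrM [-1 * x]mulrC powRrM powR_inv1// powR_ge0.
rewrite -exprVn -h /dyadic; elim: m => [|m IH]; first by rewrite !expr0 powR1.
by rewrite !exprS powRM ?IH ?invr_ge0// exprn_ge0// invr_ge0.
Qed.

(** Chosen so that its l-th power times 2^(l(N+1)) is 2^(l(a+3)): the kernel of exponent N + 1 at
    scale 2^-l is traded for exponent a + 3. *)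
Definition anc_base (a : R) (N : nat) : R := 2 `^ (a + 3) * dy N.+1.

(* The ancestor at the level [l] with [dy l] comparable to [|1 - z^* w|] alone
   bounds the left-hand side; summing over all levels removes the dependence of
   [l] on [w]. *)
Lemma ancestor_kernel (a : R) (N m j : nat) (z w : C) : -1 < a -> cabs z < 1 -> cabs w < 1 ->
  in_cell z m j ->
  (cabs (1 - (z^*)%C * w) `^ (a + 3))^-1 <=
  11 ^+ N.+1 * 2 `^ (a + 3) * \sum_(l < m.+1) anc_base a N ^+ l *
     cabs (1 - ((lattice_point R l (j %/ 2 ^ (m - l)))^*)%C * w) ^- N.+1.
Proof.
move=> a1 z1 w1 [/andP[zm1 zm2] zc].
set d := cabs (1 - (z^*)%C * w).
have d1 : 1 - cabs z <= d by exact: kern_lb (ltW w1).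
have m0 := dy_gt0 R m.+1.
have d0 : 0 < d by lra.
have d2 : d <= 2.
  rewrite /d (le_trans (cabsBD _ _))// cabs1 cabsM cabs_conj.
  have := cabs_ge0 z; have := cabs_ge0 w; nra.
(* The factor 2 is for [l = 0], as the distance may be as large as 2. The level does not exceed [m]
   since the distance is at least 1 - |z|. *)
have [l lm /andP[l1 l2]] : exists2 l, (l <= m)%N & dy l.+1 <= d <= 2 * dy l.
  have [dh|hd] := leP 2^-1 d.
    by exists 0%N => //; rewrite dy0 mulr1 d2 /dyadic expr1 dh.
  have [|l /andP[h1 h2]] := @dyadic_level d; first by rewrite d0; lra.
  exists l; last by rewrite (ltW h1)/=; have := dy_gt0 R l; lra.
  rewrite leqNgt; apply/negP => /(dy_le R) h; lra.
have a3 : 0 <= a + 3 by lra.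
have P0 : 0 < 2 `^ (a + 3) by rewrite powR_gt0.
have lhs : (d `^ (a + 3))^-1 <= (2 `^ (a + 3)) ^+ l.+1.
  rewrite -[X in _ <= X]invrK -dy_powR lef_pV2 ?posrE ?powR_gt0 ?dy_gt0//.
  by apply: ge0_ler_powR; rewrite ?nnegrE ?dy_ge0 ?(ltW d0).
apply: (le_trans lhs).
have lm1 : (l < m.+1)%N by rewrite ltnS.
rewrite (bigD1 (Ordinal lm1))//=.
have zl := zc l lm.
set p := lattice_point R l (j %/ 2 ^ (m - l)) in zl *.
have p1 : cabs p < 1 by rewrite cabs_lp; case/andP: (dy_rad R l).
(* 11 = 2 + 9: the choice of the level, and the distance to the ancestor. *)
have pd : cabs (1 - (p^*)%C * w) <= 11 * dy l.
  have -> : 1 - (p^*)%C * w = (1 - (z^*)%C * w) + ((z - p)^*)%C * w by rewrite conjB; ring.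
  rewrite (le_trans (cabsD _ _))// -/d cabsM cabs_conj.
  have := cabs_ge0 (z - p); have := cabs_ge0 w; nra.
have pp : 0 < cabs (1 - (p^*)%C * w).
  by apply: lt_le_trans (kern_lb p (ltW w1)); rewrite subr_gt0.
have dl0 := dy_gt0 R l.
have rhs : (11 * dy l) ^- N.+1 <= cabs (1 - (p^*)%C * w) ^- N.+1.
  have dd : 0 < 11 * dy l by rewrite mulr_gt0.
  by rewrite lef_pV2 ?posrE ?exprn_gt0// lerXn2r ?nnegrE ?(ltW pp) ?(ltW dd).
have B0 : 0 <= anc_base a N by rewrite mulr_ge0 ?dy_ge0// ltW.
have K0 : 0 <= 11 ^+ N.+1 * 2 `^ (a + 3) by rewrite mulr_ge0 ?exprn_ge0// ltW.
apply: (@le_trans _ _ (11 ^+ N.+1 * 2 `^ (a + 3) * (anc_base a N ^+ l * (11 * dy l) ^- N.+1))).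
  rewrite /anc_base exprMn exprMn -[dy N.+1 ^+ l]exprM mulnC exprM -/(dy l) invfM exprS.
  have n1 : (11:R) ^+ N.+1 != 0 by rewrite expf_neq0.
  have n2 : dy l ^+ N.+1 != 0 by rewrite expf_neq0// gt_eqF.
  set A := 11 ^+ N.+1 in n1 *; set D := dy l ^+ N.+1 in n2 *; set Q := 2 `^ _ ^+ l.
  suff -> : A * 2 `^ (a + 3) * (Q * D * (A^-1 * D^-1)) = 2 `^ (a + 3) * Q by [].
  by field; rewrite n1 n2.
apply: ler_wpM2l => //; rewrite -[X in X <= _]addr0; apply: lerD.
  by apply: ler_wpM2l; rewrite ?exprn_ge0.
apply: sumr_ge0 => i _; rewrite mulr_ge0 ?exprn_ge0//.
by rewrite invr_ge0 exprn_ge0// cabs_ge0.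
Qed.

Lemma triangle_sum (T : nat -> nat -> R) M :
  \sum_(m < M) \sum_(l < m.+1) T m l = \sum_(l < M) \sum_(i < M - l) T (l + i)%N l.
Proof.
elim: M => [|M IH]; first by rewrite !big_ord0.
rewrite big_ord_recr/= IH [X in _ + X]big_ord_recr/= [RHS]big_ord_recr/= subSnn big_ord1 addn0 addrA.
congr (_ + _).
rewrite -big_split/=; apply: eq_bigr => l _.
by rewrite subSn 1?ltnW// big_ord_recr/= subnKC// ltnW.
Qed.

(** Each coarse cell is the ancestor of exactly [k] fine ones. *)
Lemma sum_div (F : nat -> R) L k : (0 < k)%N ->
  \sum_(j < L * k) F (j %/ k)%N = k%:R * \sum_(j < L) F j.
Proof.
move=> k0; elim: L => [|L IH]; first by rewrite mul0n !big_ord0 mulr0.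
rewrite mulSn addnC big_split_ord/= IH big_ord_recr/= mulrDr; congr (_ + _).
under eq_bigr => i _ do rewrite divnMDl// divn_small ?addn0//.
by rewrite sumr_const card_ord mulr_natl.
Qed.

(** The sign of the exponent is not known; the sum of the two constants serves both cases. *)
Lemma powR_comparable (a x y : R) : 0 < y -> y / 2 <= x <= 2 * y ->
  x `^ a <= (2 `^ a + 2 `^ (- a)) * y `^ a.
Proof.
move=> y0 /andP[h1 h2]; have x0 : 0 < x by lra.
have p1 := @powR_gt0 R 2 a (ltr0n _ _); have p2 := @powR_gt0 R 2 (- a) (ltr0n _ _).
have y1 : 0 < y `^ a by rewrite powR_gt0.
have [a0|a0] := leP 0 a.
  apply: (@le_trans _ _ ((2 * y) `^ a)).
    by apply: ge0_ler_powR => //; rewrite nnegrE ?mulr_ge0 ?ltW.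
  by rewrite powRM ?(ltW y0)// ler_pM2r// lerDl ltW.
have xa : x `^ a = (x `^ (- a))^-1 by rewrite -powRN opprK.
have ya : y `^ a = (y `^ (- a))^-1 by rewrite -powRN opprK.
have q1 : 0 < x `^ (- a) by rewrite powR_gt0.
have q2 : 0 < y `^ (- a) by rewrite powR_gt0.
apply: (@le_trans _ _ (2 `^ (- a) * y `^ a)); last by rewrite ler_pM2r// lerDr ltW.
rewrite xa ya -[X in X <= _]mul1r ler_pdivrMr// mulrAC ler_pdivlMr// mul1r.
rewrite -powRM ?(ltW x0)//; apply: ge0_ler_powR; rewrite ?nnegrE ?mulr_ge0 ?(ltW y0) ?(ltW x0)//; lra.
Qed.

End Cells.

(** No measurability is assumed: the integral of a nonnegative function is the supremum over the
    simple functions below it. *)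
Lemma ge0_integral_mono d (T : measurableType d) (R : realType)
    (mu : {measure set T -> \bar R}) (f g : T -> \bar R) :
  (forall x, 0 <= f x)%E -> (forall x, f x <= g x)%E ->
  (\int[mu]_x f x <= \int[mu]_x g x)%E.
Proof.
move=> f0 fg; rewrite !ge0_integralTE//; last by move=> x; exact: le_trans (fg x).
by apply: le_ereal_sup => _ [h hf <-]; exists h => // x; exact: le_trans (fg x).
Qed.

(** * Comparison of the disc integral with sums over squares *)

Section Area.
Variable R : realType.
Local Notation C := R[i].
Local Notation dy := (dyadic R).
Local Notation leb := (@lebesgue_measure R).
Local Notation area := (leb \x leb)%E.

Definition box (p : C) (r : R) : set (R * R) :=
  `[complex.Re p - r, complex.Re p + r] `*` `[complex.Im p - r, complex.Im p + r].

Lemma measurable_box p r : measurable (box p r).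
Proof. by apply: measurableX; exact: measurable_itv. Qed.

Lemma area_box p r : 0 <= r -> area (box p r) = ((2 * r) ^+ 2)%:E.
Proof.
move=> r0; rewrite product_measure1E; [|exact: measurable_itv|exact: measurable_itv].
have L (x : R) : leb `[x - r, x + r] = (2 * r)%:E.
  rewrite lebesgue_measure_itv/= lte_fin; case: ltP => h; last first.
    by have -> : r = 0 by [lra|]; rewrite mulr0.
  by rewrite -EFinB; congr EFin; ring.
by rewrite /= !L -EFinM expr2.
Qed.

Lemma box_mem (p z : C) r : cabs (z - p) <= r -> box p r (complex.Re z, complex.Im z).
Proof.
move=> h; have h1 := le_trans (cabs_Re (z - p)) h; have h2 := le_trans (cabs_Im (z - p)) h.
by move: h1 h2; rewrite ReB ImB !ler_distl /box/= !in_itv/= => -> ->.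
Qed.

Lemma box_near (p : C) r (q : R * R) : box p r q -> cabs ((q.1 +i* q.2)%C - p) <= 2 * r.
Proof.
rewrite /box/= !in_itv/= => -[h1 h2]; rewrite (le_trans (cabs_le_ReIm _))//.
rewrite ReB ImB mulr_natl mulr2n; apply: lerD; rewrite ler_distl//.
Qed.

Lemma pi_inv_gt0 : 0 < (pi : R)^-1.
Proof. by rewrite invr_gt0 pi_gt0. Qed.

Local Notation Dset := [set p : R * R | disc R (p.1 +i* p.2)%C].

Lemma disc_integral_lty (F : C -> \bar R) : (forall z, disc R z -> (0 <= F z)%E) ->
  (disc_integral F < +oo)%E ->
  exists Q : R, (\int[area]_p ((fun p => F (p.1 +i* p.2)%C) \_ Dset) p)%E = Q%:E.
Proof.
move=> F0; rewrite /disc_integral integral_mkcond.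
set I := (\int[_]_x _)%E => h.
have I0 : (0 <= I)%E by apply: integral_ge0 => x _; apply: erestrict_ge0 => // q; exact: F0.
exists (fine I); rewrite fineK// ge0_fin_numE//.
move: h I0; case: I => [r _ _|+ _|_]; [exact: ltry| |by []].
by rewrite gt0_muley// lte_fin pi_inv_gt0.
Qed.

Definition box_fun (M : nat) (V : nat -> nat -> R) (P : nat -> nat -> C) (r : nat -> R) (q : R * R) : R :=
  \sum_(j < 2 ^ M) V M j * \1_(box (P M j) (r M)) q.

Lemma box_fun_ge0 M V P r q : (forall m j, 0 <= V m j) -> 0 <= box_fun M V P r q.
Proof. by move=> V0; apply: sumr_ge0 => j _; rewrite mulr_ge0// indicE. Qed.

Lemma measurable_box_fun M V P r : measurable_fun setT (box_fun M V P r).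
Proof.
apply: measurable_sum => j; apply: measurable_funM; first exact: measurable_cst.
apply: measurable_indic; exact: measurable_box.
Qed.

Lemma integral_box_fun M V P r : (forall m j, 0 <= V m j) -> (forall m, 0 <= r m) ->
  (\int[area]_q (box_fun M V P r q)%:E = (\sum_(j < 2 ^ M) V M j * (2 * r M) ^+ 2)%:E)%E.
Proof.
move=> V0 r0; rewrite /box_fun.
under eq_integral do rewrite -sumEFin.
rewrite ge0_integral_sum//; last 2 first.
- move=> j; apply/measurable_EFinP; apply: measurable_funM; first exact: measurable_cst.
  by apply: measurable_indic; exact: measurable_box.
- by move=> j q _; rewrite lee_fin mulr_ge0// indicE.
rewrite -sumEFin; apply: eq_bigr => j _.
under eq_integral do rewrite EFinM.
rewrite ge0_integralZl_EFin//.
- rewrite integral_indic; [|exact: measurableT|exact: measurable_box].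
  by rewrite setIT [X in (_ * X)%E](area_box _ (r0 M)) EFinM.
- by apply/measurable_EFinP/measurable_indic; exact: measurable_box.
Qed.

(** Each point lies in a square whose value dominates [F] there, so [F] is below the series of all
    square indicators, and that series is integrated term by term. *)
Lemma disc_integral_upper (F : C -> \bar R) (V : nat -> nat -> R) (P : nat -> nat -> C) (r : nat -> R) (Q : R) :
  (forall z, disc R z -> (0 <= F z)%E) -> (forall m j, 0 <= V m j) -> (forall m, 0 <= r m) ->
  (forall z, disc R z -> exists m j, [/\ (j < 2 ^ m)%N, cabs (z - P m j) <= r m & (F z <= (V m j)%:E)%E]) ->
  (forall M, \sum_(m < M) \sum_(j < 2 ^ m) V m j * (2 * r m) ^+ 2 <= Q) ->
  (disc_integral F < +oo)%E.
Proof.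
move=> F0 V0 r0 cov HQ; rewrite /disc_integral integral_mkcond.
have H : (\int[area]_p ((fun p => F (p.1 +i* p.2)%C) \_ Dset) p <= Q%:E)%E.
  apply: (@le_trans _ _ (\int[area]_p (\sum_(0 <= m <oo) (box_fun m V P r p)%:E)))%E.
    apply: ge0_integral_mono => q; first by apply: erestrict_ge0 => // q'; exact: F0.
    have S0 m : (0 <= (box_fun m V P r q)%:E)%E by rewrite lee_fin box_fun_ge0.
    rewrite patchE; case: ifPn => [/set_mem/= qD|_]; last by apply: nneseries_ge0 => m _ _.
    have [m [j [jm near Fle]]] := cov _ qD.
    apply: (le_trans Fle).
    apply: (@le_trans _ _ (box_fun m V P r q)%:E).
      rewrite lee_fin /box_fun (bigD1 (Ordinal jm))//=.
      rewrite indicE mem_set ?mulr1.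
        by rewrite lerDl; apply: sumr_ge0 => i _; rewrite mulr_ge0// indicE.
      by have := box_mem near; case: (q).
    have := @nneseries_lim_ge R (fun m => (box_fun m V P r q)%:E) xpredT 0 m.+1 (fun m _ _ => S0 m).
    apply: le_trans; rewrite big_nat_recr//= leeDr// big_mkord.
    by apply: sume_ge0.
  rewrite integral_nneseries//; last 2 first.
  - by move=> m; apply/measurable_EFinP; exact: measurable_box_fun.
  - by move=> m q _; rewrite lee_fin box_fun_ge0.
  apply: lime_le.
    by apply: is_cvg_nneseries => m _ _; rewrite integral_box_fun// lee_fin; apply: sumr_ge0 => j _; rewrite mulr_ge0// sqr_ge0.
  apply: nearW => M; rewrite big_mkord.
  under eq_bigr do rewrite integral_box_fun//.
  by rewrite sumEFin lee_fin.
have I0 : (0 <= \int[area]_p ((fun p => F (p.1 +i* p.2)%C) \_ Dset) p)%E.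
  by apply: integral_ge0 => x _; apply: erestrict_ge0 => // q; exact: F0.
apply: (@le_lt_trans _ _ ((pi^-1)%:E * Q%:E)%E); last by rewrite -EFinM ltry.
by apply: lee_pmul => //; rewrite lee_fin ltW// pi_inv_gt0.
Qed.

Lemma sum_at_most_one (I : finType) (f : I -> R) (b : R) : 0 <= b ->
  (forall i, f i <= b) -> (forall i k, f i != 0 -> f k != 0 -> i = k) -> \sum_i f i <= b.
Proof.
move=> b0 fb one; have [i fi|none] := pickP (fun i => f i != 0); last first.
  by rewrite big1// => i _; have /negbFE/eqP := none i.
rewrite (bigD1 i)//= big1 ?addr0// => k ki; apply/eqP; apply/negPn/negP => fk.
by move: ki; rewrite (one _ _ fk fi) eqxx.
Qed.

(** The squares are disjoint, so at each point at most one indicator counts and the finite sum stays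
    below [F]. The radius 2 r appears because a square of half side r fits in that disc. *)
Lemma disc_integral_lower (F : C -> \bar R) (V : nat -> nat -> R) (P : nat -> nat -> C) (r : nat -> R) :
  (forall z, disc R z -> (0 <= F z)%E) -> (forall m j, 0 <= V m j) -> (forall m, 0 <= r m) ->
  (forall m j z, (j < 2 ^ m)%N -> cabs (z - P m j) <= 2 * r m -> disc R z /\ ((V m j)%:E <= F z)%E) ->
  (forall m j m' j' z, (j < 2 ^ m)%N -> (j' < 2 ^ m')%N -> cabs (z - P m j) <= 2 * r m ->
     cabs (z - P m' j') <= 2 * r m' -> m = m' /\ j = j') ->
  (disc_integral F < +oo)%E ->
  exists Q : R, forall M, \sum_(m < M) \sum_(j < 2 ^ m) V m j * (2 * r m) ^+ 2 <= Q.
Proof.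
move=> F0 V0 r0 low disj fin; have [Q HQ] := disc_integral_lty F0 fin.
exists Q => M; rewrite -lee_fin -HQ -sumEFin.
under eq_bigr do rewrite -(@integral_box_fun _ V P r V0 r0).
rewrite -ge0_integral_sum//; last 2 first.
- by move=> m; apply/measurable_EFinP; exact: measurable_box_fun.
- by move=> m q _; rewrite lee_fin box_fun_ge0.
apply: ge0_integral_mono => q.
  by apply: sume_ge0 => m _; rewrite lee_fin box_fun_ge0.
rewrite sumEFin /box_fun.
(* One sum over pairs (level, index), so that squares of different levels are compared in the same
   way as squares of one level. *)
rewrite (@sig_big_dep _ _ _ _ (fun m : 'I_M => 'I_(2 ^ m)) xpredT (fun _ => xpredT)
   (fun m j => V m j * \1_(box (P m j) (r m)) q))/=.
pose f (p : {m : 'I_M & 'I_(2 ^ m)}) := V (tag p) (tagged p) * \1_(box (P (tag p) (tagged p)) (r (tag p))) q.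
have fm p : f p != 0 -> box (P (tag p) (tagged p)) (r (tag p)) q.
  by rewrite /f indicE; case: (boolP (q \in _)) => [/set_mem//|_]; rewrite mulr0 eqxx.
rewrite patchE; case: ifPn => [/set_mem/= qD|qD].
  have [[b Fb]|Finf] : (exists b, F (q.1 +i* q.2)%C = b%:E) \/ F (q.1 +i* q.2)%C = +oo%E.
  - have := F0 _ qD; case: (F _) => [b| |]// _; [by left; exists b|by right].
  - have b0 : 0 <= b by rewrite -lee_fin -Fb F0.
    rewrite Fb lee_fin; apply: (@sum_at_most_one _ f) => //.
      move=> p; have [->//|fp] := eqVneq (f p) 0.
      rewrite -lee_fin -Fb /f indicE mem_set ?mulr1; last exact: fm.
      by have [] := low _ _ _ (ltn_ord (tagged p)) (box_near (fm _ fp)).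
    move=> p p' /fm/box_near h /fm/box_near h'.
    have [] := disj _ _ _ _ _ (ltn_ord (tagged p)) (ltn_ord (tagged p')) h h'.
    case: p p' {h h'} => [m j] [m' j'] /= /val_inj mm; move: j j'; rewrite mm => j j' /val_inj -> //.
  - by rewrite Finf leey.
rewrite lee_fin; apply: (@sum_at_most_one _ f) => // p.
  have [->//|fp] := eqVneq (f p) 0.
  have [d _] := low _ _ _ (ltn_ord (tagged p)) (box_near (fm _ fp)).
  by move: qD; rewrite mem_set.
move=> p' fp _.
have [d _] := low _ _ _ (ltn_ord (tagged p)) (box_near (fm _ fp)).
by move: qD; rewrite mem_set.
Qed.

End Area.

(** * From nuclearity to the integral condition *)

Section Assembly.
Variable R : realType.
Local Notation C := R[i].
Local Notation dy := (dyadic R).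
Variables (nu mu : C -> R) (g phi : C -> C) (alpha beta Mg C1 C2 G : R) (n : nat).
Hypothesis hnu : normal_weight nu.
Hypothesis hmu : normal_weight mu.
Hypothesis halpha : -1 < alpha.
Hypothesis hab : beta - 1 < alpha.
Hypothesis hg : holo g.
Hypothesis hphi : holo phi.
Hypothesis sphi : forall z, cabs z < 1 -> cabs (phi z) < 1.
Hypothesis HMg : forall z, disc R z -> mu z * cabs (g z) <= Mg.
Hypothesis C10 : 0 < C1.
Hypothesis C20 : 0 < C2.
Hypothesis G01 : 0 < G < 1.
Local Notation B := (2 `^ beta).
Local Notation dyadic_weight := (dyadic_weight nu).
Hypothesis W1 : forall m i, dyadic_weight m <= C1 * B ^+ i * dyadic_weight (m + i).
Hypothesis W2 : forall m i, dyadic_weight (m + i) <= C2 * G ^+ i * dyadic_weight m.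
Hypothesis Bn : B * dy n.+1 < 1.

Local Notation N := n.+2.
Local Notation J := (kernel_sup mu g phi N.+1).
Local Notation lattice_point := (lattice_point R).
Local Notation lam m := (dy m ^+ N / dyadic_weight m).

Let a := 2 `^ (- alpha).
Let b := anc_base alpha N.
Let Ka := 2 `^ alpha + 2 `^ (- alpha).

Lemma B_gt0 : 0 < B. Proof. exact: powR_gt0. Qed.
Lemma a_gt0 : 0 < a. Proof. exact: powR_gt0. Qed.
Lemma Ka_gt0 : 0 < Ka. Proof. by rewrite addr_gt0// powR_gt0. Qed.
Lemma vmp m : 0 < dyadic_weight m. Proof. exact: vm_gt0. Qed.
Lemma b_ge0 : 0 <= b. Proof. by rewrite mulr_ge0 ?powR_ge0 ?dy_ge0. Qed.
Lemma lp_lt1 m j : cabs (lattice_point m j) < 1.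
Proof. by rewrite cabs_lp; case/andP: (dy_rad R m). Qed.
Lemma J_lp_ge0 m j : 0 <= J (lattice_point m j).
Proof. exact: (Jf_ge0 hmu sphi HMg _ (lp_lt1 m j)). Qed.
Lemma lam_ge0 m : 0 <= lam m.
Proof. by rewrite divr_ge0 ?exprn_ge0 ?dy_ge0 ?ltW ?vmp. Qed.

Lemma dy_alpha m : (dy m) `^ alpha = a ^+ m.
Proof. by rewrite dy_powR /a powRN exprVn. Qed.

Definition integrand (zeta : C) : \bar R :=
  (ereal_sup [set (mu z * cabs (g z) /
                       cabs (1 - zeta^*%C * phi z) `^ (alpha + 3))%:E
                 | z in disc R] *
       ((1 - cabs zeta ^+ 2) `^ alpha / nu zeta)%:E)%E.

Lemma sup_term_ge0 (zeta z : C) : disc R z -> 0 <= mu z * cabs (g z) /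
                       cabs (1 - zeta^*%C * phi z) `^ (alpha + 3).
Proof.
move=> z1; rewrite divr_ge0 ?powR_ge0// mulr_ge0 ?cabs_ge0//.
by apply: ltW; apply: (weight_gt0 hmu).
Qed.

Lemma integrand_ge0 z : disc R z -> (0 <= integrand z)%E.
Proof.
move=> z1; apply: mule_ge0.
  apply: (@le_trans _ _ (mu 0 * cabs (g 0) / cabs (1 - z^*%C * phi 0) `^ (alpha + 3))%:E).
    by rewrite lee_fin; apply: sup_term_ge0; exact: disc0.
  by apply: ereal_sup_ubound; exists 0 => //; exact: disc0.
by rewrite lee_fin divr_ge0 ?powR_ge0//; apply: ltW; apply: (weight_gt0 hnu).
Qed.

Lemma nu_le_vm z m : cabs z < 1 -> 1 - cabs z <= dy m -> nu z <= dyadic_weight m.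
Proof.
move=> z1 zm; rewrite (weight_vr hnu)//; apply: vr_le => //; last by lra.
by case/andP: (dy_rad R m).
Qed.

Lemma vm_le_nu z m : cabs z < 1 -> dy m <= 1 - cabs z -> dyadic_weight m <= nu z.
Proof.
move=> z1 zm; rewrite (weight_vr hnu)//; apply: vr_le => //.
- exact: cabs_ge0.
- by lra.
- by case/andP: (dy_rad R m).
Qed.

Lemma forelli_rudin_bound (z : C) M : disc R z ->
  nu z * \sum_(m < M) (lam m * \sum_(j < 2 ^ m) cabs (kern N (lattice_point m j) z)) <=
  `|fr_const C1 C2 B G n| + 1.
Proof.
move=> z1; have z0 := cabs_ge0 z.
have [|M0 /andP[h1 h2]] := @dyadic_level R (1 - cabs z).
  by apply/andP; split; [rewrite subr_gt0|lra].
have FR := discrete_forelli_rudin vmp C10 C20 B_gt0 G01 Bn W1 W2 M h1 z1.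
apply: (@le_trans _ _ (fr_const C1 C2 B G n)); last first.
  by have := ler_norm (fr_const C1 C2 B G n); lra.
apply: le_trans FR; under eq_bigr do under eq_bigr do rewrite /kern cabsV cabsX.
apply: ler_wpM2r; last exact: nu_le_vm.
apply: sumr_ge0 => m _; apply: mulr_ge0; first exact: lam_ge0.
by apply: sumr_ge0 => j _; rewrite invr_ge0 exprn_ge0// cabs_ge0.
Qed.

Lemma nuclear_discrete : nuclear (Hzero nu) (Bloch mu) (Sop g phi) ->
  exists2 Bd : R, 0 <= Bd &
  forall M, \sum_(m < M) lam m * \sum_(j < 2 ^ m) J (lattice_point m j) <= Bd.
Proof.
move=> hT; have [T T0 HT] := nuclear_sum_bound hmu sphi hnu hg hphi hT.
(* Absolute value and 1 give the positive bound that the duality argument requires. *)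
pose Fc := `|fr_const C1 C2 B G n| + 1.
have Fc0 : 0 < Fc by rewrite ltr_wpDl.
have J0 := J_lp_ge0.
have key M : \sum_(m < M) lam m * \sum_(j < 2 ^ m) (N%:R * cabs (lattice_point m j) * J (lattice_point m j)) <= T * Fc.
  have := HT {m : 'I_M & 'I_(2 ^ m)} (fun p => lam (tag p)) (fun p => lattice_point (tag p) (tagged p)) N Fc.
  move=> /(_ (fun p => lam_ge0 _) (fun p => lp_lt1 _ _) Fc0) H.
  under eq_bigr do rewrite mulr_sumr.
  rewrite (@sig_big_dep _ _ _ _ (fun m : 'I_M => 'I_(2 ^ m)) xpredT (fun _ => xpredT)
     (fun m j => lam m * (N%:R * cabs (lattice_point m j) * J (lattice_point m j))))/=.
  apply: H => z z1; apply: le_trans (forelli_rudin_bound M z1).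
  under [X in _ <= _ * X]eq_bigr do rewrite mulr_sumr.
  by rewrite (@sig_big_dep _ _ _ _ (fun m : 'I_M => 'I_(2 ^ m)) xpredT (fun _ => xpredT)
     (fun m j => lam m * cabs (kern N (lattice_point m j) z))).
(* Level 0 is kept apart: its lattice point is 0, where the factor |p| makes the nuclear bound
   empty. *)
exists (lam 0 * J (lattice_point 0 0) + T * Fc).
  by apply: addr_ge0; apply: mulr_ge0 => //; [exact: lam_ge0|exact: ltW].
case=> [|M].
  by rewrite big_ord0; apply: addr_ge0; apply: mulr_ge0 => //; [exact: lam_ge0|exact: ltW].
rewrite big_ord_recl expn0 big_ord1/=; apply: lerD => //.
apply: le_trans (key M.+1); rewrite big_ord_recl/=.
rewrite -[X in X <= _]add0r; apply: lerD.
  apply: mulr_ge0; first exact: lam_ge0.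
  by apply: sumr_ge0 => j _; rewrite !mulr_ge0 ?cabs_ge0 ?J0.
apply: ler_sum => m _; apply: ler_wpM2l; first exact: lam_ge0.
apply: ler_sum => j _; rewrite ler_peMl ?J0// cabs_lp.
have := dy_le R (_ : (1 <= lift ord0 m)%N) => /(_ isT).
rewrite /dyadic expr1 => h.
have : 2 <= N%:R :> R by rewrite ler_nat.
nra.
Qed.

(** Per level: 2^-alpha from the weight, 2^-2 from the area and [b] from the ancestor bound multiply
    to 2^-N, exactly the lattice weight in the nuclear bound. *)
Lemma ab_identity l : a ^+ l * dy l ^+ 2 * b ^+ l = dy l ^+ N.
Proof.
have E : a * dy 1 ^+ 2 * b = dy N.
  have p8 : a * 2 `^ (alpha + 3) = 2 ^+ 3.
    rewrite /a -powRD; last by rewrite pnatr_eq0 implybT.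
    by rewrite addrA addNr add0r powR_mulrn.
  rewrite /b /anc_base (dyS R N).
  have -> : a * dy 1 ^+ 2 * (2 `^ (alpha + 3) * dy N.+1) =
    (a * 2 `^ (alpha + 3)) * dy 1 ^+ 2 * dy N.+1 by ring.
  by rewrite p8 /dyadic expr1; field.
have dl : dy l = dy 1 ^+ l by rewrite /dyadic expr1.
have dN : dy l ^+ N = dy N ^+ l by rewrite /dyadic -!exprM mulnC.
by rewrite dN -E dl -exprM mulnC exprM -!exprMn.
Qed.

(** The ratio is 2^(beta - alpha - 1); this is where the normal pair condition on the exponents
    enters. *)
Lemma q_lt1 : 0 <= a * B / 2 < 1.
Proof.
rewrite divr_ge0 ?mulr_ge0 ?(ltW a_gt0) ?(ltW B_gt0)//= ltr_pdivrMr// mul1r.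
rewrite /a -powRD; last by rewrite pnatr_eq0 implybT.
have h : 0 < 1 - (- alpha + beta) by move: hab; rewrite ltrBlDr; lra.
have E : 2 `^ (- alpha + beta) * 2 `^ (1 - (- alpha + beta)) = 2 :> R.
  rewrite -powRD; last by rewrite pnatr_eq0 implybT.
  by rewrite addrC subrK powRr1.
rewrite -[X in _ < X]E ltr_pMr ?powR_gt0//.
have := @gt0_ltr_powR R _ h 1 2; rewrite powR1 !nnegrE => /(_ ler01 (ler0n _ _)); apply.
by rewrite ltr1n.
Qed.

Let Kc := 11 ^+ N.+1 * 2 `^ (alpha + 3) * Ka * (C1 * B).

Definition cell_bound m j : R := Kc * (a ^+ m / dyadic_weight m) *
  \sum_(l < m.+1) b ^+ l * J (lattice_point l (j %/ 2 ^ (m - l))).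

Lemma Kc_ge0 : 0 <= Kc.
Proof.
rewrite /Kc; apply: mulr_ge0; last by rewrite mulr_ge0 ?ltW ?B_gt0.
by rewrite mulr_ge0 ?(ltW Ka_gt0)// mulr_ge0 ?exprn_ge0 ?powR_ge0.
Qed.

Lemma cell_bound_ge0 m j : 0 <= cell_bound m j.
Proof.
apply: mulr_ge0; first by rewrite mulr_ge0 ?Kc_ge0// divr_ge0 ?exprn_ge0 ?(ltW a_gt0) ?(ltW (vmp _)).
by apply: sumr_ge0 => l _; rewrite mulr_ge0 ?exprn_ge0 ?b_ge0 ?J_lp_ge0.
Qed.

(** In the cell 1 - |z|^2 is comparable to 2^-m. The weight [nu z] is bounded below at level m + 1,
    and one step of [W1] returns to level m. *)
Lemma integrand_le z m j : cabs z < 1 -> in_cell z m j ->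
  (integrand z <= (cell_bound m j)%:E)%E.
Proof.
move=> z1 cz; have [/andP[zm1 zm2] _] := cz.
have nz := weight_gt0 hnu z1; have z0 := cabs_ge0 z.
pose S := \sum_(l < m.+1) b ^+ l * J (lattice_point l (j %/ 2 ^ (m - l))).
pose CA : R := 11 ^+ N.+1 * 2 `^ (alpha + 3).
have CA0 : 0 <= CA by rewrite mulr_ge0 ?exprn_ge0 ?powR_ge0.
have S0 : 0 <= S by apply: sumr_ge0 => l _; rewrite mulr_ge0 ?exprn_ge0 ?b_ge0 ?J_lp_ge0.
have d0 := dy_gt0 R m; have d1 := dyS R m.
have wq : (1 - cabs z ^+ 2) `^ alpha / nu z <= Ka * a ^+ m * (C1 * B / dyadic_weight m).
  have x2 : dy m / 2 <= 1 - cabs z ^+ 2 <= 2 * dy m.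
    rewrite expr2; apply/andP; split; nra.
  apply: ler_pM; rewrite ?powR_ge0 ?invr_ge0 ?(ltW nz)//.
    by rewrite -dy_alpha; exact: powR_comparable.
  have v1 := vm_le_nu z1 (ltW zm1); have v2 := W1 m 1.
  rewrite expr1 addn1 in v2.
  rewrite -[X in X <= _]mul1r ler_pdivrMr// mulrAC ler_pdivlMr ?vmp// mul1r.
  by apply: (le_trans v2); rewrite ler_wpM2l// mulr_ge0 ?ltW ?B_gt0.
have sup_le : (ereal_sup [set (mu w * cabs (g w) /
                       cabs (1 - z^*%C * phi w) `^ (alpha + 3))%:E | w in disc R] <= (CA * S)%:E)%E.
  apply: ge_ereal_sup => _ [w w1 <-]; rewrite lee_fin.
  have A := ancestor_kernel N halpha z1 (sphi w1) cz.
  have mg0 : 0 <= mu w * cabs (g w).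
    by rewrite mulr_ge0 ?cabs_ge0//; apply: ltW; apply: (weight_gt0 hmu).
  apply: (le_trans (ler_wpM2l mg0 A)).
  rewrite mulrCA; apply: ler_wpM2l => //; rewrite mulr_sumr; apply: ler_sum => l _.
  rewrite mulrCA; apply: ler_wpM2l; first by rewrite exprn_ge0 ?b_ge0.
  exact: (Jf_ub hmu sphi HMg _ (lp_lt1 _ _) w1).
apply: (@le_trans _ _ ((CA * S)%:E * ((1 - cabs z ^+ 2) `^ alpha / nu z)%:E)%E).
  by apply: lee_wpmul2r => //; rewrite lee_fin divr_ge0 ?powR_ge0 ?ltW.
rewrite -EFinM lee_fin; apply: (le_trans (ler_wpM2l (mulr_ge0 CA0 S0) wq)).
rewrite /cell_bound -/S /Kc -/CA.
suff -> : CA * S * (Ka * a ^+ m * (C1 * B / dyadic_weight m)) = CA * Ka * (C1 * B) * (a ^+ m / dyadic_weight m) * S by [].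
by ring.
Qed.

(** With the ancestor at level l fixed, each descent by i levels contributes a^i from the weight,
    B^i from 1 / nu, 4^-i from the area and 2^i from the number of descendants: a geometric series
    of ratio a B / 2. *)
Lemma nuclear_integral : nuclear (Hzero nu) (Bloch mu) (Sop g phi) ->
  (disc_integral integrand < +oo)%E.
Proof.
move=> /nuclear_discrete[Bd Bd0 HBd].
have q01 := q_lt1.
have Kc0 := Kc_ge0.
apply: (@disc_integral_upper R integrand cell_bound lattice_point (fun m => 9 * dy m)
   (324 * Kc * C1 / (1 - a * B / 2) * Bd)).
- exact: integrand_ge0.
- exact: cell_bound_ge0.
- by move=> m; rewrite mulr_ge0 ?dy_ge0.
- move=> z z1; have [m [j [jm cz]]] := cell_exists z1; exists m, j; split=> //.
    by case: cz => _ /(_ m (leqnn m)); rewrite subnn expn0 divn1.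
  exact: integrand_le.
move=> M.
pose S l := \sum_(j < 2 ^ l) J (lattice_point l j).
have S0 l : 0 <= S l by apply: sumr_ge0 => j _; exact: J_lp_ge0.
(* 324 is the square of 2 * 9, from the side of the covering squares. *)
pose T m l := 324 * Kc * (a ^+ m * dy m ^+ 2 / dyadic_weight m) * b ^+ l * (2 ^+ (m - l) * S l).
have E1 m : \sum_(j < 2 ^ m) cell_bound m j * (2 * (9 * dy m)) ^+ 2 = \sum_(l < m.+1) T m l.
  transitivity (\sum_(l < m.+1) \sum_(j < 2 ^ m) 324 * Kc * (a ^+ m * dy m ^+ 2 / dyadic_weight m) * b ^+ l *
      J (lattice_point l (j %/ 2 ^ (m - l)))).
    rewrite exchange_big/=; apply: eq_bigr => j _.
    rewrite /cell_bound -mulrA mulr_suml mulr_sumr; apply: eq_bigr => l _; ring.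
  apply: eq_bigr => l _; rewrite -mulr_sumr /T; congr (_ * _).
  have -> : (2 ^ m = 2 ^ l * 2 ^ (m - l))%N by rewrite -expnD subnKC// -ltnS.
  rewrite (sum_div (fun i => J (lattice_point l i)) (2 ^ l)) ?expn_gt0// natrX//.
under eq_bigr do rewrite E1.
rewrite triangle_sum.
apply: (@le_trans _ _ (\sum_(l < M) (324 * Kc * C1 / (1 - a * B / 2)) * (lam l * S l))).
  apply: ler_sum => l _.
  have K1 : 0 <= 324 * Kc * C1 * (lam l * S l).
    apply: mulr_ge0; first by apply: mulr_ge0; [exact: mulr_ge0|exact: ltW].
    by apply: mulr_ge0; [exact: lam_ge0|exact: S0].
  apply: (@le_trans _ _ (\sum_(i < M - l) 324 * Kc * C1 * (lam l * S l) * (a * B / 2) ^+ i)).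
    apply: ler_sum => i _; rewrite /T addKn.
    have h : (dyadic_weight (l + i))^-1 <= C1 * B ^+ i / dyadic_weight l.
      rewrite -[X in X <= _]mul1r ler_pdivrMr ?vmp// mulrAC ler_pdivlMr ?vmp// mul1r.
      exact: W1.
    have -> : 324 * Kc * (a ^+ (l + i) * dy (l + i) ^+ 2 / dyadic_weight (l + i)) * b ^+ l * (2 ^+ i * S l) =
       324 * Kc * (a ^+ (l + i) * dy (l + i) ^+ 2 * b ^+ l * 2 ^+ i * S l) * (dyadic_weight (l + i))^-1 by ring.
    have P0 : 0 <= 324 * Kc * (a ^+ (l + i) * dy (l + i) ^+ 2 * b ^+ l * 2 ^+ i * S l).
      apply: mulr_ge0; first exact: mulr_ge0.
      apply: mulr_ge0; last exact: S0.
      apply: mulr_ge0; last exact: exprn_ge0.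
      apply: mulr_ge0; last by rewrite exprn_ge0// b_ge0.
      by apply: mulr_ge0; rewrite exprn_ge0 ?dy_ge0// ltW// a_gt0.
    apply: (le_trans (ler_wpM2l P0 h)).
    have E : dy i * 2 ^+ i = 1 by exact: dy_mul2.
    have E2 : (a * B / 2) ^+ i = a ^+ i * B ^+ i * dy i by rewrite !exprMn.
    rewrite exprD dyD -(ab_identity l) E2.
    suff -> : 324 * Kc * (a ^+ l * a ^+ i * (dy l * dy i) ^+ 2 * b ^+ l * 2 ^+ i * S l) * (C1 * B ^+ i / dyadic_weight l)
      = 324 * Kc * C1 * (a ^+ l * dy l ^+ 2 * b ^+ l / dyadic_weight l * S l) * (a ^+ i * B ^+ i * dy i) * (dy i * 2 ^+ i).
      by rewrite E mulr1.
    ring.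
  rewrite -mulr_sumr.
  have := ler_wpM2l K1 (geo_le (M - l) q01); move/le_trans; apply.
  by rewrite le_eqVlt; apply/orP; left; apply/eqP; ring.
rewrite -mulr_sumr; apply: ler_wpM2l; last exact: HBd.
have /andP[_ q1] := q01.
apply: divr_ge0; last by rewrite subr_ge0 ltW.
by apply: mulr_ge0; [exact: mulr_ge0|exact: ltW].
Qed.

End Assembly.

(** * From the integral to a sum over cells *)

Section CellCentres.
Variable R : realType.
Local Notation C := R[i].
Local Notation dy := (dyadic R).

(** Distance from the centre of a cell to the unit circle. Up to level 8 it is 1 and all centres are
    0. *)
Definition gap (m : nat) : R := Num.min 1 (256 * dy m).

(* The factor 256 makes every cell lie within [ratio] times the distance from its
   centre to the unit circle, so that kernels expand around the centre with a
   uniform geometric rate. *)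
Definition cell_centre (m j : nat) : C := ((1 - gap m)%:C)%C * dyadic_root R m ^+ j.

Lemma gap_gt0 m : 0 < gap m.
Proof. by rewrite /gap lt_min ltr01 mulr_gt0// dy_gt0. Qed.

Lemma gap_le1 m : gap m <= 1.
Proof. by rewrite /gap ge_min lexx. Qed.

Lemma cabs_cc m j : cabs (cell_centre m j) = 1 - gap m.
Proof.
rewrite cabsM cabsX cabs_om expr1n mulr1 cabs_real ger0_norm//.
by rewrite subr_ge0 gap_le1.
Qed.

Lemma cc_lt1 m j : cabs (cell_centre m j) < 1.
Proof. by rewrite cabs_cc ltrBlDr ltrDl gap_gt0. Qed.

(* A point well inside the m-th dyadic annulus: small boxes around different
   box centres are disjoint. *)
Definition box_centre (m j : nat) : C := ((1 - 3 / 4 * dy m)%:C)%C * dyadic_root R m ^+ j.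

Lemma bp_cc m j : cabs (box_centre m j - cell_centre m j) <= gap m - dy m / 8.
Proof.
rewrite -mulrBl cabsM cabsX cabs_om expr1n mulr1 -real_cpxB cabs_real ler_norml /gap.
have := dy_gt0 R m; have := dy_le1 R m.
by case: (leP 1 (256 * dy m)) => h d1 d0; apply/andP; split; lra.
Qed.

Lemma cabs_bp m j : cabs (box_centre m j) = 1 - 3 / 4 * dy m.
Proof.
rewrite cabsM cabsX cabs_om expr1n mulr1 cabs_real ger0_norm//.
have := dy_le1 R m; have := dy_gt0 R m; lra.
Qed.

Lemma bp_near z m j : cabs (z - box_centre m j) <= dy m / 8 ->
  5 / 8 * dy m <= 1 - cabs z <= 7 / 8 * dy m.
Proof.
move=> h; have h1 := cabs_bp m j.
have h2 := cabs_le_sub z (box_centre m j); have h3 := cabs_le_sub (box_centre m j) z.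
rewrite cabsB in h3; rewrite h1 in h2 h3.
by apply/andP; split; lra.
Qed.

(** Different levels are told apart by 1 - |z|, which lies between 5/8 and 7/8 of 2^-m. Within a
    level, distinct centres are at least 2^-m apart by [root_separation], against a quarter of that
    if the point were common. *)
Lemma bp_separated z m j m' j' : (j < 2 ^ m)%N -> (j' < 2 ^ m')%N ->
  cabs (z - box_centre m j) <= dy m / 8 -> cabs (z - box_centre m' j') <= dy m' / 8 -> m = m' /\ j = j'.
Proof.
move=> jm jm' h h'.
have /andP[a1 a2] := bp_near h; have /andP[b1 b2] := bp_near h'.
have mm : m = m'.
  clear jm jm'; have [/(dy_le R) l|/(dy_le R) l|//] := ltngtP m m'.
    by exfalso; have := dyS R m; have := dy_gt0 R m; lra.
  by exfalso; have := dyS R m'; have := dy_gt0 R m'; lra.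
split=> //; subst m'.
wlog jj : j j' jm jm' h h' a1 a2 b1 b2 / (j < j')%N.
  move=> W; have [lt|gt|//] := ltngtP j j'; first exact: W.
  by apply/esym; apply: W.
have d0 := dy_gt0 R m; have d1 := dy_le1 R m.
have /root_separation sep : (dyadic_root R m ^+ (j' - j)) ^+ (2 ^ m) = 1.
  by rewrite -exprM mulnC exprM om_pow expr1n.
have/sep {}sep : dyadic_root R m ^+ (j' - j) != 1.
  by rewrite om_neq1// subn_gt0 jj/= (leq_ltn_trans (leq_subr _ _)).
have : cabs (box_centre m j - box_centre m j') <= dy m / 8 + dy m / 8.
  have -> : box_centre m j - box_centre m j' = (z - box_centre m j') - (z - box_centre m j) by rewrite opprB [RHS]addrC subrKA.
  by apply: (le_trans (cabsBD _ _)); exact: lerD h' h.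
rewrite -mulrBr cabsM cabs_real ger0_norm; last by lra.
have -> : dyadic_root R m ^+ j - dyadic_root R m ^+ j' = dyadic_root R m ^+ j * (1 - dyadic_root R m ^+ (j' - j)).
  by rewrite mulrBr mulr1 -exprD subnKC// ltnW.
rewrite cabsM cabsX cabs_om expr1n mul1r => h4.
have h5 := mulr_ge0 (_ : 0 <= 1 - dy m) (cabs_ge0 (1 - dyadic_root R m ^+ (j' - j))).
by exfalso; clear jj; have := h5 (_ : 0 <= 1 - dy m); rewrite subr_ge0 => /(_ d1); lra.
Qed.

End CellCentres.

(** * Lower bound of the integrand on disjoint boxes *)

Section IntegralToSum.
Variable R : realType.
Local Notation C := R[i].
Local Notation dy := (dyadic R).
Variables (nu mu : C -> R) (g phi : C -> C) (alpha Mg : R) (n : nat).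
Hypothesis hnu : normal_weight nu.
Hypothesis hmu : normal_weight mu.
Hypothesis sphi : forall z, cabs z < 1 -> cabs (phi z) < 1.
Hypothesis HMg : forall z, disc R z -> mu z * cabs (g z) <= Mg.
Hypothesis an : alpha <= n%:R.
Local Notation dyadic_weight := (dyadic_weight nu).
Local Notation N := n.+2.
Local Notation J := (kernel_sup mu g phi N.+1).
Local Notation cell_centre := (cell_centre R).
Local Notation box_centre := (box_centre R).

(** The distance from z to the cell centre is at most the gap, hence at most the kernel denominator
    at the centre, so the denominators differ by a factor 2 at most. The exponent rises from alpha +
    3 to n + 3 because |1 - conj(z) w| >= 2^-(m+1) and n >= alpha. *)
Lemma kernel_comparison z w m j : cabs (z - box_centre m j) <= dy m / 8 -> cabs w < 1 ->
  (dy m.+1) `^ (n%:R - alpha) * 2 ^- N.+1 * cabs (1 - ((cell_centre m j)^*)%C * w) ^- N.+1 <=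
  (cabs (1 - (z^*)%C * w) `^ (alpha + 3))^-1.
Proof.
move=> h w1; have /andP[z1 z2] := bp_near h.
have d0 := dy_gt0 R m; have dS := dyS R m.
set X := cabs (1 - z^*%C * w); set Y := cabs (1 - (cell_centre m j)^*%C * w).
have zl : 1 - cabs z <= X by exact: kern_lb (ltW w1).
have yl : gap R m <= Y by apply: le_trans (kern_lb (cell_centre m j) (ltW w1)); rewrite cabs_cc; lra.
have XY : X <= 2 * Y.
  have -> : X = cabs ((1 - (cell_centre m j)^*%C * w) - (z - cell_centre m j)^*%C * w).
    by rewrite /X conjB mulrBl; congr cabs; ring.
  apply: (le_trans (cabsBD _ _)); rewrite -/Y mulr_natl mulr2n lerD2l.
  apply: (@le_trans _ _ (cabs (z - cell_centre m j))).
    by rewrite cabsM cabs_conj ler_piMr ?cabs_ge0// ltW.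
  have -> : z - cell_centre m j = (z - box_centre m j) + (box_centre m j - cell_centre m j) by ring.
  by apply: (le_trans (cabsD _ _)); have := bp_cc R m j; lra.
have X0 : 0 < X by lra.
have -> : (X `^ (alpha + 3))^-1 = X `^ (n%:R - alpha) * X ^- N.+1.
  rewrite -powRN -powR_mulrn ?(ltW X0)// -powRN -powRD; last by rewrite (gt_eqF X0) implybT.
  by congr (_ `^ _); rewrite -(addn3 n) natrD; ring.
rewrite -mulrA; apply: ler_pM; rewrite ?powR_ge0//.
- by rewrite mulr_ge0// ?invr_ge0 exprn_ge0// cabs_ge0.
- by apply: ge0_ler_powR; rewrite ?nnegrE ?subr_ge0 ?dy_ge0 ?(ltW X0)//; lra.
rewrite -invfM -exprMn lef_pV2 ?posrE ?exprn_gt0//; last by lra.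
by rewrite lerXn2r ?nnegrE// ltW//; lra.
Qed.

Let Ka := 2 `^ alpha + 2 `^ (- alpha).
Let kk m := (dy m.+1) `^ (n%:R - alpha) * 2 ^- N.+1.
Let V m j := kk m * J (cell_centre m j) * ((dy m) `^ alpha / Ka / dyadic_weight m).

Let J0 m j : 0 <= J (cell_centre m j).
Proof. exact: (Jf_ge0 hmu sphi HMg _ (cc_lt1 R m j)). Qed.

Let kk0 m : 0 < kk m.
Proof. by rewrite mulr_gt0 ?powR_gt0 ?dy_gt0// invr_gt0 exprn_gt0. Qed.

Lemma integrand_lower z m j : cabs (z - box_centre m j) <= dy m / 8 ->
  ((V m j)%:E <= integrand nu mu g phi alpha z)%E.
Proof.
move=> h; have /andP[z1 z2] := bp_near h; have z0 := cabs_ge0 z.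
have d0 := dy_gt0 R m.
have zd : cabs z < 1 by lra.
have nz := weight_gt0 hnu zd; have v0 := vm_gt0 hnu m.
have Ka0 : 0 < Ka by rewrite addr_gt0// powR_gt0.
have J0' := J0 m j; have kk0' := kk0 m.
rewrite /integrand /V EFinM; apply: lee_pmul.
- by rewrite lee_fin mulr_ge0// ltW.
- by rewrite lee_fin !mulr_ge0// ?invr_ge0 ?powR_ge0// ltW.
- set s := ereal_sup _.
  have term w : disc R w -> ((kk m * (mu w * cabs (g w) * cabs (1 - (cell_centre m j)^*%C * phi w) ^- N.+1))%:E <= s)%E.
    move=> w1; apply: (@le_trans _ _ (mu w * cabs (g w) / cabs (1 - z^*%C * phi w) `^ (alpha + 3))%:E); last first.
      by apply: ereal_sup_ubound; exists w.
    rewrite lee_fin mulrCA; apply: ler_wpM2l.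
      by rewrite mulr_ge0 ?cabs_ge0//; apply: ltW; apply: (weight_gt0 hmu).
    by apply: kernel_comparison => //; apply: sphi.
  (* The extended supremum may be infinite, where the bound is trivial; the term at 0 excludes
     -oo. *)
  move: (term); case: s term => [r| |] term tt.
  + rewrite lee_fin -ler_pdivlMl//; apply: Jf_le => w w1.
    by rewrite ler_pdivlMl// -lee_fin; exact: term.
  + by rewrite leey.
  + by have := tt 0 (@disc0 R); rewrite leeNy_eq.
rewrite lee_fin; apply: ler_pM; rewrite ?invr_ge0 ?(ltW v0)//.
- by rewrite divr_ge0 ?powR_ge0// ltW.
- rewrite ler_pdivrMr// mulrC; apply: powR_comparable; rewrite expr2; first nra.
  by apply/andP; split; nra.
rewrite lef_pV2 ?posrE//; apply: (nu_le_vm hnu) => //; lra.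
Qed.

Lemma integral_discrete : (disc_integral (integrand nu mu g phi alpha) < +oo)%E ->
  exists Q : R,
  forall M, \sum_(m < M) (dy m ^+ N / dyadic_weight m) * \sum_(j < 2 ^ m) J (cell_centre m j) <= Q.
Proof.
move=> fin.
have Ka0 : 0 < Ka by rewrite addr_gt0// powR_gt0.
have [Q HQ] : exists Q, forall M, \sum_(m < M) \sum_(j < 2 ^ m) V m j * (2 * (dy m / 16)) ^+ 2 <= Q.
  apply: (@disc_integral_lower R (integrand nu mu g phi alpha) V box_centre (fun m => dy m / 16)) => //.
  - exact: (integrand_ge0 g phi alpha hnu hmu).
  - move=> m j; have v0 := vm_gt0 hnu m; have k0 := kk0 m; have j0 := J0 m j.
    by rewrite /V !mulr_ge0// ?invr_ge0 ?powR_ge0// ltW.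
  - by move=> m; rewrite divr_ge0// dy_ge0.
  - move=> m j z jm h; have {}h : cabs (z - box_centre m j) <= dy m / 8 by lra.
    split; last exact: integrand_lower.
    by have /andP[z1 z2] := bp_near h; have := dy_gt0 R m; rewrite /disc/=; lra.
  - move=> m j m' j' z jm jm' h h'.
    by apply: (@bp_separated R z) => //; lra.
(* All factors independent of the level and the cell; 64 comes from the area of boxes of half side
   2^-m / 16. *)
pose K := 2 ^- N.+1 * (2 `^ (n%:R - alpha))^-1 / Ka / 64.
have K0 : 0 < K by rewrite /K !mulr_gt0// ?invr_gt0 ?exprn_gt0// powR_gt0.
exists (K^-1 * Q) => M; rewrite ler_pdivlMl//.
apply: le_trans (HQ M); rewrite mulr_sumr; apply: ler_sum => m _.
rewrite !mulr_sumr; apply: ler_sum => j _.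
have E : dy m.+1 `^ (n%:R - alpha) * dy m `^ alpha = dy m ^+ n * (2 `^ (n%:R - alpha))^-1.
  have p0 : 2 `^ (n%:R - alpha) != 0 :> R by rewrite gt_eqF// powR_gt0.
  have dn : dy m ^+ n = (2 `^ (n%:R - alpha) * 2 `^ alpha) ^- m.
    rewrite -powRD; last by rewrite pnatr_eq0 implybT.
    by rewrite subrK powR_mulrn// /dyadic -exprM mulnC exprM -exprVn exprVn.
  rewrite !dy_powR dn exprMn exprS !invfM; move: (_ ^- m) (_ ^-1) => u v; ring.
rewrite /V /kk /K.
have -> : (2 * (dy m / 16)) ^+ 2 = dy m ^+ 2 / 64 by field.
have -> : (dy m.+1 `^ (n%:R - alpha) * 2 ^- N.+1 * J (cell_centre m j) * (dy m `^ alpha / Ka / dyadic_weight m) *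
  (dy m ^+ 2 / 64)) = (dy m.+1 `^ (n%:R - alpha) * dy m `^ alpha) * 2 ^- N.+1 * J (cell_centre m j) / Ka / dyadic_weight m *
  dy m ^+ 2 / 64 by ring.
rewrite E (_ : dy m ^+ N = dy m ^+ n * dy m ^+ 2); last by rewrite -exprD addn2.
rewrite le_eqVlt; apply/orP; left; apply/eqP; ring.
Qed.

End IntegralToSum.

(** * Double series *)

Lemma pair_bijection : exists (e : nat -> nat * nat) (e' : nat * nat -> nat), cancel e e' /\ cancel e' e.
Proof.
have /card_esym/card_set_bijP[e] := card_nat2.
by rewrite setTT_bijective => -[e' eK e'K]; exists e, e'.
Qed.

Lemma sum_delta (V : nmodType) (F : nat -> V) (a n : nat) :
  \sum_(p < n) (if a == p then F p else 0) = if (a < n)%N then F a else 0.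
Proof.
elim: n => [|n IH]; first by rewrite big_ord0.
rewrite big_ord_recr/= IH [in RHS]ltnS [in RHS]leq_eqVlt.
by have [->|an] := eqVneq a n; rewrite /= ?ltnn ?add0r ?addr0.
Qed.

Section DoubleSeries.
Variable R : realType.
Local Notation C := R[i].
Variables (e : nat -> nat * nat) (e' : nat * nat -> nat).
Hypotheses (eK : cancel e e') (e'K : cancel e' e).

Lemma box_reindex (V : nmodType) (v : nat -> nat -> V) P K L :
  (forall p k, (p < P)%N -> (k < K)%N -> (e' (p, k) < L)%N) ->
  \sum_(p < P) \sum_(k < K) v p k =
  \sum_(i < L) (if ((e i).1 < P)%N && ((e i).2 < K)%N then v (e i).1 (e i).2 else 0).
Proof.
move=> HL.
transitivity (\sum_(i < L) \sum_(p < P) \sum_(k < K) (if e i == (p : nat, k : nat) then v p k else 0)).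
  rewrite [RHS]exchange_big/=; apply: eq_bigr => p _; rewrite [RHS]exchange_big/=; apply: eq_bigr => k _.
  rewrite (eq_bigr (fun i : 'I_L => if e' (p : nat, k : nat) == i then v p k else 0)).
    by rewrite (sum_delta (fun=> v p k)) HL.
  move=> i _; congr (if _ then _ else _).
  by apply/eqP/eqP => [<-|<-]; rewrite ?eK ?e'K.
apply: eq_bigr => i _; case: (e i) => a b /=.
transitivity (\sum_(p < P) (if a == p then (if (b < K)%N then v p b else 0) else 0)).
  apply: eq_bigr => p _; case: (eqVneq a p) => [->|ap].
    rewrite -(sum_delta (fun k => v p k)); apply: eq_bigr => k _.
    by rewrite xpair_eqE eqxx.
  by rewrite big1// => k _; rewrite xpair_eqE (negbTE ap).
by rewrite (sum_delta (fun p => if (b < K)%N then v p b else 0)); case: (a < P)%N.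
Qed.

Lemma box_index P K n : exists2 L, (n <= L)%N &
  forall p k, (p < P)%N -> (k < K)%N -> (e' (p, k) < L)%N.
Proof.
exists (maxn n (\max_(p < P) \max_(k < K) (e' (p : nat, k : nat)).+1)); first exact: leq_maxl.
move=> p k pP kK; rewrite leq_max; apply/orP; right.
apply: leq_trans (leq_bigmax (Ordinal pP)).
exact: leq_trans (leq_bigmax (F := fun k : 'I_K => (e' (p, k : nat)).+1) (Ordinal kK)).
Qed.

Lemma box_cover n P0 K0 : exists P K, [/\ (P0 <= P)%N, (K0 <= K)%N &
  forall i, (i < n)%N -> ((e i).1 < P)%N && ((e i).2 < K)%N].
Proof.
exists (maxn P0 (\max_(i < n) (e i).1.+1)), (maxn K0 (\max_(i < n) (e i).2.+1)).
split; try exact: leq_maxl; move=> i ni; rewrite !leq_max; apply/andP; split; apply/orP; right.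
  exact: leq_trans (leq_bigmax (F := fun i : 'I_n => (e i).1.+1) (Ordinal ni)).
exact: leq_trans (leq_bigmax (F := fun i : 'I_n => (e i).2.+1) (Ordinal ni)).
Qed.

Lemma box_split (V : zmodType) (v : nat -> nat -> V) n P K : 
  (forall i, (i < n)%N -> ((e i).1 < P)%N && ((e i).2 < K)%N) -> exists2 L, (n <= L)%N &
  \sum_(p < P) \sum_(k < K) v p k = \sum_(i < n) v (e i).1 (e i).2 +
   \sum_(n <= i < L) (if ((e i).1 < P)%N && ((e i).2 < K)%N then v (e i).1 (e i).2 else 0).
Proof.
move=> H; have [L nL HL] := box_index P K n; exists L => //.
rewrite (box_reindex _ HL).
rewrite -(big_mkord xpredT (fun i => if ((e i).1 < P)%N && ((e i).2 < K)%N then v (e i).1 (e i).2 else 0)).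
rewrite (@big_cat_nat _ _ _ n)//= big_mkord; congr (_ + _).
by apply: eq_bigr => i _; rewrite H.
Qed.

Variables (b : nat -> nat -> R) (Q : R).
Hypothesis b0 : forall p k, 0 <= b p k.
Hypothesis bQ : forall P K, \sum_(p < P) \sum_(k < K) b p k <= Q.

Lemma double_summable : summable (fun i => b (e i).1 (e i).2).
Proof.
split=> [i|]; first exact: b0.
exists Q => n; have [P [K [_ _ H]]] := box_cover n 0 0.
apply: le_trans (bQ P K); have [L _ ->] := box_split b H.
by rewrite lerDl sumr_ge0// => i _; case: ifP.
Qed.

(** A partial sum along the enumeration is compared with a rectangle containing its indices: the
    difference is a tail of the majorant, and large rectangles approach the iterated sum. *)
Lemma double_csum (v : nat -> nat -> C) (r : nat -> C) (S : C) :
  (forall p k, cabs (v p k) <= b p k) -> (forall p, csum (v p) (r p)) -> csum r S ->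
  csum (fun i => v (e i).1 (e i).2) S.
Proof.
move=> vb weight_at rS eps eps0.
have [N HN] := summable_tail double_summable eps0.
exists N => n Nn; apply: le_eps => d d0.
have [P0 HP] := rS (d / 2) (divr_gt0 d0 (ltr0Sn _ _)).
have [P [K1 [P0P _ HPc]]] := box_cover n P0 0.
have dP : 0 < d / 2 / P.+1%:R by rewrite !divr_gt0.
have [k0 Hk0] := choice (fun p => weight_at p _ dP).
(* The width comes after the height, since all [P] rows must be summed accurately. *)
have [P' [K [_ K0K H]]] := box_cover n 0 (\max_(p < P) k0 p).
have Hbox i : (i < n)%N -> ((e i).1 < P)%N && ((e i).2 < K)%N.
  by move=> ni; have /andP[-> _] := HPc i ni; have /andP[_ ->] := H i ni.
have [L nL E] := box_split v Hbox.
set T := \sum_(n <= i < L) _ in E.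
have Tb : cabs T <= eps.
  apply: (le_trans (cabs_sum _ _ _)); apply: le_trans (HN n L Nn); apply: ler_sum => i _.
  by case: ifP => _; rewrite ?cabs0.
set B := \sum_(p < P) \sum_(k < K) v p k in E.
have BS : cabs (B - S) <= d.
  have -> : B - S = (B - \sum_(p < P) r p) + (\sum_(p < P) r p - S) by rewrite addrA subrK.
  apply: (le_trans (cabsD _ _)); rewrite [d]splitr; apply: lerD; last exact: HP.
  rewrite -sumrB; apply: (le_trans (cabs_sum _ _ _)).
  apply: (@le_trans _ _ (\sum_(p < P) d / 2 / P.+1%:R)).
    apply: ler_sum => p _; apply: Hk0; apply: leq_trans K0K.
    exact: (leq_bigmax (F := fun p : 'I_P => k0 p) p).
  rewrite sumr_const card_ord -[X in X <= _]mulr_natr mulrAC ler_pdivrMr//.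
  by apply: ler_wpM2l; [rewrite divr_ge0// ltW|rewrite ler_nat leqnSn].
have -> : \sum_(i < n) v (e i).1 (e i).2 - S = (B - S) - T by rewrite E addrAC addrK.
by apply: (le_trans (cabsBD _ _)); rewrite addrC lerD.
Qed.

End DoubleSeries.

(** * The reproducing formula *)

Section Clamp.
Variable R : realType.
Local Notation C := R[i].
Variables (a c : R).
Hypothesis ac : a <= c.

(* Nothing is known about the sum of a series of functions outside [[a, c]]; freezing
   it there gives two-sided continuity at the endpoints. *)
Definition clamp (t : R) : R := Num.max a (Num.min t c).

Lemma clamp_in t : a <= clamp t <= c.
Proof. by rewrite le_max lexx ge_max ac ge_min lexx orbT. Qed.

Lemma clamp_id t : a <= t <= c -> clamp t = t.
Proof. by move=> /andP[h1 h2]; rewrite /clamp min_l// max_r. Qed.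

Lemma clamp_lip s t : `|clamp s - clamp t| <= `|s - t|.
Proof.
rewrite /clamp; wlog st : s t / s <= t.
  by move=> W; have [/W//|/ltW/W] := leP s t; rewrite distrC [`|t - s|]distrC.
rewrite [X in X <= _]distrC [X in _ <= X]distrC [X in _ <= X]ger0_norm ?subr_ge0//.
by case: (leP t c) => ?; case: (leP s c) => ?; case: (leP a s) => ?; case: (leP a t) => ?;
  case: (leP a c) => ?; rewrite ler_norml; apply/andP; split; lra.
Qed.

Lemma rcont_clamp (h : R -> C) t : cont_on a c h -> rcont (fun s => h (clamp s)) t.
Proof.
move=> ch e e0; have [d d0 Hd] := ch _ (clamp_in t) _ e0.
by exists d => // s st; apply: Hd; exact: le_lt_trans (clamp_lip s t) st.
Qed.

Section UniformSeries.
Variables (u' : nat -> R -> C) (s : R -> C) (b : nat -> R).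
Hypothesis sb : summable b.
Hypothesis cu : forall k, cont_on a c (u' k).
Hypothesis ub : forall k t, a <= t <= c -> cabs (u' k t) <= b k.
Hypothesis us : forall t, a <= t <= c -> csum (fun k => u' k t) (s t).

Lemma csum_rcont_clamp : cont_on a c (fun t => s (clamp t)).
Proof.
apply: (@csum_continuous R (fun k t => u' k (clamp t)) _ b a c sb).
- by move=> k t _; exact: rcont_clamp.
- by move=> k t; apply: ub; exact: clamp_in.
- by move=> t; apply: us; exact: clamp_in.
Qed.

Lemma csum_cint_uniform : csum (fun k => cint a c (u' k)) (cint a c s).
Proof.
rewrite (@eq_cint _ a c s (fun t => s (clamp t))); last by move=> t tt; rewrite clamp_id.
apply: (@csum_cint R u' _ b) => //; first exact: csum_rcont_clamp.
by move=> t tt; rewrite clamp_id//; exact: us.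
Qed.

End UniformSeries.
End Clamp.

(** * Beta integrals *)

Section Beta.
Variable R : realType.
Local Notation C := R[i].

Lemma cont_beta (a c : R) (n j : nat) :
  cont_on a c (fun s => (1 - (s%:C)%C) ^+ n * (s%:C)%C ^+ j : C).
Proof.
move=> t _; apply: rcontM; apply: rcontX; last exact: rcont_id.
by apply: rcontB; [exact: rcont_cst|exact: rcont_id].
Qed.

(** Integration by parts: (1 - s)^(n+1) s^(j+1) vanishes at both ends, which moves one power from
    the first factor to the second. *)
Lemma beta_int n j : cint 0 1 (fun s : R => (1 - (s%:C)%C) ^+ n * (s%:C)%C ^+ j : C) =
  (j`! * n`!)%:R / ((j + n).+1)`!%:R.
Proof.
have r1 t : rderiv (fun s => (s%:C)%C : C) t 1.
  by have := @rderiv_lin R 1 t; under eq_fun do rewrite mulr1.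
have B0 k l : cont_on 0 1 (fun s : R => (1 - (s%:C)%C) ^+ k * (s%:C)%C ^+ l : C) by exact: cont_beta.
elim: n j => [|n IH] j; have nz : j.+1%:R != 0 :> C by rewrite pnatr_eq0.
  have E : cint 0 1 (fun s : R => j.+1%:R * ((1 - (s%:C)%C) ^+ 0 * (s%:C)%C ^+ j) : C) = 1.
    rewrite (@cint_FTC R 0 1 (fun s => (s%:C)%C ^+ j.+1))//.
    - by rewrite expr1n expr0n subr0.
    - by move=> t tt; apply: rcontM; [exact: rcont_cst|exact: B0 tt].
    - move=> t _; have := rderiv_comp (cdiffX j.+1 _) (r1 t).
      by rewrite expr0 mul1r mulr1.
  apply: (mulfI nz); rewrite -cintZ ?E; last exact: B0.
  have fz : j`!%:R != 0 :> C by rewrite pnatr_eq0 -lt0n fact_gt0.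
  by rewrite fact0 muln1 addn0 factS natrM mulrA mulfV// mulf_neq0.
have E : cint 0 1 (fun s : R => j.+1%:R * ((1 - (s%:C)%C) ^+ n.+1 * (s%:C)%C ^+ j) -
    n.+1%:R * ((1 - (s%:C)%C) ^+ n * (s%:C)%C ^+ j.+1) : C) = 0.
  rewrite (@cint_FTC R 0 1 (fun s => (1 - (s%:C)%C) ^+ n.+1 * (s%:C)%C ^+ j.+1))//.
  - by rewrite subrr !expr0n/= mul0r mulr0 subrr.
  - by move=> t tt; apply: rcontB; apply: rcontM; [exact: rcont_cst|exact: B0 tt|exact: rcont_cst|exact: B0 tt].
  - move=> t _; set w := (t%:C)%C.
    have d1 := cdiff_comp (cdiffB (cdiff_cst 1 w) (cdiff_id w)) (cdiffX n.+1 _).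
    have := rderiv_comp (h := fun s => (s%:C)%C) (cdiffM d1 (cdiffX j.+1 w)) (r1 t).
    by rewrite /= -/w; congr (rderiv _ _ _); rewrite sub0r; ring.
apply: (mulfI nz); move: E; rewrite cintB; last first.
- by move=> t tt; apply: rcontM; [exact: rcont_cst|exact: B0 tt].
- by move=> t tt; apply: rcontM; [exact: rcont_cst|exact: B0 tt].
rewrite cintZ; last exact: B0.
rewrite cintZ; last exact: B0.
move=> /eqP; rewrite subr_eq0 => /eqP ->; rewrite IH addSnnS !factS !natrM; ring.
Qed.

End Beta.

(** * Distance of the kernel parameters from the cell centre *)

Section Geometry.
Variable R : realType.
Local Notation C := R[i].
Local Notation dy := (dyadic R).
Local Notation tpi := (2 * pi : R).

Lemma law_of_cosines (x r s t : R) :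
  cabs ((x%:C)%C * ce s - (r%:C)%C * ce t : C) ^+ 2 = (x - r) ^+ 2 + x * r * cabs (ce s - ce t : C) ^+ 2.
Proof.
rewrite !cabs_sqr !ReB !ImB !ReM !ImM !ReC !ImC /ce/=.
have hs := cos2Dsin2 s; have ht := cos2Dsin2 t.
have {}hs : sin s ^+ 2 = 1 - cos s ^+ 2 by rewrite -hs addrAC subrr add0r.
have {}ht : sin t ^+ 2 = 1 - cos t ^+ 2 by rewrite -ht addrAC subrr add0r.
ring: hs ht.
Qed.

(* Circle averages of [f] against a kernel depend only on the product of the two
   radii.  Evaluating [f] at the fixed radius [1 - dy m.+2] and the kernel at
   [kernel_radius m s] leaves the integration variable [s] in the kernel alone. *)
Definition kernel_radius (m : nat) (s : R) : R := s / (1 - dy m.+2).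

(** Two demands fix the value. Up to level 8 the centre is 0 and the parameters have modulus at most
    1 - 2^-10. Beyond, a radial distance of (256 - 1/4) 2^-m and an angular one of 8 * 2^-m are
    combined, and (256 - 1/4)^2 + 8^2 <= (256 - 1/16)^2. *)
Definition ratio : R := 1 - 4096^-1.

Lemma ratio01 : 0 <= ratio < 1.
Proof. by rewrite /ratio; apply/andP; split; lra. Qed.

(** The upper bound rests on 1 - 2 d <= (1 - d)^2 with d = 2^-(m+2). *)
Lemma sg_bounds m s : 1 - dy m <= s <= 1 - dy m.+1 -> 1 - dy m <= kernel_radius m s <= 1 - dy m.+2.
Proof.
move=> /andP[s1 s2]; have d0 := dy_gt0 R m; have d1 := dy_le1 R m.
have e1 := dyS R m; have e2 := dyS R m.+1.
have p0 : 0 < 1 - dy m.+2 by lra.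
by rewrite /kernel_radius ler_pdivlMr// ler_pdivrMr//; apply/andP; split; nra.
Qed.

Lemma cell_kernel_close m j s t : 1 - dy m <= s <= 1 - dy m.+1 ->
  tpi * dy m * j%:R <= t <= tpi * dy m * j.+1%:R ->
  cabs (((kernel_radius m s)%:C)%C * ce (- t) - ((cell_centre R m j)^*)%C) <= ratio * gap R m.
Proof.
move=> /sg_bounds; move: (kernel_radius m s) => x /andP[x1 x2] /andP[t1 t2].
have d0 := dy_gt0 R m; have d1 := dy_le1 R m.
have e1 := dyS R m; have e2 := dyS R m.+1.
have -> : ((x%:C)%C * ce (- t) - ((cell_centre R m j)^*)%C) = ((((x%:C)%C * ce t - cell_centre R m j))^*)%C.
  by rewrite conjB [in RHS]conjM conjc_real ceN.
rewrite cabs_conj /cell_centre /gap; case: (leP 1 (256 * dy m)) => h.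
  rewrite subrr mul0r subr0 cabs_pt ger0_norm /ratio; lra.
rewrite om_ce; set r := 1 - 256 * dy m; set t0 := 2 * pi * _.
have tt : `|t - t0| <= 8 * dy m.
  have pi4 := @pi_lt4 R; have pi0 := @pi_gt0 R.
  have t1' : t0 <= t by rewrite /t0 mulrA.
  have t2' : t <= t0 + tpi * dy m.
    by apply: (le_trans t2); rewrite /t0 -natr1 le_eqVlt; apply/orP; left; apply/eqP; ring.
  rewrite ger0_norm; nra.
have ct := le_trans (ce_lip t t0) tt.
have r0 : 0 <= ratio * (256 * dy m) by case/andP: ratio01 => q0 _; apply: mulr_ge0 => //; apply: mulr_ge0 => //; exact: ltW.
rewrite -(ler_pXn2r (n := 2)) ?nnegrE ?cabs_ge0// law_of_cosines.
have c0 := cabs_ge0 (ce t - ce t0 : C).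
have X1 : (x - r) ^+ 2 <= ((256 - 4^-1) * dy m) ^+ 2.
  by apply: lerXn2r; rewrite ?nnegrE /r; lra.
have X2 : x * r * cabs (ce t - ce t0 : C) ^+ 2 <= (8 * dy m) ^+ 2.
  apply: (@le_trans _ _ (1 * cabs (ce t - ce t0 : C) ^+ 2)).
    apply: ler_wpM2r; first exact: exprn_ge0.
    by rewrite -[1]mulr1; apply: ler_pM; rewrite /r; lra.
  by rewrite mul1r lerXn2r ?nnegrE//; lra.
have D0 : 0 <= dy m ^+ 2 by rewrite exprn_ge0// ltW.
apply: (le_trans (lerD X1 X2)); rewrite /ratio !exprMn; lra.
Qed.

End Geometry.

Section Telescoping.
Variable R : realType.
Local Notation C := R[i].
Local Notation dy := (dyadic R).

Lemma cont_on_sub (a b c d : R) (h : R -> C) : c <= a -> b <= d -> cont_on c d h -> cont_on a b h.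
Proof.
by move=> ca bd ch t /andP[t1 t2]; apply: ch; rewrite (le_trans ca)//= (le_trans t2).
Qed.

Lemma cint_point (a : R) (h : R -> C) : rcont h a -> cint a a h = 0.
Proof.
move=> ch; have ca : cont_on a a h by move=> t; rewrite -eq_le => /eqP <-.
have [M HM] := cont_on_bounded (lexx a) ca.
apply/eqP; rewrite -cabs_eq0 eq_le cabs_ge0 andbT.
by have := cint_norm (lexx a) ca HM; rewrite subrr mulr0.
Qed.

Lemma cint_telescope (x : nat -> R) (h : R -> C) M : (forall i, x i <= x i.+1) ->
  cont_on (x 0%N) (x M) h ->
  \sum_(i < M) cint (x i) (x i.+1) h = cint (x 0%N) (x M) h.
Proof.
move=> xi.
have x0 i : x 0%N <= x i by elim: i => [//|i IH]; exact: le_trans (xi i).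
elim: M => [|M IH] ch; first by rewrite big_ord0 cint_point//; apply: ch; rewrite lexx.
rewrite big_ord_recr/= IH; last exact: cont_on_sub ch.
by rewrite (cint_split (x0 M) (xi M)).
Qed.

Lemma csum_cint_dyadic (h : R -> C) : cont_on 0 1 h ->
  csum (fun m => cint (1 - dy m) (1 - dy m.+1) h) (cint 0 1 h).
Proof.
move=> ch; have [B HB] := cont_on_bounded (@ler01 R) ch.
have B0 : 0 <= B by apply: le_trans (HB 0 _); rewrite ?cabs_ge0// lexx ler01.
have h0 m : 0 <= 1 - dy m by case/andP: (dy_rad R m).
have h1 m : 1 - dy m <= 1 by have := dy_gt0 R m; lra.
move=> e e0; have [N HN] := dy_small (divr_gt0 e0 (ltr_wpDl B0 ltr01)); exists N => n Nn.
have x0 : 1 - dy 0 = 0 by rewrite dy0 subrr.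
rewrite (@cint_telescope (fun m => 1 - dy m)).
- rewrite x0 (cint_split (h0 n) (h1 n) ch) opprD addNKr cabsN.
  apply: (@le_trans _ _ (B * (1 - (1 - dy n)))).
    apply: cint_norm; [exact: h1|exact: cont_on_sub ch|move=> t /andP[t1 t2]].
    by apply: HB; rewrite t2 (le_trans (h0 n)).
  rewrite opprB addrCA subrr addr0.
  have := le_trans (dy_le R Nn) HN; rewrite ler_pdivlMr; last by lra.
  have := dy_ge0 R n; nra.
- by move=> i; have := dyS R i; have := dy_gt0 R i.+1; lra.
- by rewrite x0; exact: cont_on_sub ch.
Qed.

End Telescoping.

(** * The derivative as a sum of circle averages *)

Section Reproducing.
Variable R : realType.
Local Notation C := R[i].
Local Notation dy := (dyadic R).
Local Notation tpi := (2 * pi : R).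
Local Notation pt r t := ((r%:C)%C * ce t).

Lemma rad1_shift (a : nat -> C) : rad1 a -> rad1 (fun k => a k.+1).
Proof.
move=> ra r r01; have [p [p0 rp p01]] := radius_between r01.
have [M HM] := ra p p01; exists (M / p) => k; rewrite ler_pdivlMr//.
apply: le_trans (HM k.+1); rewrite exprSr mulrA.
apply: ler_wpM2r; first exact: ltW.
by apply: ler_wpM2l; [exact: cabs_ge0|apply: lerXn2r; rewrite ?nnegrE ?(ltW p0) ?(ltW rp)//; case/andP: r01].
Qed.

Variable f : C -> C.
Hypothesis hf : holo f.

Lemma rcont_circle_kernel (p s : R) (w : C) N t : 0 <= p < 1 -> 0 <= s < 1 -> cabs w <= 1 ->
  rcont (fun t => f (pt p t) * (((s%:C)%C * ce (- t)) * (1 - (s%:C)%C * ce (- t) * w) ^- N)) t.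
Proof.
move=> p01 /andP[s0 s1] w1; have cs u : rcont (fun t => (s%:C)%C * ce (- t)) u.
  by apply: rcontM; [exact: rcont_cst|exact: rcont_ceN].
apply: rcontM; first exact: holo_arc.
apply: rcontM => //.
have -> : (fun t => (1 - (s%:C)%C * ce (- t) * w) ^- N) =
          (fun t => (1 - (s%:C)%C * ce (- t) * w)^-1 ^+ N) by apply/funext => u; rewrite exprVn.
apply: rcontX; apply: (ccont_rcont (f := fun z => z^-1)).
  apply: ccontV; first exact: ccont_id.
  by apply: disc_one_sub => //; rewrite cabs_pt ger0_norm.
by apply: rcontB; [exact: rcont_cst|apply: rcontM => //; exact: rcont_cst].
Qed.

(** The binomial expansion of the kernel turns the average into Fourier coefficients of [f]. The
    prefactor of the kernel shifts the index by one, as differentiation does. *)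
Lemma circle_kernel (a : nat -> C) (p s : R) (w : C) N :
  (forall r, 0 < r < 1 -> forall k, taylor_coef f r k = a k * (r%:C)%C ^+ k) ->
  0 < p < 1 -> 0 <= s < 1 -> cabs w <= 1 ->
  csum (fun j => a j.+1 * ((p * s)%:C)%C ^+ j.+1 * ('C(N + j, j)%:R * w ^+ j))
    (((tpi^-1)%:C)%C * cint 0 tpi (fun t => f (pt p t) *
       (((s%:C)%C * ce (- t)) * (1 - (s%:C)%C * ce (- t) * w) ^- N.+1))).
Proof.
move=> aE p01 s01 w1; have /andP[p0 p1] := p01; have /andP[s0 s1] := s01.
have p01' : 0 <= p < 1 by rewrite p1 ltW.
have cf t : rcont (fun t => f (pt p t)) t by exact: holo_arc.
have [M HM] := cont_on_bounded (@tpi_ge0 R) (fun t _ => cf t : rcont _ t).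
have M0 : 0 <= M by apply: le_trans (HM 0 _); rewrite ?cabs_ge0// lexx tpi_ge0.
have cs u : rcont (fun t => (s%:C)%C * ce (- t) : C) u.
  by apply: rcontM; [exact: rcont_cst|exact: rcont_ceN].
pose v j t := f (pt p t) * (((s%:C)%C * ce (- t)) * ('C(N + j, j)%:R * ((s%:C)%C * ce (- t) * w) ^+ j)).
have sw : 0 <= s * cabs w < 1.
  by rewrite mulr_ge0 ?cabs_ge0//= (le_lt_trans _ s1)// ler_piMr.
have S : csum (fun j => cint 0 tpi (v j)) (cint 0 tpi (fun t => f (pt p t) *
       (((s%:C)%C * ce (- t)) * (1 - (s%:C)%C * ce (- t) * w) ^- N.+1))).
  apply: (csum_cint_uniform (@tpi_ge0 R) (summableZ M0 (summable_bin_geo N sw))).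
  - move=> j t _; apply: rcontM => //; apply: rcontM => //; apply: rcontM; first exact: rcont_cst.
    by apply: rcontX; apply: rcontM => //; exact: rcont_cst.
  - move=> j t tt; rewrite /v !cabsM cabs_nat cabsX !cabsM cabs_real cabs_ce mulr1 (ger0_norm s0).
    apply: ler_pM; rewrite ?cabs_ge0 ?HM//.
      by rewrite mulr_ge0// mulr_ge0// exprn_ge0// mulr_ge0 ?cabs_ge0.
    by rewrite ler_piMl ?(ltW s1)// mulr_ge0// exprn_ge0// mulr_ge0 ?cabs_ge0.
  - move=> t tt; apply: csumZ; apply: csumZ; apply: csum_binomial.
    by rewrite !cabsM cabs_real cabs_ce mulr1 ger0_norm//; case/andP: sw.
have := csumZ ((tpi^-1)%:C)%C S; apply: eq_csum => j.
rewrite (@eq_cint _ 0 tpi (v j) (fun t => (s%:C)%C ^+ j.+1 * ('C(N + j, j)%:R * w ^+ j) *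
   (f (pt p t) * ce (- t) ^+ j.+1))); last first.
  by move=> t _; rewrite /v !exprMn !exprS; ring.
rewrite cintZ; last by move=> t _; apply: rcontM => //; apply: rcontX; exact: rcont_ceN.
have := aE p p01 j.+1; rewrite /taylor_coef => E.
by rewrite mulrCA E real_cpxM exprMn; ring.
Qed.

Variables (n : nat) (w : C).
Hypothesis w1 : cabs w < 1.
Local Notation N := n.+2.

Definition level_int (m : nat) : C := cint (1 - dy m) (1 - dy m.+1) (fun s => (1 - (s%:C)%C) ^+ n *
    (((tpi^-1)%:C)%C * cint 0 tpi (fun t => f (pt (1 - dy m.+2) t) *
       ((((kernel_radius m s)%:C)%C * ce (- t)) * (1 - ((kernel_radius m s)%:C)%C * ce (- t) * w) ^- N.+1)))).

(** The binomial coefficient of the kernel cancels the beta integral up to j + 1, the factor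
    produced by differentiation. This fixes the constant N! / n!. *)
Lemma beta_binomial (j : nat) : 'C(N + j, j)%:R * ((j.+1`! * n`!)%:R / ((j.+1 + n).+1)`!%:R) =
  n`!%:R / N`!%:R * j.+1%:R :> C.
Proof.
have nz k : k`!%:R != 0 :> C by rewrite pnatr_eq0 -lt0n fact_gt0.
have -> : ((j.+1 + n).+1 = N + j)%N by rewrite addSn addnC.
have := @bin_fact (N + j) j (leq_addl _ _); rewrite addnK => <-.
have c0 : 'C(N + j, j)%:R != 0 :> C by rewrite pnatr_eq0 -lt0n bin_gt0 leq_addl.
have f1 := nz j; have f2 := nz n.
rewrite [j.+1`!]factS !natrM.
by field; rewrite -(natrD _ 1) -(natrD _ 2) !pnatr_eq0 !add1n add2n -!lt0n !fact_gt0 bin_gt0 leq_addl.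
Qed.

Lemma reproducing_formula :
  csum (fun m => (N`!%:R / n`!%:R) * level_int m) (cderiv f w).
Proof.
have [a [ra _ sd aE]] := holo_series hf.
have w01 : 0 <= cabs w < 1 by rewrite cabs_ge0.
pose u j (s : R) := (1 - (s%:C)%C) ^+ n * (a j.+1 * (s%:C)%C ^+ j.+1 * ('C(N + j, j)%:R * w ^+ j)).
have sb := rad1_summable N (rad1_shift ra) w01.
have pb j (s : R) : 0 <= s <= 1 -> cabs (a j.+1 * (s%:C)%C ^+ j.+1 * ('C(N + j, j)%:R * w ^+ j)) <=
    'C(N + j, j)%:R * (cabs (a j.+1) * cabs w ^+ j).
  move=> /andP[s0 s1]; rewrite !cabsM !cabsX cabs_real cabs_nat ger0_norm//.
  rewrite -mulrA [X in _ <= X]mulrCA; apply: ler_wpM2l; first exact: cabs_ge0.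
  by rewrite ler_piMl ?exprn_ile1// mulr_ge0// exprn_ge0// cabs_ge0.
have /choice[P HP] : forall s : R, exists S : C, 0 <= s <= 1 ->
    csum (fun j => a j.+1 * (s%:C)%C ^+ j.+1 * ('C(N + j, j)%:R * w ^+ j)) S.
  move=> s; case: (boolP (0 <= s <= 1)) => s01; last by exists 0.
  by have [S HS] := csum_exists sb (fun j => pb j s s01); exists S.
have cu j : cont_on 0 1 (u j).
  move=> t _; apply: rcontM.
    by apply: rcontX; apply: rcontB; [exact: rcont_cst|exact: rcont_id].
  apply: rcontM; last exact: rcont_cst.
  by apply: rcontM; [exact: rcont_cst|apply: rcontX; exact: rcont_id].
have ub j s : 0 <= s <= 1 -> cabs (u j s) <= 'C(N + j, j)%:R * (cabs (a j.+1) * cabs w ^+ j).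
  move=> s01; have /andP[s0 s1] := s01; apply: le_trans (pb j s s01).
  rewrite /u [X in X <= _]cabsM ler_piMl ?cabs_ge0// cabsX -real_cpxB cabs_real ger0_norm; last lra.
  by apply: exprn_ile1; lra.
have su s : 0 <= s <= 1 -> csum (fun j => u j s) ((1 - (s%:C)%C) ^+ n * P s).
  by move=> s01; apply: csumZ; exact: HP.
(* The integrand is defined through the power series, which converges even at s = 1 because |w| < 1;
   circle averages are identified with it only level by level. *)
pose h s := (1 - ((clamp 0 1 s)%:C)%C) ^+ n * P (clamp 0 1 s).
have ch : cont_on 0 1 h := csum_rcont_clamp ler01 sb cu ub su.
have hE s : 0 <= s <= 1 -> h s = (1 - (s%:C)%C) ^+ n * P s by move=> s01; rewrite /h clamp_id.
have I : cint 0 1 h = n`!%:R / N`!%:R * cderiv f w.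
  rewrite (@eq_cint _ _ _ _ _ hE).
  apply: csum_unique (csum_cint_uniform ler01 sb cu ub su) _.
  have := csumZ (n`!%:R / N`!%:R) (sd w w1); apply: eq_csum => j.
  rewrite (@eq_cint _ 0 1 (u j) (fun s => (a j.+1 * ('C(N + j, j)%:R * w ^+ j)) *
     ((1 - (s%:C)%C) ^+ n * (s%:C)%C ^+ j.+1))); last by move=> s _; rewrite /u; ring.
  rewrite cintZ; last exact: cont_beta.
  rewrite beta_int.
  have -> : a j.+1 * ('C(N + j, j)%:R * w ^+ j) * ((j.+1`! * n`!)%:R / (j.+1 + n).+1`!%:R) =
    a j.+1 * w ^+ j * ('C(N + j, j)%:R * ((j.+1`! * n`!)%:R / (j.+1 + n).+1`!%:R)) by ring.
  by rewrite beta_binomial; ring.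
have nz k : k`!%:R != 0 :> C by rewrite pnatr_eq0 -lt0n fact_gt0.
have -> : cderiv f w = N`!%:R / n`!%:R * cint 0 1 h.
  by rewrite I mulrA mulrA divfK// divff ?mul1r.
apply: csumZ; apply: eq_csum (csum_cint_dyadic ch) => m.
have d0 := dy_gt0 R m; have d1 := dy_le1 R m.
have e1 := dyS R m; have e2 := dyS R m.+1.
apply: eq_cint => s ss; have /andP[s1 s2] := ss.
have s01 : 0 <= s <= 1 by apply/andP; split; lra.
rewrite hE//; congr (_ * _).
apply: csum_unique (HP s s01) _.
have /andP[x1 x2] := sg_bounds ss.
have p01 : 0 < 1 - dy m.+2 < 1 by apply/andP; split; lra.
have x01 : 0 <= kernel_radius m s < 1 by apply/andP; split; lra.
have := circle_kernel N aE p01 x01 (ltW w1).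
by rewrite /kernel_radius mulrC divfK// gt_eqF//; lra.
Qed.

End Reproducing.

(** * Cell functionals *)

Lemma taylor_term (F : fieldType) (A D w b : F) M k :
  A ^- M * (b * (D * w / A) ^+ k) = b * w ^+ k * A ^- (M + k) * D ^+ k.
Proof. by rewrite exprD invfM !exprMn exprVn; ring. Qed.

Section CellFunctionals.
Variable R : realType.
Local Notation C := R[i].
Local Notation dy := (dyadic R).
Local Notation gap := (gap R).
Local Notation cell_centre := (cell_centre R).
Local Notation q := (ratio R).
Local Notation tpi := (2 * pi : R).
Local Notation pt r t := ((r%:C)%C * ce t).
Variable n : nat.
Local Notation N := n.+2.
Local Notation kap := (N`!%:R / n`!%:R).

(** Conjugate of the kernel's parameter, hence the minus sign; its radius differs from the one at
    which [f] is evaluated. *)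
Definition kernel_point (m : nat) (s t : R) : C := ((kernel_radius m s)%:C)%C * ce (- t).

Definition arc (m j : nat) : R := tpi * dy m * j%:R.

Definition arc_int m j k (f : C -> C) (s : R) : C := cint (arc m j) (arc m j.+1)
  (fun t => f (pt (1 - dy m.+2) t) * (kernel_point m s t * (kernel_point m s t - ((cell_centre m j)^*)%C) ^+ k)).

Definition cell_fun m j k (f : C -> C) : C := kap * ((tpi^-1)%:C)%C *
  cint (1 - dy m) (1 - dy m.+1) (fun s => (1 - (s%:C)%C) ^+ n * arc_int m j k f s).

(** The k-th Taylor coefficient of x -> (1 - x w)^-(N+1) at the conjugate of the cell centre. *)
Definition cell_ker m j k (w : C) : C :=
  'C(N + k, k)%:R * w ^+ k * (1 - ((cell_centre m j)^*)%C * w) ^- (N.+1 + k).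

Lemma arc_le m j : arc m j <= arc m j.+1.
Proof. by apply: ler_wpM2l; [rewrite mulr_ge0 ?tpi_ge0 ?dy_ge0|rewrite ler_nat]. Qed.

Lemma arc_len m j : arc m j.+1 - arc m j = tpi * dy m.
Proof. by rewrite -mulrBr -[j.+1%:R]natr1 addrAC subrr add0r mulr1. Qed.

Lemma lev_le m : 1 - dy m <= 1 - dy m.+1.
Proof. by have := dyS R m; have := dy_gt0 R m.+1; lra. Qed.

Lemma rho01 m : 0 <= 1 - dy m.+2 < 1. Proof. exact: dy_rad. Qed.

Lemma rcont_zb m s t : rcont (fun t => kernel_point m s t) t.
Proof. by apply: rcontM; [exact: rcont_cst|exact: rcont_ceN]. Qed.

Lemma zb_le1 m s t : 1 - dy m <= s <= 1 - dy m.+1 -> cabs (kernel_point m s t) <= 1.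
Proof.
move=> /sg_bounds/andP[h1 h2]; have := dy_le1 R m; have := dy_gt0 R m.+2 => d2 d1.
by rewrite cabs_pt ger0_norm; lra.
Qed.

Section Holo.
Variable f : C -> C.
Hypothesis hf : holo f.

Lemma rcont_arc m j k s t : rcont (fun t => f (pt (1 - dy m.+2) t) * (kernel_point m s t * (kernel_point m s t - ((cell_centre m j)^*)%C) ^+ k)) t.
Proof.
apply: rcontM; first by apply: holo_arc => //; exact: rho01.
apply: rcontM; first exact: rcont_zb.
by apply: rcontX; apply: rcontB; [exact: rcont_zb|exact: rcont_cst].
Qed.

Lemma rcont_arc_int m j k s : rcont (arc_int m j k f) s.
Proof.
pose e (t : R) : C := (((1 - dy m.+2)^-1)%:C)%C * ce (- t).
have ce t : rcont e t by apply: rcontM; [exact: rcont_cst|exact: rcont_ceN].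
pose h i t := f (pt (1 - dy m.+2) t) * e t ^+ (k - i).+1.
have ch i t : rcont (h i) t.
  apply: rcontM; first by apply: holo_arc => //; exact: rho01.
  exact: rcontX.
pose c i : C := (- ((cell_centre m j)^*)%C) ^+ i *+ 'C(k, i).
have E : arc_int m j k f = fun s => \sum_(i < k.+1) (c i * (s%:C)%C ^+ (k - i).+1) * cint (arc m j) (arc m j.+1) (h i).
  apply/funext => x.
  transitivity (cint (arc m j) (arc m j.+1) (fun t => \sum_(i < k.+1) (c i * (x%:C)%C ^+ (k - i).+1) * h i t)).
    apply: eq_cint => t _.
    have -> : kernel_point m x t = (x%:C)%C * e t by rewrite /kernel_point /kernel_radius /e real_cpxM mulrA.
    rewrite exprDn mulr_sumr mulr_sumr; apply: eq_bigr => i _.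
    rewrite /c /h; move: (e t) (f _) (x%:C)%C (- ((cell_centre m j)^*)%C) (k - i)%N => u y v d l.
    rewrite -[_ *+ 'C(k, i)]mulr_natr -[d ^+ i *+ _]mulr_natr exprMn (exprS v) (exprS u).
    by move: (_%:R) => b; ring.
  rewrite (@cint_sum _ _ _ _ (fun i t => (c i * (x%:C)%C ^+ (k - i).+1) * h i t)).
    by apply: eq_bigr => i _; rewrite cintZ// => t _; exact: ch.
  by move=> i _ t _; apply: rcontM; [exact: rcont_cst|exact: ch].
rewrite E; apply: (@rcont_sum _ _ (fun i s => (c i * (s%:C)%C ^+ (k - i).+1) * cint (arc m j) (arc m j.+1) (h i))).
move=> i _; apply: rcontM; last exact: rcont_cst.
by apply: rcontM; [exact: rcont_cst|apply: rcontX; exact: rcont_id].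
Qed.

Lemma rcont_level m j k s : rcont (fun s => (1 - (s%:C)%C) ^+ n * arc_int m j k f s) s.
Proof.
apply: rcontM; last exact: rcont_arc_int.
by apply: rcontX; apply: rcontB; [exact: rcont_cst|exact: rcont_id].
Qed.

Section Bounds.
Variables (m : nat) (B : R).
Hypothesis HB : forall t, cabs (f (pt (1 - dy m.+2) t)) <= B.

Lemma circle_bound_ge0 : 0 <= B.
Proof. exact: le_trans (cabs_ge0 _) (HB 0). Qed.

Lemma arc_int_bound j k s : 1 - dy m <= s <= 1 - dy m.+1 ->
  cabs (arc_int m j k f s) <= B * (q * gap m) ^+ k * (tpi * dy m).
Proof.
move=> ss; rewrite -(arc_len m j); apply: cint_norm; first exact: arc_le.
  by move=> t _; exact: rcont_arc.
move=> t tt; rewrite cabsM [cabs (kernel_point _ _ _ * _)]cabsM cabsX; apply: ler_pM; rewrite ?cabs_ge0//.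
  by apply: mulr_ge0; rewrite ?exprn_ge0 ?cabs_ge0.
rewrite -[X in _ <= X]mul1r; apply: ler_pM; rewrite ?exprn_ge0 ?cabs_ge0//.
  exact: zb_le1.
have qg : 0 <= q * gap m by rewrite mulr_ge0 ?(ltW (gap_gt0 R m))//; case/andP: (ratio01 R).
by apply: lerXn2r; rewrite ?nnegrE ?cabs_ge0//; exact: cell_kernel_close.
Qed.

Lemma weight_pow_le s : 1 - dy m <= s <= 1 - dy m.+1 -> cabs ((1 - (s%:C)%C) ^+ n : C) <= dy m ^+ n.
Proof.
move=> /andP[s1 s2]; have d0 := dy_gt0 R m.+1; have d1 := dy_ge0 R m.
by rewrite cabsX -real_cpxB cabs_real ger0_norm; [apply: lerXn2r; rewrite ?nnegrE|]; lra.
Qed.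

(** The power 2^-mN collects 2^-mn from the weight and one factor 2^-m each from the arc length and
    the radial length. *)
Lemma cell_fun_bound j k :
  cabs (cell_fun m j k f) <= kap * dy m ^+ N * B * (q * gap m) ^+ k.
Proof.
have B0 := circle_bound_ge0.
have qg : 0 <= q * gap m by rewrite mulr_ge0 ?(ltW (gap_gt0 R m))//; case/andP: (ratio01 R).
have t0 := @tpi_gt0 R; have d0 := dy_gt0 R m; have d1 := dyS R m.
have X : cabs (cint (1 - dy m) (1 - dy m.+1) (fun s => (1 - (s%:C)%C) ^+ n * arc_int m j k f s)) <=
   dy m ^+ n * (B * (q * gap m) ^+ k * (tpi * dy m)) * dy m.
  apply: (@le_trans _ _ (dy m ^+ n * (B * (q * gap m) ^+ k * (tpi * dy m)) * (1 - dy m.+1 - (1 - dy m)))).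
    apply: cint_norm; first exact: lev_le.
      by move=> s _; exact: rcont_level.
    move=> s ss; rewrite cabsM; apply: ler_pM; rewrite ?cabs_ge0 ?weight_pow_le//.
    exact: arc_int_bound.
  apply: ler_wpM2l; last lra.
  apply: mulr_ge0; first by rewrite exprn_ge0// ltW.
  apply: mulr_ge0; first by apply: mulr_ge0 => //; exact: exprn_ge0.
  by apply: mulr_ge0; exact: ltW.
rewrite /cell_fun [X in X <= _]cabsM !cabsM cabsV !cabs_nat cabs_real ger0_norm ?invr_ge0 ?(ltW t0)//.
have k0 : 0 <= kap / tpi by rewrite divr_ge0 ?(ltW t0)// divr_ge0.
apply: (le_trans (ler_wpM2l k0 X)).
rewrite le_eqVlt; apply/orP; left; apply/eqP.
have -> : dy m ^+ N = dy m ^+ n * dy m * dy m by rewrite !exprSr.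
have tn : tpi != 0 by rewrite gt_eqF.
have -> : kap / tpi * (dy m ^+ n * (B * (q * gap m) ^+ k * (tpi * dy m)) * dy m) =
  kap * (dy m ^+ n * dy m * dy m) * B * (q * gap m) ^+ k * (tpi^-1 * tpi) by ring.
by rewrite mulVf// mulr1.
Qed.

Variable w : C.
Hypothesis w1 : cabs w < 1.

Lemma cell_ker_bound j k : cabs (cell_ker m j k w) <= 'C(N + k, k)%:R * gap m ^- (N.+1 + k).
Proof.
have g0 := gap_gt0 R m.
have h := kern_lb (cell_centre m j) (ltW w1).
have h' : gap m <= cabs (1 - ((cell_centre m j)^*)%C * w).
  by apply: le_trans h; rewrite cabs_cc; lra.
rewrite /cell_ker !cabsM cabs_nat cabsV !cabsX; apply: ler_pM.
- by apply: mulr_ge0; rewrite ?exprn_ge0 ?cabs_ge0.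
- by rewrite invr_ge0 exprn_ge0 ?cabs_ge0.
- by rewrite ler_piMr// exprn_ile1 ?cabs_ge0// ltW.
rewrite lef_pV2 ?posrE ?exprn_gt0 ?(lt_le_trans g0)//.
by apply: lerXn2r; rewrite ?nnegrE ?cabs_ge0// ltW.
Qed.

(** The powers of the gap in the coefficient and in the moment cancel, leaving the cell-independent
    rate q^k. *)
Lemma cell_ker_close j k : cabs (cell_ker m j k w) * (q * gap m) ^+ k <=
  gap m ^- N.+1 * ('C(N + k, k)%:R * q ^+ k).
Proof.
have g0 := gap_gt0 R m; have gn : gap m != 0 by rewrite gt_eqF.
have qg : 0 <= q * gap m by rewrite mulr_ge0 ?(ltW (gap_gt0 R m))//; case/andP: (ratio01 R).
apply: (le_trans (ler_wpM2r (exprn_ge0 k qg) (cell_ker_bound j k))).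
rewrite le_eqVlt; apply/orP; left; apply/eqP.
have gk : gap m ^+ k != 0 by rewrite expf_neq0.
by rewrite exprMn exprD invfM; field; rewrite gk expf_neq0.
Qed.

Lemma kernel_series j s t : 1 - dy m <= s <= 1 - dy m.+1 -> arc m j <= t <= arc m j.+1 ->
  csum (fun k => cell_ker m j k w * (kernel_point m s t - ((cell_centre m j)^*)%C) ^+ k)
    ((1 - kernel_point m s t * w) ^- N.+1).
Proof.
move=> ss tt; set z := kernel_point m s t; set c := ((cell_centre m j)^*)%C.
have g0 := gap_gt0 R m.
have cw : gap m <= cabs (1 - c * w).
  by apply: le_trans (kern_lb (cell_centre m j) (ltW w1)); rewrite cabs_cc; lra.
have nz : 1 - c * w != 0 by rewrite -cabs_gt0 (lt_le_trans g0).
pose x := (z - c) * w / (1 - c * w).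
have x1 : cabs x < 1.
  rewrite /x !cabsM cabsV ltr_pdivrMr ?mul1r ?cabs_gt0//.
  apply: lt_le_trans cw; apply: (@le_lt_trans _ _ (cabs (z - c))).
    by rewrite ler_piMr ?cabs_ge0// ltW.
  apply: le_lt_trans (cell_kernel_close ss tt) _.
  by rewrite -[X in _ < X]mul1r ltr_pM2r//; case/andP: (ratio01 R).
have xE : 1 - x = (1 - z * w) / (1 - c * w) by rewrite /x; field.
have := csumZ ((1 - c * w) ^- N.+1) (csum_binomial N x1).
rewrite xE.
have -> : (1 - c * w) ^- N.+1 * ((1 - z * w) / (1 - c * w)) ^- N.+1 = (1 - z * w) ^- N.+1.
  by rewrite expr_div_n invf_div mulrA mulVf ?mul1r// expf_neq0.
apply: eq_csum => k.
by rewrite /cell_ker -/c /x taylor_term.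
Qed.

Definition arc_ker m j s : C := cint (arc m j) (arc m j.+1)
  (fun t => f (pt (1 - dy m.+2) t) * (kernel_point m s t * (1 - kernel_point m s t * w) ^- N.+1)).

Lemma arc_series j s : 1 - dy m <= s <= 1 - dy m.+1 ->
  csum (fun k => cell_ker m j k w * arc_int m j k f s) (arc_ker m j s).
Proof.
move=> ss; have B0 := circle_bound_ge0; have g0 := gap_gt0 R m.
have cl k : cont_on (arc m j) (arc m j.+1) (fun t => cell_ker m j k w *
    (f (pt (1 - dy m.+2) t) * (kernel_point m s t * (kernel_point m s t - ((cell_centre m j)^*)%C) ^+ k))).
  by move=> t _; apply: rcontM; [exact: rcont_cst|exact: rcont_arc].
have Bg : 0 <= B * gap m ^- N.+1 by rewrite mulr_ge0// invr_ge0 exprn_ge0// ltW.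
have := csum_cint_uniform (arc_le m j) (summableZ Bg (summable_bin_geo N (ratio01 R))) cl.
move=> /(_ (fun t => f (pt (1 - dy m.+2) t) * (kernel_point m s t * (1 - kernel_point m s t * w) ^- N.+1))) H.
have := H _ _; rewrite /arc_ker => /(_ _ _) S; apply: eq_csum (S _ _).
- by move=> k; rewrite cintZ// => t _; exact: rcont_arc.
- move=> k t tt; rewrite cabsM.
  have E1 : cabs (f (pt (1 - dy m.+2) t) * (kernel_point m s t * (kernel_point m s t - ((cell_centre m j)^*)%C) ^+ k)) <= B * (q * gap m) ^+ k.
    rewrite cabsM [cabs (kernel_point _ _ _ * _)]cabsM cabsX; apply: ler_pM; rewrite ?cabs_ge0//.
      by apply: mulr_ge0; rewrite ?exprn_ge0 ?cabs_ge0.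
    rewrite -[X in _ <= X]mul1r; apply: ler_pM; rewrite ?exprn_ge0 ?cabs_ge0//.
      exact: zb_le1.
    have qg : 0 <= q * gap m by rewrite mulr_ge0 ?(ltW (gap_gt0 R m))//; case/andP: (ratio01 R).
    by apply: lerXn2r; rewrite ?nnegrE ?cabs_ge0//; exact: cell_kernel_close.
  apply: (le_trans (ler_wpM2l (cabs_ge0 _) E1)); rewrite mulrCA -mulrA; apply: ler_wpM2l => //.
  exact: cell_ker_close.
- move=> t tt; have := csumZ (f (pt (1 - dy m.+2) t) * kernel_point m s t) (kernel_series ss tt).
  by rewrite mulrA; apply: eq_csum => k; ring.
Qed.

Definition cell_int m j : C := kap * ((tpi^-1)%:C)%C *
  cint (1 - dy m) (1 - dy m.+1) (fun s => (1 - (s%:C)%C) ^+ n * arc_ker m j s).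

Let bd k := dy m ^+ n * (B * (tpi * dy m) * gap m ^- N.+1) * ('C(N + k, k)%:R * q ^+ k).

Let bd_summable : summable bd.
Proof.
apply: summableZ; last exact: summable_bin_geo (ratio01 R).
have g0 := gap_gt0 R m; have B0 := circle_bound_ge0.
by rewrite mulr_ge0 ?exprn_ge0 ?dy_ge0// mulr_ge0 ?invr_ge0 ?exprn_ge0 ?(ltW g0)//
  mulr_ge0// mulr_ge0 ?tpi_ge0 ?dy_ge0.
Qed.

Let lev_cont j k : cont_on (1 - dy m) (1 - dy m.+1)
  (fun s => cell_ker m j k w * ((1 - (s%:C)%C) ^+ n * arc_int m j k f s)).
Proof. by move=> s _; apply: rcontM; [exact: rcont_cst|exact: rcont_level]. Qed.

Let lev_bound j k s : 1 - dy m <= s <= 1 - dy m.+1 ->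
  cabs (cell_ker m j k w * ((1 - (s%:C)%C) ^+ n * arc_int m j k f s)) <= bd k.
Proof.
move=> ss; rewrite cabsM [cabs (_ ^+ n * _)]cabsM mulrCA /bd -mulrA; have B0 := circle_bound_ge0.
apply: ler_pM; rewrite ?cabs_ge0 ?weight_pow_le//; first by apply: mulr_ge0; rewrite ?cabs_ge0.
apply: (le_trans (ler_wpM2l (cabs_ge0 _) (arc_int_bound j k ss))).
have -> : cabs (cell_ker m j k w) * (B * (q * gap m) ^+ k * (tpi * dy m)) =
  B * (tpi * dy m) * (cabs (cell_ker m j k w) * (q * gap m) ^+ k) by ring.
rewrite -[X in _ <= X]mulrA; apply: ler_wpM2l; last exact: cell_ker_close.
by rewrite mulr_ge0// mulr_ge0 ?tpi_ge0 ?dy_ge0.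
Qed.

Let lev_series j s : 1 - dy m <= s <= 1 - dy m.+1 ->
  csum (fun k => cell_ker m j k w * ((1 - (s%:C)%C) ^+ n * arc_int m j k f s))
    ((1 - (s%:C)%C) ^+ n * arc_ker m j s).
Proof.
move=> ss; have := csumZ ((1 - (s%:C)%C) ^+ n) (arc_series j ss).
by apply: eq_csum => k; rewrite mulrCA.
Qed.

Lemma cell_series j : csum (fun k => cell_fun m j k f * cell_ker m j k w) (cell_int m j).
Proof.
have S := csum_cint_uniform (lev_le m) bd_summable (lev_cont j) (lev_bound j) (lev_series j).
have := csumZ (kap * ((tpi^-1)%:C)%C) S; apply: eq_csum => k.
rewrite cintZ; first by rewrite /cell_fun; ring.
by move=> s _; exact: rcont_level.
Qed.

(** The arcs of the cells of one level tile the circle, since [arc m (2 ^ m)] is 2 pi. *)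
Lemma level_sum : kap * level_int f n w m = \sum_(j < 2 ^ m) cell_int m j.
Proof.
pose h j s := (1 - ((clamp (1 - dy m) (1 - dy m.+1) s)%:C)%C) ^+ n * arc_ker m j (clamp (1 - dy m) (1 - dy m.+1) s).
have ch j : cont_on (1 - dy m) (1 - dy m.+1) (h j) :=
  csum_rcont_clamp (lev_le m) bd_summable (lev_cont j) (lev_bound j) (lev_series j).
have hE j s : 1 - dy m <= s <= 1 - dy m.+1 -> h j s = (1 - (s%:C)%C) ^+ n * arc_ker m j s.
  by move=> ss; rewrite /h clamp_id.
have -> : level_int f n w m = \sum_(j < 2 ^ m) ((tpi^-1)%:C)%C * cint (1 - dy m) (1 - dy m.+1) (h j).
  transitivity (cint (1 - dy m) (1 - dy m.+1) (fun s => \sum_(j < 2 ^ m) ((tpi^-1)%:C)%C * h j s)); last first.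
    rewrite (@cint_sum _ _ _ _ (fun j s => ((tpi^-1)%:C)%C * h j s)).
      by apply: eq_bigr => j _; rewrite cintZ.
    by move=> j _ s ss; apply: rcontM; [exact: rcont_cst|exact: ch].
  apply: eq_cint => s ss.
  transitivity (((tpi^-1)%:C)%C * ((1 - (s%:C)%C) ^+ n * \sum_(j < 2 ^ m) arc_ker m j s)); last first.
    by rewrite !mulr_sumr; apply: eq_bigr => j _; rewrite hE.
  rewrite mulrCA; congr (_ * (_ * _)).
  rewrite /arc_ker (@cint_telescope _ (arc m)); last 2 first.
  - by move=> i; exact: arc_le.
  - move=> t _; apply: rcont_circle_kernel => //; [exact: rho01| |exact: ltW].
    have /andP[h1 h2] := sg_bounds ss.
    by have := dy_gt0 R m.+2; have := dy_le1 R m => d1 d2; apply/andP; split; lra.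
  by rewrite /arc mulr0 natrX -mulrA dy_mul2 mulr1.
by rewrite mulr_sumr; apply: eq_bigr => j _; rewrite (eq_cint (hE j)) mulrA.
Qed.

End Bounds.
End Holo.

Lemma cell_fun_lin m j k (a : C) f g : holo f -> holo g ->
  cell_fun m j k (fun z => a * f z + g z) = a * cell_fun m j k f + cell_fun m j k g.
Proof.
move=> hf hg.
have E s : arc_int m j k (fun z => a * f z + g z) s = a * arc_int m j k f s + arc_int m j k g s.
  rewrite /arc_int -cintZ; last by move=> t _; exact: rcont_arc.
  rewrite -cintD.
  - by apply: eq_cint => t _; ring.
  - by move=> t _; apply: rcontM; [exact: rcont_cst|exact: rcont_arc].
  - by move=> t _; exact: rcont_arc.
rewrite /cell_fun [a * _]mulrCA -mulrDr -(cintZ a); last by move=> s _; exact: rcont_level.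
rewrite -cintD.
- by congr (_ * _); apply: eq_cint => s _; rewrite E; ring.
- by move=> s _; apply: rcontM; [exact: rcont_cst|exact: rcont_level].
- by move=> s _; exact: rcont_level.
Qed.

End CellFunctionals.

(** * The nuclear representation *)

Section NuclearRepresentation.
Variable R : realType.
Local Notation C := R[i].
Local Notation dy := (dyadic R).
Local Notation gap := (gap R).
Local Notation cell_centre := (cell_centre R).
Local Notation q := (ratio R).
Local Notation pt r t := ((r%:C)%C * ce t).
Variables (nu mu : C -> R) (g phi : C -> C) (Mg C1 B Q : R) (n : nat).
Hypothesis hnu : normal_weight nu.
Hypothesis hmu : normal_weight mu.
Hypothesis hg : holo g.
Hypothesis hphi : holo phi.
Hypothesis sphi : forall z, cabs z < 1 -> cabs (phi z) < 1.
Hypothesis HMg : forall z, disc R z -> mu z * cabs (g z) <= Mg.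
Hypothesis C10 : 0 < C1.
Hypothesis B0 : 0 < B.
Local Notation dyadic_weight := (dyadic_weight nu).
Hypothesis W1 : forall m i, dyadic_weight m <= C1 * B ^+ i * dyadic_weight (m + i).
Local Notation N := n.+2.
Local Notation J := (kernel_sup mu g phi N.+1).
Local Notation lam m := (dy m ^+ N / dyadic_weight m).
Local Notation kap := (N`!%:R / n`!%:R : R).
Hypothesis HQ : forall M, \sum_(m < M) lam m * \sum_(j < 2 ^ m) J (cell_centre m j) <= Q.
Variables (e : nat -> nat * nat) (e' : nat * nat -> nat).
Hypotheses (eK : cancel e e') (e'K : cancel e' e).

(** Both sides vanish outside the disc; inside, their difference has derivative 0 and vanishes at
    0. *)
Lemma Sop_linear (a : C) f h : HD R f -> HD R h ->
  Sop g phi (a *: f + h) = a *: Sop g phi f + Sop g phi h.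
Proof.
move=> Hf Hh; have Hl := HD_lin a Hf Hh.
have [hS S0 dS] := Sop_spec hg hphi sphi (HD_holo Hl).
have [hF F0 dF] := Sop_spec hg hphi sphi (HD_holo Hf).
have [hH H0 dH] := Sop_spec hg hphi sphi (HD_holo Hh).
apply/funext => z.
have [z1|nz] := ltP (cabs z) 1; last first.
  have nd : ~ disc R z by rewrite /disc/= => h1; move: nz; rewrite leNgt h1.
  case: hS => _ ->//; case: (HD_lin a hF hH) => _ ->//.
pose D w := Sop g phi (a *: f + h) w - (a * Sop g phi f w + Sop g phi h w).
have dD w : cabs w < 1 -> cdiff D w 0.
  move=> w1.
  have c1 := holo_cdiff (HD_holo hS) w1; rewrite (dS w w1) in c1.
  have c2 := holo_cdiff (HD_holo hF) w1; rewrite (dF w w1) in c2.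
  have c3 := holo_cdiff (HD_holo hH) w1; rewrite (dH w w1) in c3.
  have := cdiffB c1 (cdiffD (cdiffZ a c2) c3).
  have -> : cderiv (a *: f + h) (phi w) = a * cderiv f (phi w) + cderiv h (phi w).
    by apply: cderivE; apply: cdiffD (cdiffZ a _) _; apply: holo_cdiff; rewrite ?sphi//; exact: HD_holo.
  by rewrite mulrDl mulrA subrr.
have h0 : holo (fun _ : C => 0 : C) by move=> w _; exists 0; exact: cdiff_cst.
have := radial_integral h0 z1 dD.
rewrite cintegral01E (@eq_cint _ _ _ _ (fun=> 0)) ?cint0; last by move=> t _; rewrite mul0r.
have -> : D 0 = 0 by rewrite /D S0 F0 H0 mulr0 addr0 subrr.
by rewrite subr0 => /esym/eqP; rewrite subr_eq0 => /eqP.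
Qed.

Lemma holo_cell_ker m j k : holo (cell_ker n m j k : C -> C).
Proof.
apply: (holoM (f := fun w => 'C(N + k, k)%:R * w ^+ k)).
  by move=> w w1; eexists; apply: cdiffZ; exact: cdiffX.
exact: holo_kern (cc_lt1 R m j).
Qed.

(** The operator applied to a primitive of the k-th kernel coefficient has the required
    derivative. *)
Lemma cell_vectors : exists y : nat -> nat -> nat -> C -> C, forall m j k,
  [/\ HD R (y m j k), y m j k 0 = 0 &
      forall z, cabs z < 1 -> cderiv (y m j k) z = cell_ker n m j k (phi z) * g z].
Proof.
have ex m j k : exists y, [/\ HD R y, y 0 = 0 &
    forall z, cabs z < 1 -> cderiv y z = cell_ker n m j k (phi z) * g z].
  have [H _ dH] := holo_primitive (@holo_cell_ker m j k).
  have hH : holo H by move=> z z1; eexists; exact: dH.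
  have [hS S0 dS] := Sop_spec hg hphi sphi hH.
  exists (Sop g phi H); split=> // z z1; rewrite dS//; congr (_ * _).
  by apply: cderivE; apply: dH; exact: sphi.
have [y hy] := choice (fun p : nat * nat * nat => ex p.1.1 p.1.2 p.2).
by exists (fun m j k => y (m, j, k)) => m j k; exact: (hy (m, j, k)).
Qed.

(* Pairs [(m, j)] with [2 ^ m <= j] label no cell and contribute 0. *)
Definition cellX p k (f : C -> C) : C :=
  if ((e p).2 < 2 ^ (e p).1)%N then cell_fun n (e p).1 (e p).2 k f else 0.

(** The weight is taken at level m + 2 because the functional evaluates [f] on the circle of radius
    1 - 2^-(m+2). *)
Definition boundX p k : R :=
  if ((e p).2 < 2 ^ (e p).1)%N then kap * dy (e p).1 ^+ N / dyadic_weight (e p).1.+2 * (q * gap (e p).1) ^+ k else 0.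

Definition boundY p k : R := 'C(N + k, k)%:R * gap (e p).1 ^- k * J (cell_centre (e p).1 (e p).2).

Definition cellW m j : R :=
  if (j < 2 ^ m)%N then kap * (C1 * B ^+ 2) * lam m * J (cell_centre m j) else 0.

Definition boundXY p k : R := cellW (e p).1 (e p).2 * ('C(N + k, k)%:R * q ^+ k).

Let J0 m j : 0 <= J (cell_centre m j).
Proof. exact: (Jf_ge0 hmu sphi HMg _ (cc_lt1 R m j)). Qed.

Let vm0 m : 0 < dyadic_weight m. Proof. exact: vm_gt0. Qed.

Let kap0 : 0 <= kap. Proof. by rewrite divr_ge0. Qed.

Let qg0 m : 0 <= q * gap m.
Proof. by rewrite mulr_ge0 ?(ltW (gap_gt0 R m))//; case/andP: (ratio01 R). Qed.

Let K00 : 0 <= kap * (C1 * B ^+ 2).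
Proof. by rewrite mulr_ge0// mulr_ge0 ?exprn_ge0// ltW. Qed.

Lemma cellW_ge0 m j : 0 <= cellW m j.
Proof.
rewrite /cellW; case: ifP => // _; apply: mulr_ge0 => //; apply: mulr_ge0 => //.
by rewrite divr_ge0 ?exprn_ge0 ?dy_ge0// ltW.
Qed.

Let bin_q_ge0 k : 0 <= 'C(N + k, k)%:R * q ^+ k.
Proof. by rewrite mulr_ge0// exprn_ge0//; case/andP: (ratio01 R). Qed.

Lemma boundXY_ge0 p k : 0 <= boundXY p k.
Proof. by rewrite /boundXY mulr_ge0// cellW_ge0. Qed.

(** The gaps cancel, and [W1] over two steps replaces the weight at level m + 2 by the one at level
    m. *)
Lemma bound_mul p k : boundX p k * boundY p k <= boundXY p k.
Proof.
rewrite /boundX /boundY /boundXY /cellW; case: ifP => _; last by rewrite !mul0r.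
move: (e p).1 (e p).2 => m j.
have g0 : gap m != 0 by rewrite gt_eqF// gap_gt0.
have v : (dyadic_weight m.+2)^-1 <= C1 * B ^+ 2 / dyadic_weight m.
  rewrite -[X in X <= _]mul1r ler_pdivrMr// mulrAC ler_pdivlMr// mul1r.
  by have := W1 m 2; rewrite addn2.
have gg : gap m ^+ k * gap m ^- k = 1 by rewrite mulfV// expf_neq0.
have -> : kap * dy m ^+ N / dyadic_weight m.+2 * (q * gap m) ^+ k * ('C(N + k, k)%:R * gap m ^- k * J (cell_centre m j)) =
  kap * dy m ^+ N * J (cell_centre m j) * ('C(N + k, k)%:R * q ^+ k) * (dyadic_weight m.+2)^-1 * (gap m ^+ k * gap m ^- k).
  by rewrite exprMn; ring.
have -> : kap * (C1 * B ^+ 2) * lam m * J (cell_centre m j) * ('C(N + k, k)%:R * q ^+ k) =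
  kap * dy m ^+ N * J (cell_centre m j) * ('C(N + k, k)%:R * q ^+ k) * (C1 * B ^+ 2 / dyadic_weight m) by ring.
rewrite gg mulr1; apply: ler_wpM2l => //; apply: mulr_ge0 => //; apply: mulr_ge0 => //.
by apply: mulr_ge0 => //; rewrite exprn_ge0// dy_ge0.
Qed.

Lemma cellW_sum M L : \sum_(m < M) \sum_(j < L) cellW m j <= kap * (C1 * B ^+ 2) * Q.
Proof.
apply: le_trans (ler_wpM2l K00 (HQ M)); rewrite mulr_sumr; apply: ler_sum => m _.
apply: (@le_trans _ _ (\sum_(j < maxn L (2 ^ m)) cellW m j)).
  rewrite (big_ord_widen _ (fun j => cellW m j) (leq_maxl L (2 ^ m))) big_mkcond/=.
  by apply: ler_sum => j _; case: ifP => // _; exact: cellW_ge0.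
rewrite !mulr_sumr (big_ord_widen _ (fun j => kap * (C1 * B ^+ 2) * (lam m * J (cell_centre m j))) (leq_maxr L (2 ^ m))).
rewrite [X in _ <= X]big_mkcond/=; apply: ler_sum => j _; rewrite /cellW.
by case: ifP => // _; rewrite -mulrA.
Qed.

Lemma boundXY_sum : exists Q' : R, forall P K, \sum_(p < P) \sum_(k < K) boundXY p k <= Q'.
Proof.
have [_ [Q1 HQ1]] := double_summable eK e'K cellW_ge0 cellW_sum.
have [_ [Q2 HQ2]] := summable_bin_geo N (ratio01 R).
exists (Q1 * Q2) => P K.
have Q20 : 0 <= Q2 by have := HQ2 0%N; rewrite big_ord0.
apply: (@le_trans _ _ (\sum_(p < P) cellW (e p).1 (e p).2 * Q2)).
  apply: ler_sum => p _; rewrite -mulr_sumr; apply: ler_wpM2l; first exact: cellW_ge0.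
  exact: HQ2.
by rewrite -mulr_suml; apply: ler_wpM2r => //; exact: HQ1.
Qed.

Lemma circle_bound f (M : R) m : (forall z, disc R z -> nu z * cabs (f z) <= M) ->
  forall t, cabs (f (pt (1 - dy m.+2) t)) <= M / dyadic_weight m.+2.
Proof.
move=> HM t; have /andP[r0 r1] := dy_rad R m.+2.
have z1 : disc R (pt (1 - dy m.+2) t) by rewrite /disc/= cabs_pt ger0_norm.
by have := HM _ z1; rewrite (weight_vr hnu z1) cabs_pt ger0_norm// mulrC ler_pdivlMr.
Qed.

Lemma cellX_bound p k f (M : R) : HD R f -> (forall z, disc R z -> nu z * cabs (f z) <= M) ->
  cabs (cellX p k f) <= boundX p k * M.
Proof.
move=> Hf HM; rewrite /cellX /boundX; case: ifP => _; last by rewrite cabs0 mul0r.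
apply: (le_trans (cell_fun_bound n (HD_holo Hf) (circle_bound _ HM) _ _)).
by rewrite le_eqVlt; apply/orP; left; apply/eqP; ring.
Qed.

Lemma cellX_lin p k (a : C) f h : HD R f -> HD R h ->
  cellX p k (fun z => a * f z + h z) = a * cellX p k f + cellX p k h.
Proof.
move=> Hf Hh; rewrite /cellX; case: (_ < _)%N; last by rewrite mulr0 addr0.
exact: cell_fun_lin (HD_holo Hf) (HD_holo Hh).
Qed.

Lemma cellX_dual p k : dual (Hinf nu) (cellX p k) /\ (dual_norm (Hinf nu) (cellX p k) <= (boundX p k)%:E)%E.
Proof.
have le : (dual_norm (Hinf nu) (cellX p k) <= (boundX p k)%:E)%E.
  apply: ge_ereal_sup => _ [f [[Hf _] nf] <-]; rewrite lee_fin -[X in _ <= X]mulr1.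
  apply: cellX_bound => // z z1; rewrite -lee_fin; apply: le_trans nf; exact: sup_norm_ub.
split=> //; split; last exact: le_lt_trans le (ltry _).
by move=> a f h [Hf _] [Hh _]; exact: (cellX_lin p k a Hf Hh).
Qed.

(** Of the N + 1 + k kernel factors, k are bounded by the gap and N + 1 are left to the kernel
    supremum. *)
Lemma cell_ker_weight p k z : disc R z ->
  mu z * cabs (cell_ker n (e p).1 (e p).2 k (phi z) * g z) <= boundY p k.
Proof.
move=> z1; rewrite /boundY; move: (e p).1 (e p).2 => m j.
have w1 := sphi z1; have g0 := gap_gt0 R m.
have mz := weight_gt0 hmu z1.
set Z := cabs (1 - ((cell_centre m j)^*)%C * phi z).
have gZ : gap m <= Z.
  by apply: le_trans (kern_lb (cell_centre m j) (ltW w1)); rewrite cabs_cc; lra.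
have Z0 : 0 < Z by exact: lt_le_trans gZ.
have E : cabs (cell_ker n m j k (phi z) * g z) =
   'C(N + k, k)%:R * cabs (phi z) ^+ k * (Z ^- N.+1 * Z ^- k) * cabs (g z).
  by rewrite !cabsM cabs_nat cabsV !cabsX -invfM -exprD.
rewrite E.
have -> : mu z * ('C(N + k, k)%:R * cabs (phi z) ^+ k * (Z ^- N.+1 * Z ^- k) * cabs (g z)) =
   'C(N + k, k)%:R * (cabs (phi z) ^+ k * Z ^- k) * (mu z * cabs (g z) * Z ^- N.+1) by ring.
apply: ler_pM.
- by apply: mulr_ge0 => //; apply: mulr_ge0; rewrite ?invr_ge0 exprn_ge0 ?cabs_ge0// ltW.
- apply: mulr_ge0; first by apply: mulr_ge0; rewrite ?cabs_ge0// ltW.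
  by rewrite invr_ge0 exprn_ge0// ltW.
- apply: ler_wpM2l => //; rewrite -[X in _ <= X]mul1r; apply: ler_pM.
  + by rewrite exprn_ge0 ?cabs_ge0.
  + by rewrite invr_ge0 exprn_ge0// ltW.
  + by rewrite exprn_ile1 ?cabs_ge0// ltW.
  + by rewrite lef_pV2 ?posrE ?exprn_gt0//; apply: lerXn2r; rewrite ?nnegrE// ltW.
- exact: (Jf_ub hmu sphi HMg _ (cc_lt1 R m j) z1).
Qed.

Lemma csum_finite (F : nat -> C) L : csum (fun j => if (j < L)%N then F j else 0) (\sum_(j < L) F j).
Proof.
move=> eps eps0; exists L => m Lm.
by rewrite (big_ord_widen _ F Lm) [in X in _ - X]big_mkcond/= subrr cabs0 ltW.
Qed.

Lemma csumMr (u : nat -> C) s (c : C) : csum u s -> csum (fun k => u k * c) (s * c).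
Proof. by move=> /(csumZ c); rewrite mulrC; apply: eq_csum => k; rewrite mulrC. Qed.

Lemma csum0 : csum (fun=> 0 : C) 0.
Proof. by move=> eps eps0; exists 0%N => L _; rewrite big1 ?subrr ?cabs0 ?ltW. Qed.

Section Pointwise.
Variables (f : C -> C) (M : R) (z : C).
Hypothesis Hf : HD R f.
Hypothesis HM : forall z, disc R z -> nu z * cabs (f z) <= M.
Hypothesis z1 : cabs z < 1.
Local Notation w := (phi z).

Definition term p k : C := cellX p k f * (cell_ker n (e p).1 (e p).2 k w * g z).

Let M0 : 0 <= M.
Proof.
by apply: le_trans (HM (@disc0 R)); rewrite mulr_ge0 ?cabs_ge0// ltW//;
  apply: (weight_gt0 hnu); exact: disc0.
Qed.

Lemma term_bound p k : cabs (term p k) <= M / mu z * boundXY p k.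
Proof.
have mz := weight_gt0 hmu z1.
rewrite mulrAC ler_pdivlMr// /term cabsM -mulrA [_ * mu z]mulrC.
apply: (@le_trans _ _ (boundX p k * M * boundY p k)).
  apply: ler_pM; rewrite ?cabs_ge0 ?cellX_bound ?cell_ker_weight//.
  by rewrite mulr_ge0 ?cabs_ge0// ltW.
by rewrite mulrAC [X in _ <= X]mulrC; apply: ler_wpM2r => //; exact: bound_mul.
Qed.

(** Two regroupings by [double_csum]: the cell integrals, summed by level, give the reproducing
    formula; the Taylor terms, summed over k, give the cell integrals. *)
Lemma pointwise_series : csum (fun i => term (e i).1 (e i).2) (cderiv f w * g z).
Proof.
have mz := weight_gt0 hmu z1; have w1 := sphi z1.
have c0 : 0 <= M / mu z by rewrite divr_ge0// ltW.
have [Q' HQ'] := boundXY_sum.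
have [_ [Q2 HQ2]] := summable_bin_geo N (ratio01 R).
have Q20 : 0 <= Q2 by have := HQ2 0%N; rewrite big_ord0.
pose r m j := if (j < 2 ^ m)%N then cell_int n f w m j * g z else 0.
have tr p : csum (term p) (r (e p).1 (e p).2).
  rewrite /term /r /cellX; case: (_ < _)%N; last by apply: eq_csum csum0 => k; rewrite mul0r.
  apply: eq_csum (csumMr (g z) (cell_series n (HD_holo Hf) (circle_bound _ HM) w1 (e p).2)) => k.
  by rewrite mulrA.
have rS : csum (fun p => r (e p).1 (e p).2) (cderiv f w * g z).
  have := @double_csum R e e' eK e'K (fun m j => M / mu z * Q2 * cellW m j)
    (M / mu z * Q2 * (kap * (C1 * B ^+ 2) * Q)).
  move=> /(_ _ _ r (fun m => N`!%:R / n`!%:R * level_int f n w m * g z)); apply.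
  - by move=> m j; apply: mulr_ge0; [exact: mulr_ge0|exact: cellW_ge0].
  - move=> P K; under eq_bigr do rewrite -mulr_sumr; rewrite -mulr_sumr.
    by apply: ler_wpM2l (cellW_sum _ _); rewrite mulr_ge0.
  (* A cell integral is bounded through its own Taylor series, whose majorant sums to a multiple of
     [cellW m j]. *)
  - move=> m j; have := csum_le (tr (e' (m, j))); rewrite e'K; apply => L.
    apply: (le_trans (cabs_sum _ _ _)).
    apply: (@le_trans _ _ (\sum_(k < L) M / mu z * boundXY (e' (m, j)) k)).
      by apply: ler_sum => k _; exact: term_bound.
    rewrite -mulr_sumr -[X in _ <= X]mulrA; apply: ler_wpM2l => //.
    rewrite /boundXY e'K/= -mulr_sumr mulrC; apply: ler_wpM2r (HQ2 L); exact: cellW_ge0.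
  - move=> m; rewrite (level_sum n (HD_holo Hf) (circle_bound _ HM) w1).
    apply: eq_csum (csumMr (g z) (csum_finite (cell_int n f w m) (2 ^ m))) => j.
    by rewrite /r; case: (_ < _)%N; rewrite ?mul0r.
  - exact: csumMr (reproducing_formula (HD_holo Hf) n w1).
apply: (@double_csum R e e' eK e'K (fun p k => M / mu z * boundXY p k) (M / mu z * Q') _ _ _ _ _ term_bound tr rS).
- by move=> p k; rewrite mulr_ge0// boundXY_ge0.
- by move=> P K; under eq_bigr do rewrite -mulr_sumr; rewrite -mulr_sumr; apply: ler_wpM2l.
Qed.

End Pointwise.

Lemma cvg_ereal0 (u : nat -> \bar R) : (forall k, (0 <= u k)%E) ->
  (forall eps : R, 0 < eps -> exists K, forall k, (K <= k)%N -> (u k <= eps%:E)%E) ->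
  u k @[k --> \oo] --> 0%E.
Proof.
move=> u0 H; apply/fine_cvgP; split.
  have [K HK] := H 1 ltr01; exists K => // k /HK uk.
  by rewrite ge0_fin_numE// (le_lt_trans uk)// ltry.
apply/(@cvgrPdist_le _ R^o) => eps eps0; have [K HK] := H eps eps0; exists K => // k /HK uk /=.
rewrite sub0r normrN ger0_norm ?fine_ge0// -lee_fin fineK//.
by rewrite ge0_fin_numE// (le_lt_trans uk)// ltry.
Qed.

Lemma discrete_nuclear : (forall f, carrier (Hinf nu) f -> carrier (Bloch mu) (Sop g phi f)) ->
  nuclear (Hinf nu) (Bloch mu) (Sop g phi).
Proof.
move=> mS; split=> //; first by move=> a f h [Hf _] [Hh _]; exact: Sop_linear.
have [y hy] := cell_vectors.
have [Q' HQ'] := boundXY_sum.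
have sXY := double_summable eK e'K boundXY_ge0 HQ'.
(* The index [i] codes a pair (p, k), and [p] in turn codes a pair (m, j). *)
pose Y i := let p := (e i).1 in y (e p).1 (e p).2 (e i).2.
have YH i : HD R (Y i) by case: (hy (e (e i).1).1 (e (e i).1).2 (e i).2).
have Y0 i : Y i 0 = 0 by case: (hy (e (e i).1).1 (e (e i).1).2 (e i).2).
have dY i z : cabs z < 1 -> cderiv (Y i) z = cell_ker n (e (e i).1).1 (e (e i).1).2 (e i).2 (phi z) * g z.
  by case: (hy (e (e i).1).1 (e (e i).1).2 (e i).2) => _ _; apply.
have Yn i : (sup_norm mu (cderiv (Y i)) <= (boundY (e i).1 (e i).2)%:E)%E.
  by apply: sup_norm_le => z z1; rewrite dY//; exact: cell_ker_weight.
have Yn' i : (snorm (Bloch mu) (Y i) <= (boundY (e i).1 (e i).2)%:E)%E.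
  by rewrite /= Y0 cabs0 add0e.
exists (fun i => cellX (e i).1 (e i).2), Y; split.
- by move=> i; case: (cellX_dual (e i).1 (e i).2).
- by move=> i; split=> //; apply: le_lt_trans (Yn i) (ltry _).
- have n0 := dual_norm_ge0 _ (Hzero_Hinf hnu (Hzero0 hnu)) (sup_norm0 nu).
  apply: (@le_lt_trans _ _ (\sum_(0 <= i <oo) (boundXY (e i).1 (e i).2)%:E)%E).
    apply: lee_nneseries => i _.
      by move=> _; apply: mule_ge0; [exact: n0|exact: Bloch_norm_ge0].
    apply: (@le_trans _ _ ((boundX (e i).1 (e i).2)%:E * (boundY (e i).1 (e i).2)%:E)%E).
      apply: lee_pmul => //; [exact: Bloch_norm_ge0|by case: (cellX_dual (e i).1 (e i).2)].
    by rewrite -EFinM lee_fin; exact: bound_mul.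
  have [_ [Q3 HQ3]] := sXY.
  apply: (@le_lt_trans _ _ Q3%:E); last exact: ltry.
  apply: lime_le; first by apply: is_cvg_nneseries => i _ _; rewrite lee_fin; exact: boundXY_ge0.
  by apply: nearW => k; rewrite sumEFin lee_fin big_mkord.
move=> f [Hf /(sup_norm_fin (weight_gt0 hnu))[M M0 [_ HM]]].
apply: cvg_ereal0 => [k|eps eps0]; first exact: Bloch_norm_ge0.
(* [K] does not depend on the point: the factor M / mu z of the pointwise majorant cancels the
   weight of the Bloch norm, and M eps / (M + 1) <= eps. *)
have [K HK] := summable_tail sXY (divr_gt0 eps0 (ltr_wpDl M0 ltr01)).
exists K => k Kk.
have [hS S0 dS] := Sop_spec hg hphi sphi (HD_holo Hf).
set D := Sop g phi f - _.
have D0 : D 0 = 0.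
  rewrite /D /GRing.add/= /GRing.opp/= S0 sum_apply big1 ?oppr0 ?addr0//.
  by move=> i _; rewrite Y0 mulr0.
rewrite /= D0 cabs0 add0e; apply: sup_norm_le => z z1.
have mz := weight_gt0 hmu z1.
have -> : cderiv D z = cderiv f (phi z) * g z - \sum_(i < k) term f z (e i).1 (e i).2.
  apply: cderivE; apply: cdiffB; first by rewrite -dS//; apply: holo_cdiff => //; exact: HD_holo.
  have := cderiv_lin_sum k (fun i => cellX (e i).1 (e i).2 f) YH z1.
  by congr (cdiff _ _ _); apply: eq_bigr => i _; rewrite dY.
have c0 : 0 <= M / mu z by rewrite divr_ge0// ltW.
have tail k1 k2 : (K <= k1)%N ->
    \sum_(k1 <= i < k2) (M / mu z * boundXY (e i).1 (e i).2) <= M / mu z * (eps / (M + 1)).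
  by move=> /HK h; rewrite -mulr_sumr; apply: ler_wpM2l.
have := csum_tail (fun i => term_bound Hf HM z1 (e i).1 (e i).2) (pointwise_series Hf HM z1) tail Kk.
rewrite cabsB => /(ler_wpM2l (ltW mz)) /le_trans; apply.
have mn : mu z != 0 by rewrite gt_eqF.
have M1 : 0 < M + 1 by rewrite ltr_wpDl.
have -> : mu z * (M / mu z * (eps / (M + 1))) = M * eps / (M + 1) by field; rewrite mn gt_eqF.
by rewrite ler_pdivrMr// mulrDr mulr1 [M * _]mulrC lerDl ltW.
Qed.

End NuclearRepresentation.

Section SymbolBound.
Variable R : realType.

(** The image of the identity has derivative g and lies in the Bloch space. *)
Lemma symbol_bound (nu mu : R[i] -> R) (g phi : R[i] -> R[i]) :
  normal_weight nu -> normal_weight mu -> holo g -> holo phi ->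
  (forall z, cabs z < 1 -> cabs (phi z) < 1) ->
  (forall f, carrier (Hinf nu) f -> carrier (Bloch mu) (Sop g phi f)) ->
  exists Mg, forall z, disc R z -> mu z * cabs (g z) <= Mg.
Proof.
move=> hnu hmu hg hphi sphi mS.
have hid : holo (id : R[i] -> R[i]) by move=> z _; exists 1; exact: cdiff_id.
have cf : carrier (Hinf nu) (ext0 id).
  apply: (@Hinf_bounded R nu _ (nu 0)); first exact: HD_ext0.
  move=> z z1; rewrite ext0E// -[X in _ <= X]mulr1; apply: ler_pM.
  - by apply: ltW; apply: (weight_gt0 hnu).
  - exact: cabs_ge0.
  - exact: nu_le0.
  - exact: ltW.
have [_ /(sup_norm_fin (weight_gt0 hmu))[M _ [_ HM]]] := mS _ cf.
exists M => z z1; apply: le_trans (HM z z1).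
have [_ _ dS] := Sop_spec hg hphi sphi (holo_ext0 hid).
by rewrite dS// (cderivE (cdiff_ext0 (sphi z z1) (cdiff_id _))) mul1r.
Qed.

End SymbolBound.

Theorem corollary8 (R : realType) (nu mu omega : R[i] -> R) (alpha : R)
    (g phi : R[i] -> R[i])
    (hnu : normal_weight nu) (hmu : normal_weight mu)
    (halpha : -1 < alpha)
    (hpair : normal_pair nu omega alpha)
    (hg : HD R g) (hphi : analytic_self_map phi)
    (hS : bounded_operator (Hinf nu) (Bloch mu) (Sop g phi)) :
  let a := nuclear (Hzero nu) (Bloch mu) (Sop g phi) in
  let b := nuclear (Hinf nu) (Bloch mu) (Sop g phi) in
  let c :=
    (disc_integral (fun zeta : R[i] =>
       ereal_sup [set (mu z * cabs (g z) /
                       cabs (1 - zeta^*%C * phi z) `^ (alpha + 3))%:E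
                 | z in disc R] *
       ((1 - cabs zeta ^+ 2) `^ alpha / nu zeta)%:E) < +oo)%E in
  (a <-> b) /\ (b <-> c).
Proof.
have [_ _ _ [beta hbeta hab]] := hpair.
have [C1 C10 W1] := weight_I hnu hbeta.
have [C2 C20 [G G01 W2]] := weight_II hnu.
have hg' : holo g by exact: HD_holo.
have hphi' : holo phi by apply/analytic_holo; case: hphi.
have sphi : forall z, cabs z < 1 -> cabs (phi z) < 1 by case: hphi.
have [mS _] := hS.
have [Mg HMg] := symbol_bound hnu hmu hg' hphi' sphi mS.
have B0 : 0 < 2 `^ beta :> R by rewrite powR_gt0.
(* [Bn] serves the Forelli-Rudin estimate, [an] the exponent comparison in the converse
   direction. *)
have [n Bn an] : exists2 n, 2 `^ beta * dyadic R n.+1 < 1 & alpha <= n%:R.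
  have i0 : 0 < (2 `^ beta)^-1 :> R by rewrite invr_gt0.
  have [k hk] := dy_small i0.
  exists (maxn k (Num.bound `|alpha|)).
    rewrite mulrC -ltr_pdivlMr// mul1r; apply: lt_le_trans hk.
    apply: (@lt_le_trans _ _ (dyadic R (maxn k (Num.bound `|alpha|)))); last by apply: dy_le; exact: leq_maxl.
    by rewrite (dyS R (maxn _ _)); have := dy_gt0 R (maxn k (Num.bound `|alpha|)).+1; lra.
  apply: ltW; apply: lt_le_trans (_ : (Num.bound `|alpha|)%:R <= _); last by rewrite ler_nat leq_maxr.
  by apply: le_lt_trans (ler_norm _) _; apply: archi_boundP; exact: normr_ge0.
have ba := nuclear_restrict hnu hmu (T := Sop g phi).
have ac := nuclear_integral hnu hmu halpha hab hg' hphi' sphi HMg C10 C20 G01 W1 W2 Bn.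
have cb : (disc_integral (integrand nu mu g phi alpha) < +oo)%E -> nuclear (Hinf nu) (Bloch mu) (Sop g phi).
  move=> /(integral_discrete hnu hmu sphi HMg an)[Q HQ].
  have [e [e' [eK e'K]]] := pair_bijection.
  exact: (discrete_nuclear hnu hmu hg' hphi' sphi HMg C10 B0 W1 HQ eK e'K mS).
move=> a b c; split; split.
- by move=> /ac/cb.
- exact: ba.
- by move=> /ba/ac.
- exact: cb.
Qed.
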